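(* Let $\mathfrak A=\{\mathfrak A_k\}_k$ be an $AB$-closed multiplicative sequence of polynomial ideals which is regular at a Banach space $E$. Then $(M_{b\mathfrak A}(E),\pi)$ is a Riemann domain over $E''$ (i.e. $M_{b\mathfrak A}(E)$ is a Hausdorff space and $\pi:M_{b\mathfrak A}(E)\to E''$ is a local homeomorphism), and each connected component of $(M_{b\mathfrak A}(E),\pi)$ is homeomorphic to $E''$.
   Context: All Banach spaces are complex. $\mathcal P^k(E)$ is the Banach space of continuous $k$-homogeneous polynomials $E\to\mathbb C$; $\check P$ is the symmetric $k$-linear form of $P\in\mathcal P^k(E)$, and for $a\in E$, $P_{a^j}(x)=\check P(a,\dots,a,x,\dots,x)$ ($a$ repeated $j$ times), $P_a=P_{a^1}$. A Banach ideal of (scalar valued continuous) $k$-homogeneous polynomials is a pair $(\mathfrak A_k,\|\cdot\|_{\mathfrak A_k})$ such that: (i) for every Banach space $E$, $\mathfrak A_k(E)=\mathfrak A_k\cap\mathcal P^k(E)$ is a linear subspace of $\mathcal P^k(E)$ and $(\mathfrak A_k(E),\|\cdot\|_{\mathfrak A_k(E)})$ is a Banach space; (ii) if $T\in\mathcal L(E_1,E)$ and $P\in\mathfrak A_k(E)$ then $P\circ T\in\mathfrak A_k(E_1)$ and $\|P\circ T\|_{\mathfrak A_k(E_1)}\le\|P\|_{\mathfrak A_k(E)}\|T\|^k$; (iii) $z\mapsto z^k$ belongs to $\mathfrak A_k(\mathbb C)$ and has norm 1. A sequence $\mathfrak A=\{\mathfrak A_k\}_{k\ge1}$ of such ideals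 is coherent if there are constants $C,D>0$ such that for every Banach space $E$ and $k\in\mathbb N$: $P\in\mathfrak A_{k+1}(E)$, $a\in E$ imply $P_a\in\mathfrak A_k(E)$ and $\|P_a\|_{\mathfrak A_k(E)}\le C\|P\|_{\mathfrak A_{k+1}(E)}\|a\|$; and $P\in\mathfrak A_k(E)$, $\gamma\in E'$ imply $\gamma P\in\mathfrak A_{k+1}(E)$ and $\|\gamma P\|_{\mathfrak A_{k+1}(E)}\le D\|\gamma\|\|P\|_{\mathfrak A_k(E)}$. It is multiplicative if it is coherent and there is a constant $M$ such that for all $k,l$, every Banach space $E$, $P\in\mathfrak A_k(E)$, $Q\in\mathfrak A_l(E)$, one has $PQ\in\mathfrak A_{k+l}(E)$ and $\|PQ\|_{\mathfrak A_{k+l}(E)}\le M^{k+l}\|P\|_{\mathfrak A_k(E)}\|Q\|_{\mathfrak A_l(E)}$. $H_{b\mathfrak A}(E)$ is the space of entire functions $f$ on $E$ with $\frac{d^kf(0)}{k!}\in\mathfrak A_k(E)$ for all $k$ and $\lim_k\|\frac{d^kf(0)}{k!}\|_{\mathfrak A_k(E)}^{1/k}=0$; it is a Fréchet space with the seminorms $p_R(f)=\sum_{k\ge0}\|\frac{d^kf(0)}{k!}\|_{\mathfrak A_k(E)}R^k$, $R>0$ (the $k=0$ term is the constant $f(0)$ with its absolute value), and an algebra when $\mathfrak A$ is multiplicative. $M_{b\mathfrak A}(E)$ is its spectrum: the set of nonzero continuous multiplicative linear functionals on $H_{b\mathfrak A}(E)$. The map $\pi:M_{b\mathfrak A}(E)\to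 E''$ is $\pi(\varphi)=\varphi|_{E'}$. Aron-Berner extension: for $P\in\mathcal P^k(E)$, extend $\check P$ to $E''\times\dots\times E''$ by weak-star continuity one variable at a time in some order (each such extension is an Arens extension of $\check P$) and restrict to the diagonal; this gives $AB(P)\in\mathcal P^k(E'')$. For $f=\sum_kP_k$, $AB(f)=\sum_kAB(P_k)$. $\mathfrak A$ is $AB$-closed if there is $\alpha>0$ such that for every Banach space $E$, every $k$ and $P\in\mathfrak A_k(E)$, $AB(P)\in\mathfrak A_k(E'')$ and $\|AB(P)\|_{\mathfrak A_k(E'')}\le\alpha^k\|P\|_{\mathfrak A_k(E)}$. $\mathfrak A$ is regular at $E$ if for every $k$ and every $P\in\mathfrak A_k(E)$ every Arens extension of $\check P$ is symmetric. $J_E:E\to E''$ is the canonical injection. For $z\in E''$, $\tilde\tau_z:H_{b\mathfrak A}(E)\to H_{b\mathfrak A}(E)$ is $\tilde\tau_z(f)(x)=AB(f)(z+J_Ex)$; it is a well-defined continuous operator and $\varphi\circ\tilde\tau_z\in M_{b\mathfrak A}(E)$ for $\varphi\in M_{b\mathfrak A}(E)$. The topology on $M_{b\mathfrak A}(E)$ is the one with basis the sets $V_{\varphi,\varepsilon}=\{\varphi\circ\tilde\tau_z: z\in E'',\ \|z\|<\varepsilon\}$, $\varphi\in M_{b\mathfrak A}(E)$, $\varepsilon>0$ (under the hypotheses of the claim these sets form a basis of a Hausdorff topology). $E''$ carries its norm topology. *)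

(* Defs.v *)
From HB Require Import structures.
From mathcomp Require Import all_boot all_order all_algebra perm.
From mathcomp Require Import complex lra.
From mathcomp Require Import all_classical all_reals all_analysis.

Set Implicit Arguments.
Unset Strict Implicit.
Unset Printing Implicit Defensive.

Import Order.TTheory GRing.Theory Num.Theory.
Import numFieldNormedType.Exports.

Local Open Scope classical_set_scope.
Local Open Scope ring_scope.

(* The field R[i] as a Banach space over itself. The library has the normed
   module R[i]^o, but its completeness instance for ^o is tied to realType,
   hence this alias. *)
Definition scalars (R : realType) : Type := R[i]^o.

HB.instance Definition _ (R : realType) :=
  GRing.ComAlgebra.copy (scalars R) R[i]^o.
HB.instance Definition _ (R : realType) :=
  NormedModule.copy (scalars R) R[i]^o.

Notation banach R := (completeNormedModType (complex.complex R)).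

(* Over the scalar field R[i] the library norm `|x| lies in R[i] *)
Definition nrm (R : realType) (E : normedModType R[i]) (x : E) : R :=
  complex.Re `|x|.

Section Norm.
Context {R : realType}.
Implicit Types (E : normedModType R[i]).

Lemma nrmE E (x : E) : `|x| = (nrm x)%:C%C.
Proof.
have : 0 <= `|x| by exact: normr_ge0.
by rewrite /nrm; case: `|x| => a b; rewrite lecE /= => /andP[/eqP -> _].
Qed.

Lemma ball_nrmE E (x : E) (e : R) :
  ball x e%:C%C = [set y | nrm (x - y) < e].
Proof.
by apply/seteqP; split=> y; rewrite -ball_normE /= nrmE ltcR.
Qed.

Lemma nrm_ge0 E (x : E) : 0 <= nrm x.
Proof. by rewrite -ler0c -nrmE. Qed.

Lemma nrmD E (x y : E) : nrm (x + y) <= nrm x + nrm y.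
Proof. by rewrite -lecR rmorphD/= -!nrmE ler_normD. Qed.

Lemma nrmZ E (a : R[i]) (x : E) : nrm (a *: x) = nrm (a : scalars R) * nrm x.
Proof. by apply: complexI; rewrite rmorphM/= -!nrmE normrZ. Qed.

Lemma nrm0 E : nrm (0 : E) = 0.
Proof. by apply: complexI; rewrite -nrmE normr0. Qed.

Lemma nrm_eq0 E (x : E) : nrm x = 0 -> x = 0.
Proof. by move=> x0; apply/normr0_eq0; rewrite nrmE x0. Qed.

Lemma nrmB E (x y : E) : nrm (x - y) = nrm (y - x).
Proof. by apply: complexI; rewrite -!nrmE distrC. Qed.

Lemma pos_realC (e : R[i]) : 0 < e -> exists2 d : R, 0 < d & e = d%:C%C.
Proof.
by case: e => u v; rewrite ltcE /= => /andP[/eqP -> u0]; exists u.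
Qed.

Lemma cvg_nrmP E (F : set_system E) (FF : Filter F) (l : E) :
  F --> l <-> forall e, 0 < e -> \forall x \near F, nrm (l - x) < e.
Proof.
split=> [/cvgrPdist_lt Fl e e0|Fl].
  have := Fl e%:C%C; rewrite ltcR => /(_ e0).
  by apply: filterS => x; rewrite nrmE ltcR.
apply/cvgrPdist_lt => _ /pos_realC[e e0 ->].
by apply: filterS (Fl _ e0) => x; rewrite nrmE ltcR.
Qed.

End Norm.


Section Scalars.
Variable R : realType.

Lemma nrm_scalarE (z : scalars R) :
  nrm z = Num.sqrt (complex.Re z ^+ 2 + complex.Im z ^+ 2).
Proof. by rewrite /nrm normc_def. Qed.

Lemma le_Re_nrm (z : scalars R) : `|complex.Re z| <= nrm z.
Proof. by rewrite nrm_scalarE -sqrtr_sqr ler_wsqrtr// lerDl sqr_ge0. Qed.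

Lemma le_Im_nrm (z : scalars R) : `|complex.Im z| <= nrm z.
Proof. by rewrite nrm_scalarE -sqrtr_sqr ler_wsqrtr// lerDr sqr_ge0. Qed.

Lemma le_nrm_ReIm (z : scalars R) :
  nrm z <= `|complex.Re z| + `|complex.Im z|.
Proof.
rewrite nrm_scalarE -[leRHS]ger0_norm ?addr_ge0// -sqrtr_sqr ler_wsqrtr//.
rewrite sqrrD !real_normK ?num_real// addrAC lerDl.
by rewrite mulrn_wge0// mulr_ge0.
Qed.

Lemma scalars_complete (F : set_system (scalars R)) :
  ProperFilter F -> cauchy F -> cvg F.
Proof.
move=> FF /cauchyP cF.
have part (p : scalars R -> R) :
    (forall x y, `|p x - p y| <= nrm (x - y)) -> cvg (p @ F).
  move=> pB; apply: R_complete; apply/cauchyP => e e0.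
  have [|x Fx] := cF e%:C%C; first by rewrite ltcR.
  exists (p x); apply: (@filterS _ F _ _ _ _ Fx) => y; rewrite ball_nrmE -ball_normE /=.
  by apply: le_lt_trans; exact: pB.
have /cvg_ex[/= a Fa] : cvg (@complex.Re R @ F).
  by apply: part => x y; rewrite -raddfB; exact: le_Re_nrm.
have /cvg_ex[/= b Fb] : cvg (@complex.Im R @ F).
  by apply: part => x y; rewrite -raddfB; exact: le_Im_nrm.
apply/cvg_ex; exists ((a +i* b)%C : scalars R).
apply/cvg_nrmP => e e0.
move/cvgrPdist_lt : Fa => /(_ _ (divr_gt0 e0 (ltr0n _ 2))) Fa.
move/cvgrPdist_lt : Fb => /(_ _ (divr_gt0 e0 (ltr0n _ 2))) Fb.
near=> z; apply: le_lt_trans (le_nrm_ReIm _) _.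
rewrite [ltRHS]splitr !raddfB /= ltrD//; near: z.
  exact: Fa.
exact: Fb.
Unshelve. all: by end_near. Qed.

HB.instance Definition _ := Uniform_isComplete.Build (scalars R)
  scalars_complete.

End Scalars.


Section ContinuousLinear.
Context {R : realType}.

Definition clinear (E F : normedModType R[i]) : {pred E -> F} :=
  [pred f | `[< linear f /\ continuous f >]].

Record clin (E F : normedModType R[i]) :=
  Clin { clin_fun :> E -> F ; clinP : clin_fun \in @clinear E F }.

HB.instance Definition _ (E F : normedModType R[i]) :=
  [isSub for @clin_fun E F].
HB.instance Definition _ (E F : normedModType R[i]) :=
  [Choice of clin E F by <:].

Variables E F : normedModType R[i].

Lemma clinearP (f : E -> F) :
  reflect (linear f /\ continuous f) (f \in @clinear E F).
Proof. exact: asboolP. Qed.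

Lemma clinear_submod_closed : submod_closed (@clinear E F).
Proof.
split=> [|a f g /clinearP[lf cf] /clinearP[lg cg]]; apply/clinearP; split.
- by move=> a x y; rewrite scaler0 addr0.
- exact: cst_continuous.
- move=> b x y; rewrite /= !fctE lf lg !scalerDr !scalerA (mulrC a b).
  by rewrite addrACA.
- by move=> x; apply: cvgD; [apply: cvgZl_tmp; exact: cf|exact: cg].
Qed.

HB.instance Definition _ := GRing.isSubmodClosed.Build _ _ (@clinear E F)
  clinear_submod_closed.
HB.instance Definition _ := [SubChoice_isSubLmodule of clin E F by <:].

Implicit Types f g : clin E F.

Lemma clin_linear f : linear f.
Proof. by have /clinearP[] := clinP f. Qed.

HB.instance Definition _ f :=
  GRing.isLinear.Build R[i] E F *:%R f (clin_linear f).

Lemma clin_continuous f : continuous f.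
Proof. by have /clinearP[] := clinP f. Qed.

Lemma bounded_clinear (u : E -> F) (M : R) : linear u ->
  (forall x, nrm (u x) <= M * nrm x) -> u \in @clinear E F.
Proof.
move=> lu uM; apply/clinearP; split=> // x; apply/cvg_nrmP => e e0.
have uB y z : u (y - z) = u y - u z.
  by have := lu (-1) z y; rewrite !scaleN1r [- z + y]addrC [- _ + _]addrC.
have M0 : 0 < `|M| + 1 by rewrite ltr_pwDr.
have xe : \forall y \near x, nrm (x - y) < e / (`|M| + 1).
  by have /cvg_nrmP := @cvg_id _ (nbhs x); apply; exact: divr_gt0.
apply: (@filterS _ (nbhs x) _ _ _ _ xe) => y /=; rewrite ltr_pdivlMr// mulrC => xy.
rewrite -uB; apply: le_lt_trans (uM _) (le_lt_trans _ xy).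
by rewrite ler_wpM2r ?nrm_ge0// ler_wpDr// ler_norm.
Qed.

Lemma clin_ext f g : f =1 g -> f = g.
Proof. by move=> /funext fg; exact: val_inj. Qed.

Definition opnorm f : R := sup [set nrm (f x) | x in [set x | nrm x <= 1]].

Lemma clin_bounded f : exists2 M, 0 <= M & forall x, nrm (f x) <= M * nrm x.
Proof.
have /linear_bounded_continuous/linear_boundedP : continuous f.
  exact: clin_continuous.
move=> /pinfty_ex_gt0[_ /pos_realC[M M0 ->] fM]; exists M; first exact: ltW.
by move=> x; have := fM x; rewrite !nrmE -rmorphM lecR.
Qed.

Lemma opnorm_has_sup f :
  has_sup [set nrm (f x) | x in [set x | nrm x <= 1]].
Proof.
split; first by exists (nrm (f 0)), 0 => //=; rewrite nrm0.
have [M M0 fM] := clin_bounded f.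
exists M => _ [x /= x1 <-]; apply: le_trans (fM x) _.
by rewrite -[leRHS]mulr1 ler_wpM2l.
Qed.

Lemma opnorm_ge0 f : 0 <= opnorm f.
Proof.
apply: le_trans (nrm_ge0 (f 0)) _.
by apply: (sup_upper_bound (opnorm_has_sup f)); exists 0 => //=; rewrite nrm0.
Qed.

Lemma le_opnorm f x : nrm (f x) <= opnorm f * nrm x.
Proof.
have [/nrm_eq0->|x0] := eqVneq (nrm x) 0.
  by rewrite linear0 !nrm0 mulr0.
have nx : nrm ((nrm x)%:C%C : scalars R) = nrm x.
  by rewrite nrm_scalarE /= expr0n addr0 sqrtr_sqr ger0_norm ?nrm_ge0.
pose a := ((nrm x)^-1)%:C%C : R[i].
have na : nrm (a : scalars R) = (nrm x)^-1.
  rewrite nrm_scalarE /= expr0n addr0 sqrtr_sqr ger0_norm// invr_ge0.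
  exact: nrm_ge0.
have : nrm (f (a *: x)) <= opnorm f.
  apply: (sup_upper_bound (opnorm_has_sup f)).
  by exists (a *: x) => //=; rewrite nrmZ na mulVf.
rewrite linearZ /= nrmZ na mulrC ler_pdivrMr// lt_neqAle eq_sym x0.
exact: nrm_ge0.
Qed.

Lemma opnorm_le f M : 0 <= M -> (forall x, nrm (f x) <= M * nrm x) ->
  opnorm f <= M.
Proof.
move=> M0 fM; apply: ge_sup; first by have [] := opnorm_has_sup f.
move=> _ [x /= x1 <-]; apply: le_trans (fM x) _.
by rewrite -[leRHS]mulr1 ler_wpM2l.
Qed.

Let norm f : R[i] := (opnorm f)%:C%C.

Let norm_normD f g : norm (f + g) <= norm f + norm g.
Proof.
rewrite /norm -rmorphD lecR; apply: opnorm_le => [|x].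
  by rewrite addr_ge0// opnorm_ge0.
apply: le_trans (nrmD _ _) _.
by rewrite mulrDl lerD// le_opnorm.
Qed.

Let opnormZ_le a f : opnorm (a *: f) <= nrm (a : scalars R) * opnorm f.
Proof.
apply: opnorm_le => [|x]; first by rewrite mulr_ge0// ?nrm_ge0 ?opnorm_ge0.
by rewrite [X in nrm X <= _]/= nrmZ -mulrA ler_wpM2l ?nrm_ge0 ?le_opnorm.
Qed.

Let norm_normrZ (a : R[i]) f : norm (a *: f) = `|a| * norm f.
Proof.
rewrite /norm (nrmE (a : scalars R)) -rmorphM; congr (_%:C)%C.
apply/eqP; rewrite eq_le opnormZ_le /=.
have [->|a0] := eqVneq a 0; first by rewrite nrm0 mul0r opnorm_ge0.
have na : nrm (a : scalars R) != 0 by apply: contra a0 => /eqP/nrm_eq0/eqP.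
have na0 : 0 < nrm (a : scalars R) by rewrite lt_neqAle eq_sym na nrm_ge0.
rewrite -ler_pdivlMl// -[in leLHS](scale1r f) -(mulVf a0) -scalerA.
apply: le_trans (opnormZ_le _ _) _; rewrite ler_wpM2r ?opnorm_ge0//.
suff -> : nrm (a^-1 : scalars R) = (nrm (a : scalars R))^-1 by [].
apply: (mulfI na); rewrite -nrmZ divff// [_ *: _]mulfV//.
by rewrite /nrm normr1.
Qed.

Let norm_normr0_eq0 f : norm f = 0 -> f = 0.
Proof.
move=> /complexI f0; apply: clin_ext => x; apply: nrm_eq0.
by apply/eqP; rewrite eq_le nrm_ge0 andbT -(mul0r (nrm x)) -f0 le_opnorm.
Qed.

HB.instance Definition _ := Lmodule_isNormed.Build R[i] (clin E F)
  norm_normD norm_normrZ norm_normr0_eq0.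

Lemma nrm_clin f : nrm f = opnorm f.
Proof. by []. Qed.

End ContinuousLinear.

Section ContinuousLinearComplete.
Context {R : realType}.
Variables (E : normedModType R[i]) (F : completeNormedModType R[i]).

Lemma clin_complete (G : set_system (clin E F)) :
  ProperFilter G -> cauchy G -> cvg G.
Proof.
move=> GG /cauchyP cG.
have Gcauchy (e : R) : 0 < e -> exists f0, G [set f | nrm (f0 - f) < e].
  move=> e0; have [|f0] := cG e%:C%C; first by rewrite ltcR.
  by rewrite ball_nrmE; exists f0.
have cev x : cvg ((fun f : clin E F => f x) @ G).
  apply: cauchy_cvg; apply/cauchyP => _ /pos_realC[e e0 ->].
  have nx : 0 < nrm x + 1 by rewrite ltr_pwDr// nrm_ge0.
  have [f0 Gf0] := Gcauchy _ (divr_gt0 e0 nx).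
  exists (f0 x); rewrite ball_nrmE; apply: (@filterS _ G _ _ _ _ Gf0) => f /=.
  rewrite ltr_pdivlMr// => ff0; apply: le_lt_trans ff0.
  apply: le_trans (le_opnorm (f0 - f) x) _.
  by rewrite ler_wpM2l ?opnorm_ge0// lerDl.
pose g x : F := lim ((fun f : clin E F => f x) @ G).
have gP x : (fun f : clin E F => f x) @ G --> g x by exact: cev.
have lg : linear g.
  move=> a x y; apply: norm_cvg_unique (gP _) _ => /=.
  rewrite (_ : (fun f : clin E F => f (a *: x + y)) =
               (fun f : clin E F => a *: f x + f y)); last first.
    by apply/funext => f; rewrite linearP.
  by apply: cvgD; [apply: cvgZl_tmp; exact: gP|exact: gP].
have gle (f0 : clin E F) e : 0 < e -> G [set f | nrm (f0 - f) < e] ->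
    forall x, nrm (g x - f0 x) <= e * nrm x.
  move=> e0 Gf0 x; apply/ler_addgt0Pr => d d0.
  have gd : G [set f | nrm (g x - f x) < d] by have /cvg_nrmP := gP x; apply.
  have [f [/= gf ff0]] := filter_ex (filterI gd Gf0).
  rewrite -(subrK (f x) (g x)) -addrA addrC; apply: le_trans (nrmD _ _) _.
  rewrite lerD ?(ltW gf)// nrmB; apply: le_trans (le_opnorm (f0 - f) x) _.
  by rewrite ler_wpM2r ?nrm_ge0// ltW.
have [f1 Gf1] := Gcauchy _ ltr01.
have gin : g \in @clinear _ E F.
  apply: (@bounded_clinear _ _ _ _ (1 + opnorm f1)) => // x.
  rewrite -(subrK (f1 x) (g x)); apply: le_trans (nrmD _ _) _.
  by rewrite mulrDl lerD ?le_opnorm// gle.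
apply/cvg_ex; exists (Clin gin); apply/cvg_nrmP => e e0.
have e3 : 0 < e / 3 by rewrite divr_gt0.
have [f0 Gf0] := Gcauchy _ e3.
apply: (@filterS _ G _ _ _ _ Gf0) => f /= ff0.
apply: le_lt_trans (_ : opnorm _ <= e / 3 + e / 3) _; last by lra.
apply: opnorm_le => [|x]; first by rewrite addr_ge0// ltW.
rewrite [X in nrm X](_ : _ = (g x - f0 x) + (f0 - f) x); last first.
  by rewrite /= addrA subrK.
apply: le_trans (nrmD _ _) _; rewrite mulrDl lerD ?gle//.
by apply: le_trans (le_opnorm _ _) _; rewrite ler_wpM2r ?nrm_ge0// ltW.
Qed.

HB.instance Definition _ := Uniform_isComplete.Build (clin E F) clin_complete.

End ContinuousLinearComplete.

Notation dual E := (clin E (scalars _)).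
Notation bidual E := (dual (dual E)).

Section Bidual.
Context {R : realType} {E : normedModType R[i]}.

Lemma canon_clinear (x : E) :
  (fun g : dual E => g x) \in @clinear R (dual E) (scalars R).
Proof.
apply: (@bounded_clinear _ _ _ _ (nrm x)) => [a g h //|g].
by rewrite mulrC le_opnorm.
Qed.

Definition canon (x : E) : bidual E := Clin (canon_clinear x).

Definition weakstar : Type :=
  initial_topology (fun g : dual E => (g : {ptws E -> scalars R})).

HB.instance Definition _ := Topological.on weakstar.

End Bidual.

Arguments weakstar {R} E.

Section Polynomials.
Context {R : realType}.
Implicit Types E : normedModType R[i].

Definition multilinear k E (L : ('I_k -> E) -> scalars R) : Prop :=
  forall (x : 'I_k -> E) (i : 'I_k),
    linear (fun y : E => L [eta x with i |-> y]).

Definition symmetric_form k E (L : ('I_k -> E) -> scalars R) : Prop :=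
  forall (s : 'S_k) (x : 'I_k -> E), L (x \o s) = L x.

Definition hpoly k E : set (E -> scalars R) :=
  [set P | continuous P /\
    exists2 L : ('I_k -> E) -> scalars R,
      multilinear L & forall x, P x = L (fun=> x)].

(* The symmetric k-linear form of P, unique by the polarization formula *)
Definition polar k E (P : E -> scalars R) : ('I_k -> E) -> scalars R :=
  xget (fun=> 0) [set L | [/\ multilinear L, symmetric_form L &
                             forall x, P x = L (fun=> x)]].

(* P_a, for P homogeneous of degree k + 1 *)
Definition pfix k E (P : E -> scalars R) (a : E) : E -> scalars R :=
  fun x => polar P [eta (fun=> x) : 'I_k.+1 -> E with ord0 |-> a].

(* B extends the k-linear form L to E'' x ... x E'' by weak-star continuity, one
   variable at a time, the variable of index s j being the j-th one to be
   extended: at that stage the variables s i with i < j range over E'' and the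
   variables s i with i > j still range over E. *)
Definition arens_extension k E (s : 'S_k) (L : ('I_k -> E) -> scalars R)
    (B : ('I_k -> bidual E) -> scalars R) : Prop :=
  (forall x : 'I_k -> E, B (canon \o x) = L x) /\
  forall (j : 'I_k) (z : 'I_k -> bidual E),
    (forall i : 'I_k, (j < i)%N -> range canon (z (s i))) ->
    continuous (fun w : weakstar (dual E) => B [eta z with s j |-> w]).

(* The Aron-Berner extension. The order of the variables is immaterial on the
   diagonal because the form of P is symmetric; we take the increasing one. *)
Definition aron_berner k E (P : E -> scalars R) : bidual E -> scalars R :=
  fun z => xget (fun=> 0) (@arens_extension k E 1%g (polar P)) (fun=> z).

Definition power_series_at E (f : E -> scalars R) (a : E)
    (P : nat -> E -> scalars R) : Prop :=
  (forall k, hpoly k (P k)) /\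
  exists2 r : R, 0 < r &
    {uniform [set x | nrm (x - a) < r],
      (fun n x => \sum_(k < n) P k (x - a)) @ \oo --> f}.

Definition entire E (f : E -> scalars R) : Prop :=
  forall a, exists P, power_series_at f a P.

(* taylor f k is d^k f(0) / k!, the k-th term of the expansion of f at 0 *)
Definition taylor E (f : E -> scalars R) : nat -> E -> scalars R :=
  xget (fun=> cst 0) (power_series_at f 0).

Definition AB E (f : E -> scalars R) : bidual E -> scalars R :=
  fun z => limn (series (fun k => aron_berner k (taylor f k) z)).

End Polynomials.

Arguments hpoly {R} k E.
Arguments pfix {R} k {E}.
Arguments aron_berner {R} k {E}.

Record poly_ideal (R : realType) := PolyIdeal {
  ideal_set :> forall E : banach R, set (E -> scalars R) ;
  ideal_norm : forall E : banach R, (E -> scalars R) -> R }.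

Arguments ideal_norm {R} _ {E}.

Record banach_ideal (R : realType) (k : nat) (A : poly_ideal R) : Prop := {
  ideal_hpoly : forall E : banach R, A E `<=` hpoly k E ;
  ideal_0 : forall E : banach R, A E 0 ;
  ideal_linear : forall (E : banach R) (a : R[i]) (P Q : E -> scalars R),
    A E P -> A E Q -> A E (a *: P + Q) ;
  ideal_normD : forall (E : banach R) (P Q : E -> scalars R),
    A E P -> A E Q -> ideal_norm A (P + Q) <= ideal_norm A P + ideal_norm A Q ;
  ideal_normZ : forall (E : banach R) (a : scalars R) (P : E -> scalars R),
    A E P -> ideal_norm A (a *: P) = nrm a * ideal_norm A P ;
  ideal_norm_eq0 : forall (E : banach R) (P : E -> scalars R),
    A E P -> ideal_norm A P = 0 -> P = 0 ;
  ideal_complete : forall (E : banach R) (u : nat -> E -> scalars R),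
    (forall n, A E (u n)) ->
    (forall e, 0 < e -> exists N, forall m n, (N <= m)%N -> (N <= n)%N ->
      ideal_norm A (u m - u n) < e) ->
    exists2 P, A E P & ideal_norm A (u n - P) @[n --> \oo] --> 0 ;
  ideal_comp : forall (E1 E : banach R) (T : clin E1 E) (P : E -> scalars R),
    A E P -> A E1 (P \o T) /\
      ideal_norm A (P \o T) <= ideal_norm A P * nrm T ^+ k ;
  ideal_pow : A (scalars R) (fun z => z ^+ k) /\
    ideal_norm A (fun z : scalars R => z ^+ k) = 1 }.

(* Sequences of ideals start at k = 1: A 0 is never used. *)

Record coherent (R : realType) (A : nat -> poly_ideal R) : Prop := {
  coherent_ideal : forall k, (0 < k)%N -> banach_ideal k (A k) ;
  coherent_bounds : exists C D : R, [/\ 0 < C, 0 < D &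
    forall (E : banach R) k, (0 < k)%N ->
      (forall (P : E -> scalars R) (a : E), A k.+1 E P ->
        A k E (pfix k P a) /\
        ideal_norm (A k) (pfix k P a) <= C * ideal_norm (A k.+1) P * nrm a) /\
      (forall (P : E -> scalars R) (g : dual E), A k E P ->
        A k.+1 E (fun x => g x * P x) /\
        ideal_norm (A k.+1) (fun x => g x * P x)
          <= D * nrm g * ideal_norm (A k) P)] }.

Record multiplicative_seq (R : realType) (A : nat -> poly_ideal R) : Prop := {
  multiplicative_coherent : coherent A ;
  multiplicative_bound : exists M : R,
    forall k l, (0 < k)%N -> (0 < l)%N ->
    forall (E : banach R) (P Q : E -> scalars R), A k E P -> A l E Q ->
      A (k + l)%N E (fun x => P x * Q x) /\
      ideal_norm (A (k + l)%N) (fun x => P x * Q x)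
        <= M ^+ (k + l) * ideal_norm (A k) P * ideal_norm (A l) Q }.

Definition AB_closed (R : realType) (A : nat -> poly_ideal R) : Prop :=
  exists2 alpha : R, 0 < alpha &
    forall (E : banach R) k, (0 < k)%N -> forall P : E -> scalars R, A k E P ->
      A k (bidual E) (aron_berner k P) /\
      ideal_norm (A k) (aron_berner k P) <= alpha ^+ k * ideal_norm (A k) P.

Definition regular_at (R : realType) (A : nat -> poly_ideal R) (E : banach R) :
    Prop :=
  forall k, (0 < k)%N -> forall P : E -> scalars R, A k E P ->
  forall (s : 'S_k) (B : ('I_k -> bidual E) -> scalars R),
    arens_extension s (polar P) B -> symmetric_form B.

Section Spectrum.
Context {R : realType}.
Variables (A : nat -> poly_ideal R) (E : banach R).

Record in_Hb (f : E -> scalars R) : Prop := {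
  Hb_entire : entire f ;
  Hb_ideal : forall k, (0 < k)%N -> A k E (taylor f k) ;
  Hb_lim : (ideal_norm (A k) (taylor f k) `^ k%:R^-1) @[k --> \oo] --> (0 : R) }.

Definition Hb : Type := {f : E -> scalars R | in_Hb f}.

HB.instance Definition _ := gen_eqMixin Hb.
HB.instance Definition _ := gen_choiceMixin Hb.

Definition Hb_seminorm (r : R) (f : E -> scalars R) : R :=
  limn (series (fun k =>
    (if k == 0%N then nrm (f 0) else ideal_norm (A k) (taylor f k)) * r ^+ k)).

HB.instance Definition _ := isSubBaseTopological.Build Hb
  [set U | exists (f : Hb) (r e : R), [/\ 0 < r, 0 < e &
    U = [set g : Hb | Hb_seminorm r (sval g - sval f) < e]]]
  (fun U : set Hb => U).

(* Linearity and multiplicativity are stated without the closure of H_bA(E)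
   under the operations, which holds only for a suitable A. *)
Record is_character (phi : Hb -> scalars R) : Prop := {
  character_linear : forall (a : R[i]) (f g h : Hb),
    sval h = a *: sval f + sval g -> phi h = a *: phi f + phi g ;
  character_mul : forall f g h : Hb,
    sval h = (fun x => sval f x * sval g x) -> phi h = phi f * phi g ;
  character_continuous : continuous phi ;
  character_neq0 : exists f, phi f != 0 }.

Definition spectrum : Type := {phi : Hb -> scalars R | is_character phi}.

HB.instance Definition _ := gen_eqMixin spectrum.
HB.instance Definition _ := gen_choiceMixin spectrum.

(* f |-> AB(f)(z + J_E x); the default value f is for the case, excluded when A
   is AB-closed and multiplicative, of a translate outside H_bA(E). *)
Definition tau (z : bidual E) (f : Hb) : Hb :=
  xget f [set g : Hb | sval g = (fun x => AB (sval f) (z + canon x))].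

Definition spectrum_nbhd (phi : spectrum) (e : R) : set spectrum :=
  [set psi | exists2 z : bidual E,
    nrm z < e & sval psi = sval phi \o tau z].

(* The sets spectrum_nbhd phi e form a basis only for a suitable A, hence the
   construction from a subbase, which is the same topology in that case. *)
HB.instance Definition _ := isSubBaseTopological.Build spectrum
  [set U | exists (phi : spectrum) (e : R), 0 < e /\ U = spectrum_nbhd phi e]
  (fun U : set spectrum => U).

(* The restriction of phi to E', which lies in H_bA(E) for a suitable A *)
Definition spectrum_proj (phi : spectrum) : bidual E :=
  xget 0 [set z : bidual E | forall (g : dual E) (f : Hb),
    sval f = g :> (E -> scalars R) -> z g = sval phi f].

End Spectrum.

Definition local_homeomorphism (X Y : topologicalType) (p : X -> Y) : Prop :=
  forall x, exists U : set X, [/\ open U, U x, open (p @` U),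
    {within U, continuous p} &
    exists2 q : Y -> X, {in U, cancel p q} & {within p @` U, continuous q}].

Definition riemann_domain (X Y : topologicalType) (p : X -> Y) : Prop :=
  hausdorff_space X /\ local_homeomorphism p.

Definition homeomorphic (X Y : topologicalType) : Prop :=
  exists (f : X -> Y) (g : Y -> X),
    [/\ cancel f g, cancel g f, continuous f & continuous g].

(* Main.v *)
From HB Require Import structures.
From mathcomp Require Import all_boot all_order all_algebra perm.
From mathcomp Require Import fingroup complex lra ring zify.
From mathcomp Require Import all_classical all_reals all_analysis.

Require Import Defs.

Set Implicit Arguments.
Unset Strict Implicit.
Unset Printing Implicit Defensive.

Import Order.TTheory GRing.Theory Num.Theory.
Import numFieldNormedType.Exports.

Local Open Scope classical_set_scope.
Local Open Scope ring_scope.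

(** The bidual E'' acts on the spectrum by phi |-> phi \o tau z, and the
    projection is equivariant: spectrum_proj (phi \o tau z) =
    spectrum_proj phi + z (proj_act). Hence the action is free, and the basic
    neighbourhoods V_(phi, e) are the images of the balls of radius e under the
    orbit maps. On the orbit (sheet) of phi the projection has the inverse
    w |-> phi \o tau (w - spectrum_proj phi), and both maps are continuous because
    V_(phi, e) projects onto the ball of radius e around spectrum_proj phi. The
    orbits are open, therefore closed since they form a partition, and connected
    as images of E'': they are the connected components. Two characters with
    different projections are separated by neighbourhoods with disjoint
    projections; two characters with the same projection lie on different sheets
    unless they are equal, because the action is free.

    What needs work is that there is an action at all: tau z must be a continuous
    algebra endomorphism of H_bA(E) (tau_linear, tau_mul, tau_continuous), with
    tau 0 = id (tau0) and tau w \o tau z = tau (z + w) (tauD).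

    The group law rests on regularity. Call a homogeneous polynomial on E''
    weak-star if it is the diagonal of a multilinear form that is weak-star
    continuous in each variable (wpoly). Since E is weak-star dense in E'', such a
    polynomial is the Aron-Berner extension of its restriction to E (wpoly_AB); and
    regularity at E says exactly that Aron-Berner extensions of members of A are
    weak-star (regular_AB). Weak-star polynomials are stable under linear
    combinations, products and the operation of fixing some of the variables.
    Continuity of the Aron-Berner extension for the norms of A then passes the
    identity G = AB (G \o J) to limits (AB_fixed_limit), in particular to the
    Taylor coefficients of w |-> AB f (z + w). This yields
    AB (tau z f) = AB f (z + .) (AB_translate), and with it the group law.
    Linearity and multiplicativity of AB come from the same description of the
    Aron-Berner extension.

    The analytic part is one estimate (translate). If f = sum_k P_k with all
    sum_k ||P_k|| r^k finite, the n-th Taylor coefficient of f at a is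
    sum_k binom(k, n) (P_k)_(a^(k-n)), which converges in A_n by coherence, and
    p_r (f (a + .)) <= p_(r + C |a|) (f). It shows at once that such sums are entire,
    that tau z maps H_bA(E) to itself, and that tau z is continuous. The converse,
    that a function of H_bA(E) is the sum of its Taylor series on the whole of E,
    is the identity theorem (entire_identity). *)

(** * Symmetric multilinear forms *)

Section Forms.
Context {R : realType} {E : normedModType R[i]}.
Implicit Types (K : set (E -> scalars R)).

Definition upd (T : Type) k (x : 'I_k -> T) (i : 'I_k) (y : T) : 'I_k -> T :=
  fun j => if j == i then y else x j.

Lemma upd_comp (T : Type) k (x : 'I_k -> T) i y (s : 'S_k) :
  upd x i y \o s = upd (x \o s) ((s^-1)%g i) y.
Proof.
apply/funext => j; rewrite /upd /=; congr (if _ then _ else _).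
by apply/eqP/eqP => [<-|->]; rewrite ?permK ?permKV.
Qed.

Lemma upd_id (T : Type) k (x : 'I_k -> T) i : upd x i (x i) = x.
Proof. by apply/funext => j; rewrite /upd; case: eqP => // ->. Qed.

Lemma upd_swap (T : Type) k (x : 'I_k -> T) i j y z : i != j ->
  upd (upd x i y) j z = upd (upd x j z) i y.
Proof.
move=> ij; apply/funext => l; rewrite /upd; case: eqP => // ->.
by rewrite eq_sym (negbTE ij).
Qed.

(** Multilinearity and separate weak-star continuity are both of this shape; the
    common form lets symmetrization be treated once. *)
Definition slotwise k (K : set (E -> scalars R)) (L : ('I_k -> E) -> scalars R) :=
  forall x i, K (fun y => L (upd x i y)).

Lemma multilinearE k (L : ('I_k -> E) -> scalars R) :
  multilinear L <-> slotwise (fun f => linear f) L.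
Proof. by split => lL x i; exact: lL. Qed.

Definition lin_closed (K : set (E -> scalars R)) :=
  K (fun=> 0) /\ forall (a : R[i]) f g, K f -> K g -> K (fun y => a *: f y + g y).

Lemma lin_closed_sum (K : set (E -> scalars R)) (I : Type) (r : seq I)
    (f : I -> E -> scalars R) : lin_closed K ->
  (forall i, K (f i)) -> K (fun y => \sum_(i <- r) f i y).
Proof.
move=> [K0 KD] Kf; elim: r => [|i r IH].
  by under eq_fun do rewrite big_nil.
under eq_fun do rewrite big_cons -[f i _]scale1r.
exact: KD.
Qed.

Lemma lin_closedZ (K : set (E -> scalars R)) (a : R[i]) f : lin_closed K ->
  K f -> K (fun y => a *: f y).
Proof.
move=> [K0 KD] Kf; under eq_fun do rewrite -[_ *: _]addr0.
exact: KD.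
Qed.

Lemma linear_lin_closed : lin_closed (fun f => linear f).
Proof.
split=> [a x y|a f g lf lg b x y]; first by rewrite scaler0 addr0.
rewrite lf lg !scalerDr !scalerA (mulrC a b) addrACA //.
Qed.

Definition symz k (L : ('I_k -> E) -> scalars R) (x : 'I_k -> E) : scalars R :=
  ((k`!)%:R^-1 : R[i]) *: \sum_(s : 'S_k) L (x \o s).

Lemma symz_sym k (L : ('I_k -> E) -> scalars R) : symmetric_form (symz L).
Proof.
move=> t x; rewrite /symz; congr (_ *: _).
rewrite (reindex_inj (mulIg (t^-1)%g)); apply: eq_bigr => s _.
by congr L; apply/funext => i /=; rewrite permM permKV.
Qed.

Lemma symz_diag k (L : ('I_k -> E) -> scalars R) (x : E) : symz L (fun=> x) = L (fun=> x).
Proof.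
by rewrite /symz (eq_bigr (fun=> L (fun=> x)))// sumr_const card_Sn
  -[X in _ *: X](scaler_nat (k`!)) scalerA mulVf ?scale1r//.
Qed.

Lemma symz_slot k K (L : ('I_k -> E) -> scalars R) : lin_closed K ->
  slotwise K L -> slotwise K (symz L).
Proof.
move=> Kc KL x i; apply: lin_closedZ => //; apply: lin_closed_sum => // s.
by under eq_fun do rewrite upd_comp; exact: KL.
Qed.

(** Symmetric forms of degree k on lists of length k. Lists make it easy to fix,
    repeat or permute arguments; by symmetry, linearity in the head suffices. *)
Definition symlist k (F : seq E -> scalars R) :=
  (forall s t : seq E, size s = k -> perm_eq s t -> F s = F t) /\
  (forall s : seq E, (size s).+1 = k -> linear (fun y : E => F (y :: s))).

Lemma symlist_binom k F n (s : seq E) (x y : E) : symlist k F -> (n + size s = k)%N ->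
  F (nseq n (x + y) ++ s) =
  \sum_(j < n.+1) 'C(n, j)%:R * F (nseq (n - j) x ++ nseq j y ++ s).
Proof.
move=> [Fs Fl]; elim: n s => [|n IH] s nk.
  by rewrite big_ord_recl big_ord0 bin0 mul1r addr0.
have sz (u : E) : (n + size (u :: s))%N = k by rewrite /= addnS.
have FD : F (nseq n.+1 (x + y) ++ s) =
    F (nseq n (x + y) ++ (x :: s)) + F (nseq n (x + y) ++ (y :: s)).
  have mv (u v : E) : F (nseq n v ++ (u :: s)) = F (u :: nseq n v ++ s).
    by apply: Fs; rewrite ?size_cat ?size_nseq ?sz// perm_catC /= perm_cons perm_catC.
  rewrite !mv /=.
  have /= := Fl (nseq n (x + y) ++ s) _ 1 x y; rewrite !scale1r; apply.
  by rewrite size_cat size_nseq.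
rewrite FD !IH//; set G := fun j => F (nseq (n.+1 - j) x ++ nseq j y ++ s).
rewrite (eq_bigr (fun j : 'I_n.+1 => 'C(n, j)%:R * G j)); last first.
  move=> j _; congr (_ * _); rewrite /G subSn; last by rewrite -ltnS.
  apply: Fs; first by rewrite !size_cat !size_nseq /=; have := ltn_ord j; lia.
  apply/seq.permP => p /=; rewrite !(count_cat, count_nseq) /= ?(count_cat, count_nseq); lia.
rewrite [X in _ + X](eq_bigr (fun j : 'I_n.+1 => 'C(n, j)%:R * G j.+1)); last first.
  move=> j _; congr (_ * _); rewrite /G subSS.
  apply: Fs; first by rewrite !size_cat !size_nseq /=; have := ltn_ord j; lia.
  apply/seq.permP => p /=; rewrite !(count_cat, count_nseq) /= ?(count_cat, count_nseq); lia.
rewrite [RHS]big_ord_recl /= bin0 [X in X + _ = _]big_ord_recl /= bin0 -addrA.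
congr (_ + _); rewrite [X in _ = X](eq_bigr (fun j : 'I_n.+1 =>
   'C(n, j.+1)%:R * G j.+1 + 'C(n, j)%:R * G j.+1)); last first.
  by move=> j _; rewrite /bump /= add1n binS natrD mulrDl.
rewrite big_split /=; congr (_ + _).
by rewrite [RHS]big_ord_recr /= bin_small// mul0r addr0.
Qed.

Lemma symlist_hom k F n (s : seq E) (t : R[i]) (y : E) : symlist k F -> (n + size s = k)%N ->
  F (nseq n (t *: y) ++ s) = t ^+ n *: F (nseq n y ++ s).
Proof.
move=> [Fs Fl]; elim: n s => [|n IH] s nk; first by rewrite scale1r.
have mv (u v : E) : F (u :: nseq n v ++ s) = F (nseq n v ++ (u :: s)).
  apply/esym/Fs; last by rewrite perm_catC /= perm_cons perm_catC.
  by rewrite size_cat size_nseq /= addnS.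
have /= := Fl (nseq n (t *: y) ++ s) _ t y 0.
rewrite addr0 => ->; last by rewrite size_cat size_nseq.
have -> : F (0 :: nseq n (t *: y) ++ s) = 0.
  have /= := Fl (nseq n (t *: y) ++ s) _ (-1) 0 0.
  rewrite scaler0 addr0 scaleN1r addNr; apply.
  by rewrite size_cat size_nseq.
rewrite addr0 (mv y (t *: y)) IH; last by rewrite /= addnS.
by rewrite scalerA exprS (mv y y).
Qed.

Lemma symlist_homr k F m n (s : seq E) (t : R[i]) (x y : E) : symlist k F ->
  (m + (n + size s) = k)%N ->
  F (nseq m x ++ nseq n (t *: y) ++ s) = t ^+ n *: F (nseq m x ++ nseq n y ++ s).
Proof.
move=> FP mnk.
have cm u : F (nseq m x ++ nseq n u ++ s) = F (nseq n u ++ nseq m x ++ s).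
  apply: FP.1; first by rewrite !size_cat !size_nseq.
  exact/permPl/perm_catCA.
rewrite !cm (symlist_hom _ _ FP)// size_cat size_nseq; lia.
Qed.

Lemma poly_vanish n (c : nat -> R[i]) :
  (forall t : R[i], \sum_(j < n) c j * t ^+ j = 0) -> forall j, (j < n)%N -> c j = 0.
Proof.
move=> c0 j jn; pose p := \poly_(j < n) c j.
have -> : c j = p`_j by rewrite coef_poly jn.
suff -> : p = 0 by rewrite coef0.
apply/eqP; apply: contraT => p0.
(* A nonzero polynomial cannot have as many roots as its size. *)
pose rs : seq R[i] := [seq i%:R | i <- iota 0 (size p)].
have := @max_poly_roots _ p rs p0.
rewrite size_map size_iota ltnn; apply.
  by apply/allP => t _; rewrite /root horner_poly c0.
by rewrite map_inj_uniq ?iota_uniq// => i i' /eqP; rewrite eqr_nat => /eqP.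
Qed.

(** Polarization, without its formula: a symmetric form is determined by its
    diagonal. Starting from k equal arguments, the linear term of a polynomial in
    one variable frees one argument after the other. *)
Lemma symlist_diag0 k F : symlist k F -> (forall x : E, F (nseq k x) = 0) ->
  forall s : seq E, size s = k -> F s = 0.
Proof.
move=> FP F0.
suff H m : (m <= k)%N -> forall (x : E) (s : seq E), size s = m -> F (nseq (k - m) x ++ s) = 0.
  by move=> s /[dup] sk; have := H k (leqnn _) 0 s; rewrite subnn; apply.
elim: m => [|m IH] mk x s sm; first by rewrite (size0nil sm) cats0 subn0.
case: s sm => // y s [sm].
set n := (k - m.+1)%N.
have nE : (k - m)%N = n.+1 by rewrite /n; lia.
have nk : (n.+1 + size s = k)%N by rewrite sm /n; lia.
have := @poly_vanish n.+2 (fun j => 'C(n.+1, j)%:R * F (nseq (n.+1 - j) x ++ nseq j y ++ s)).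
move/(_ _ 1%N isT); rewrite bin1 subSS subn0 => H.
have {}H : n.+1%:R * F (nseq n x ++ nseq 1 y ++ s) = 0.
  (* The identity at x + t y, expanded in powers of t. *)
  apply: H => t; have := IH (ltnW mk) (x + t *: y) s sm.
  rewrite nE (symlist_binom _ _ FP nk) => {2}<-.
  apply: eq_bigr => j _; rewrite -mulrA; congr (_ * _).
  rewrite mulrC (@symlist_homr k)// sm; have := ltn_ord j; rewrite /n; lia.
have n0 : n.+1%:R != 0 :> R[i] by rewrite pnatr_eq0.
apply: (mulfI n0); rewrite mulr0; exact: H.
Qed.

Definition mkform k (F : seq E -> scalars R) (x : 'I_k -> E) : scalars R :=
  F (codom x).
(** The default value 0 of nth is only met on lists shorter than k. *)
Definition ofform k (L : ('I_k -> E) -> scalars R) (s : seq E) : scalars R :=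
  L (fun i : 'I_k => nth 0 s i).

Lemma nth_codom k (x : 'I_k -> E) (i : 'I_k) : nth 0 (codom x) i = x i.
Proof. by rewrite codomE (nth_map i) ?size_enum_ord// nth_ord_enum. Qed.

Lemma size_codom_ord k (x : 'I_k -> E) : size (codom x) = k.
Proof. by rewrite size_codom card_ord. Qed.

Lemma offormK k (L : ('I_k -> E) -> scalars R) x : ofform L (codom x) = L x.
Proof. by rewrite /ofform; congr L; apply/funext => i; rewrite nth_codom. Qed.

Lemma codom_const k (x : E) : codom (fun _ : 'I_k => x) = nseq k x.
Proof.
apply: (@eq_from_nth _ 0); rewrite ?size_codom_ord ?size_nseq// => i ik.
by rewrite (nth_codom (fun=> x) (Ordinal ik)) nth_nseq ik.
Qed.

Lemma codom_upd k (x : 'I_k -> E) i : exists2 s : seq E, (size s).+1 = k &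
  forall y, perm_eq (codom (upd x i y)) (y :: s).
Proof.
exists [seq x j | j <- rem i (enum 'I_k)].
  rewrite size_map size_rem ?mem_enum// size_enum_ord prednK//.
  exact: leq_ltn_trans (ltn_ord i).
move=> y; rewrite codomE.
apply: (@perm_trans _ (map (upd x i y) (i :: rem i (enum 'I_k)))).
  by apply: perm_map; rewrite perm_to_rem// mem_enum.
rewrite /= {1}/upd eqxx perm_cons.
suff -> : [seq upd x i y j | j <- rem i (enum 'I_k)] =
          [seq x j | j <- rem i (enum 'I_k)] by [].
apply/eq_in_map => j; rewrite mem_rem_uniq ?enum_uniq// inE => /andP[ji _].
by rewrite /upd (negbTE ji).
Qed.

Lemma mkform_sym k F : symlist k F -> symmetric_form (@mkform k F).
Proof.
move=> FP s x; apply: FP.1; first exact: size_codom_ord.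
rewrite !codomE (map_comp x s); apply: perm_map.
apply: uniq_perm; rewrite ?(map_inj_uniq perm_inj) ?enum_uniq//.
move=> i; rewrite mem_enum; apply/mapP; exists ((s^-1)%g i).
  by rewrite mem_enum.
by rewrite permKV.
Qed.

Lemma mkform_lin k F : symlist k F -> multilinear (@mkform k F).
Proof.
move=> FP; apply/multilinearE => x i; have [s sk sP] := codom_upd x i.
move=> a y z; rewrite /mkform.
by rewrite !(FP.1 _ _ _ (sP _)) ?size_codom_ord// FP.2.
Qed.

Lemma ofform_symlist k (L : ('I_k -> E) -> scalars R) :
  multilinear L -> symmetric_form L -> symlist k (ofform L).
Proof.
move=> /multilinearE lL sL; split; last first.
  case: k L lL sL => // k L lL _ s [sk] a y z.
  have E0 (u : E) : ofform L (u :: s) =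
      L (upd (fun i : 'I_k.+1 => nth 0 (0 :: s) i) ord0 u).
    rewrite /ofform; congr L; apply/funext => i; rewrite /upd.
    by case: (unliftP ord0 i) => [j|] ->.
  by rewrite !E0; exact: lL.
move=> s t sk /[dup] /perm_size; rewrite sk => /esym/eqP tk.
move=> /(@tuple_permP _ _ _ (Tuple tk))[p st].
rewrite /ofform -[RHS](sL p); congr L; apply/funext => i.
have ti (j : 'I_k) : nth 0 t j = tnth (Tuple tk) j by rewrite (tnth_nth 0).
rewrite /= st ti /= (nth_map i) ?size_enum_ord//.
by rewrite nth_ord_enum.
Qed.

(** Homogeneous polynomials without the continuity that hpoly demands. *)
Definition apoly k (P : E -> scalars R) :=
  exists2 L : ('I_k -> E) -> scalars R, multilinear L & forall x, P x = L (fun=> x).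

(** The choice made in polar is the only one possible, so that polar forms can be
    computed by exhibiting them. *)
Lemma polar_unique k (P : E -> scalars R) (L : ('I_k -> E) -> scalars R) :
  multilinear L -> symmetric_form L -> (forall x, P x = L (fun=> x)) ->
  polar P = L.
Proof.
move=> lL sL PL; rewrite /polar; case: xgetP => [L' _ [lL' sL' PL']|/(_ L)/=[]//].
have FP := ofform_symlist lL sL; have FP' := ofform_symlist lL' sL'.
pose F s := ofform L' s - ofform L s.
have FF : symlist k F.
  split=> [s t sk st|s sk a y z]; first by rewrite /F (FP.1 _ _ sk st) (FP'.1 _ _ sk st).
  rewrite /F /= (FP.2 _ sk) (FP'.2 _ sk) scalerBr opprD !addrA; congr (_ - _).
  by rewrite addrAC.
apply/funext => x; rewrite -(offormK L') -(offormK L); apply/eqP.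
rewrite -subr_eq0; apply/eqP; apply: (symlist_diag0 FF); last exact: size_codom_ord.
by move=> y; rewrite /F -codom_const !offormK -PL -PL' subrr.
Qed.

Lemma polarP k (P : E -> scalars R) : apoly k P ->
  [/\ multilinear (@polar _ k E P), symmetric_form (@polar _ k E P) &
    forall x, P x = polar P (fun _ : 'I_k => x)].
Proof.
move=> [L lL PL].
apply: (@xgetPex _ (fun=> 0) [set L : ('I_k -> E) -> scalars R |
  [/\ multilinear L, symmetric_form L & forall x, P x = L (fun=> x)]]).
exists (symz L); split; last by move=> x; rewrite symz_diag.
  by apply: (multilinearE _).2; apply: symz_slot;
    [exact: linear_lin_closed|exact: (multilinearE _).1 lL].
exact: symz_sym.
Qed.

Definition pol k (P : E -> scalars R) (s : seq E) : scalars R :=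
  ofform (@polar _ k E P) s.

Lemma pol_symlist k P : apoly k P -> symlist k (pol k P).
Proof. by move=> /polarP[lP sP _]; exact: ofform_symlist. Qed.

Lemma pol_diag k P (x : E) : apoly k P -> pol k P (nseq k x) = P x.
Proof. by move=> /polarP[_ _ PE]; rewrite -codom_const /pol offormK PE. Qed.

Lemma pol_unique k F P : symlist k F -> (forall x : E, F (nseq k x) = P x) ->
  forall s : seq E, size s = k -> pol k P s = F s.
Proof.
move=> FP F0 s sk; rewrite /pol (@polar_unique k P (@mkform k F)).
- rewrite /ofform /mkform; congr F; apply: (@eq_from_nth _ 0).
    by rewrite size_codom_ord.
  move=> i; rewrite size_codom_ord => ik.
  by rewrite (nth_codom (fun i : 'I_k => nth 0 s i) (Ordinal ik)).
- exact: mkform_lin.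
- exact: mkform_sym.
- by move=> x; rewrite /mkform codom_const F0.
Qed.

Lemma hpoly_apoly k (P : E -> scalars R) : hpoly k E P -> apoly k P.
Proof. by case. Qed.

Lemma pfixE k (P : E -> scalars R) (a x : E) :
  pfix k P a x = pol k.+1 P (a :: nseq k x).
Proof.
rewrite /pfix /pol /ofform; congr polar; apply/funext => i /=.
by case: (unliftP ord0 i) => [j|] -> //=; rewrite nth_nseq ltn_ord.
Qed.

(** Iterating P |-> P_a amounts to filling the arguments of the symmetric form one
    at a time; this converts the coherence bounds into bounds on that form. *)
Lemma pol_fix k (P : E -> scalars R) (a : E) (s : seq E) : apoly k.+1 P ->
  size s = k -> pol k (pfix k P a) s = pol k.+1 P (a :: s).
Proof.
move=> PP sk; have [Ps Pl] := pol_symlist PP.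
rewrite (@pol_unique k (fun s => pol k.+1 P (a :: s)))//; last first.
  by move=> x; rewrite pfixE.
split=> [t u tk tu|t tk b y z].
  by apply: Ps; rewrite /= ?tk// perm_cons.
have sw (v : E) : pol k.+1 P (a :: v :: t) = pol k.+1 P (v :: a :: t).
  by apply: Ps => /=; rewrite ?tk//; apply/seq.permP => p /=; rewrite addnCA.
by rewrite !sw Pl //= tk.
Qed.

End Forms.

(** * The weak-star topology and Arens extensions *)

Section ClinTheory.
Context {R : realType} {E F : normedModType R[i]}.
Implicit Types f : clin E F.

Lemma clin0 f : f 0 = 0. Proof. exact: linear0. Qed.
Lemma clinD f x y : f (x + y) = f x + f y. Proof. exact: linearD. Qed.
Lemma clinB f x y : f (x - y) = f x - f y. Proof. exact: linearB. Qed.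
Lemma clinZ f (a : R[i]) x : f (a *: x) = a *: f x. Proof. exact: linearZ. Qed.

End ClinTheory.

Section Arens.
Context {R : realType} {E : normedModType R[i]}.

Lemma scale_divfK (a b : scalars R) : b != 0 -> ((a / b : R[i]) *: b) = a.
Proof. by move=> b0; exact: (@divfK R[i]). Qed.

(** The finite-dimensional core of weak-star density: if g vanishes on the common
    kernel of gs, it is a linear combination of gs. The conclusion states only the
    consequence of being such a combination that interpolation uses, which keeps
    coefficients out of the induction. *)
Lemma interp_dep (gs : seq (dual E)) (g : dual E) :
  (forall x, (forall h, h \in gs -> h x = 0) -> g x = 0) ->
  forall (w : bidual E) x, (forall h, h \in gs -> w h = h x) -> w g = g x.
Proof.
elim: gs g => [|h gs IH] g g0 w x wx.
  by rewrite (_ : g = 0) ?clin0//; apply: clin_ext => y; exact: g0.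
have [[u [u0 hu]]|nou] :=
    pselect (exists u, (forall h', h' \in gs -> h' u = 0) /\ h u != 0); last first.
  apply: IH => [y y0|h' h'gs]; last by apply: wx; rewrite inE h'gs orbT.
  apply: g0 => h'; rewrite inE => /orP[/eqP->|/y0//].
  by apply: contrapT => /eqP hy; apply: nou; exists y.
have wh : w h = h x by apply: wx; rewrite mem_head.
pose c : R[i] := g u / h u.
have : w (g - c *: h) = (g - c *: h) x.
  apply: IH => [y y0|h' h'gs]; last by apply: wx; rewrite inE h'gs orbT.
  have : g (y - (h y / h u) *: u) = 0.
    apply: g0 => h'; rewrite inE clinB clinZ => /orP[/eqP->|h'gs];
      last by rewrite (y0 _ h'gs) (u0 _ h'gs) scaler0 subrr.
      by apply/eqP; rewrite subr_eq0; apply/eqP/esym; exact: scale_divfK.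
  rewrite clinB clinZ => /eqP; rewrite subr_eq0 => /eqP gy.
  change (g y - c *: h y = 0); rewrite gy /c; apply/eqP; rewrite subr_eq0; apply/eqP.
  by change ((h y / h u : R[i]) * g u = g u / h u * h y); ring.
rewrite clinB clinZ wh [RHS](_ : _ = g x - c *: h x)//.
exact: addIr.
Qed.

(** A finite number of functionals cannot tell an element of the bidual from an
    element of E. *)
Lemma interpolation (gs : seq (dual E)) (w : bidual E) :
  exists x : E, forall g, g \in gs -> g x = w g.
Proof.
elim: gs => [|g gs [x xP]]; first by exists 0.
have [[u [u0 gu]]|nou] :=
    pselect (exists u, (forall h', h' \in gs -> h' u = 0) /\ g u != 0).
  exists (x + ((w g - g x) / g u : R[i]) *: u) => h; rewrite inE clinD clinZ.
  move=> /orP[/eqP->|hgs]; last by rewrite (u0 _ hgs) scaler0 addr0 xP.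
  rewrite (_ : _ *: _ = w g - g x); last exact: scale_divfK.
  by rewrite addrC subrK.
exists x => h; rewrite inE => /orP[/eqP->|/xP//].
apply/esym/(@interp_dep gs) => [y y0|h' /xP//].
by apply: contrapT => /eqP gy; apply: nou; exists y.
Qed.

(** By interpolation, the sets on which finitely many functionals take the values
    prescribed by w form a filter base on E converging weak-star to w. *)
Lemma weakstar_dense (f f' : weakstar (dual E) -> scalars R) :
  continuous f -> continuous f' ->
  (forall x : E, f (canon x) = f' (canon x)) -> f = f'.
Proof.
move=> cf cf' ff'; apply/funext => w.
pose B (gs : seq (dual E)) := [set x : E | forall g, g \in gs -> g x = (w : bidual E) g].
pose F := filter_from [set: seq (dual E)] B.
have FF : ProperFilter F.
  apply: filter_from_proper => [|gs _]; last exact: interpolation.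
  apply: filter_from_filter; first by exists [::].
  move=> gs hs _ _; exists (gs ++ hs) => // x xgh.
  by split=> g ggs; apply: xgh; rewrite mem_cat ggs ?orbT.
have Fw : (fun x => canon x : weakstar (dual E)) @ F --> w.
  move=> A /= [_ [[V Vop <-] Vw sVA]].
  have cvw : {ptws, (fun x : E => (canon x : dual E -> scalars R)) @ F -->
       ((w : bidual E) : dual E -> scalars R)}.
    apply/pointwise_cvgP => g A' A'w; exists [:: g] => // x /(_ g).
    by rewrite mem_head => /(_ isT) /= xg; rewrite /preimage /= xg; exact: nbhs_singleton.
  have : nbhs (((w : bidual E) : dual E -> scalars R) : {ptws dual E -> scalars R}) V.
    exact: (@open_nbhs_nbhs {ptws dual E -> scalars R} _ V (conj Vop Vw)).
  move=> /cvw FV; change (F ((fun x : E => canon x : weakstar (dual E)) @^-1` A)).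
  apply: (@filterS _ F _ _ _ _ FV) => x; exact: sVA.
apply: (@norm_cvg_unique _ _ ((fun x => f (canon x)) @ F)).
  exact: cvg_comp Fw (cf w).
rewrite (_ : (fun x => f (canon x)) = (fun x => f' (canon x))); last exact/funext.
exact: cvg_comp Fw (cf' w).
Qed.
End Arens.

Section WeakStarForms.
Context {R : realType} {E : normedModType R[i]}.

(** Linearity and weak-star continuity in one notion: such an f is linear and
    weak-star continuous because it is evaluation at an element of the dual, and
    Arens extensions are built from evaluations. *)
Definition evaluation (f : bidual E -> scalars R) :=
  exists g : dual E, forall w, f w = w g.

Lemma evaluation_lin_closed : lin_closed evaluation.
Proof.
split=> [|a f f' [g fg] [g' fg']]; first by exists 0 => w; rewrite clin0.
by exists (a *: g + g') => w; rewrite fg fg' clinD clinZ.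
Qed.

Lemma evaluation_linear f : evaluation f -> linear f.
Proof. by move=> [g fg] a v w; rewrite !fg. Qed.

Lemma weakstar_eval (g : dual E) :
  continuous (fun w : weakstar (dual E) => (w : bidual E) g).
Proof.
move=> w; have := @initial_continuous _ _
  (fun v : bidual E => ((v : dual E -> scalars R) : {ptws dual E -> scalars R})) w.
move/pointwise_cvgP => H; apply: H; rewrite nbhs_simpl; apply: fmap_filter.
exact: (nbhs_filter (w : weakstar (dual E))).
Qed.

Lemma evaluation_continuous f : evaluation f ->
  continuous (f : weakstar (dual E) -> scalars R).
Proof.
by move=> [g fg]; rewrite (_ : f = fun w => w g); [exact: weakstar_eval|exact/funext].
Qed.

Definition wform k (B : ('I_k -> bidual E) -> scalars R) := slotwise evaluation B.

Lemma wform_multilinear k (B : ('I_k -> bidual E) -> scalars R) :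
  wform B -> multilinear B.
Proof. by move=> wB; apply/multilinearE => x i; exact: evaluation_linear. Qed.

Lemma wform_arens k (s : 'S_k) (L : ('I_k -> E) -> scalars R) B :
  wform B -> (forall x, B (canon \o x) = L x) -> arens_extension s L B.
Proof.
by move=> wB BL; split=> // j z _; apply: evaluation_continuous; exact: wB.
Qed.

(** Induction on the number of variables that have left E: each step extends the
    equality to one more variable by weak-star density. *)
Lemma arens_unique k (L : ('I_k -> E) -> scalars R) B B' :
  arens_extension 1%g L B -> arens_extension 1%g L B' -> B = B'.
Proof.
move=> [BL Bc] [BL' Bc'].
suff H m : (m <= k)%N -> forall z : 'I_k -> bidual E,
    (forall i : 'I_k, (m <= i)%N -> range canon (z i)) -> B z = B' z.
  by apply/funext => z; apply: (H k) => // i; rewrite leqNgt ltn_ord.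
elim: m => [_ z zP|m IH mk z zP].
  have /choice[x xz] : forall i, exists x, canon x = z i.
    by move=> i; have [//|x _ xz] := zP i; exists x.
  have <- : canon \o x = z by apply/funext => i; exact: xz.
  by rewrite BL BL'.
pose j := Ordinal mk.
have zj : forall i : 'I_k, (j < i)%N -> range canon (z ((1%g : 'S_k) i)).
  by move=> i ji; rewrite perm1; exact: zP.
have := weakstar_dense (Bc j z zj) (Bc' j z zj).
rewrite perm1 => H.
have {}H : (fun w => B (upd z j w)) = (fun w => B' (upd z j w)).
  apply: H => x; apply: IH => [|i mi]; first exact: ltnW.
  rewrite /=; case: eqP => [_|/eqP ij]; first by exists x.
  apply: zP; rewrite ltn_neqAle mi andbT; apply: contra ij => /eqP mi'.
  exact/eqP/val_inj.
by have := congr1 (fun f => f (z j)) H; rewrite /= upd_id.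
Qed.

Lemma canonZD (a : R[i]) (x y : E) : canon (a *: x + y) = a *: canon x + canon y.
Proof. by apply: clin_ext => g; rewrite /= clinD clinZ. Qed.

Lemma canon_upd k (x : 'I_k -> E) i y :
  canon \o upd x i y = upd (canon \o x) i (canon y).
Proof. by apply/funext => j; rewrite /upd /=; case: eqP. Qed.

(** Symmetrizing B does not change its diagonal, keeps separate weak-star
    continuity and restricts on E to a symmetric form with diagonal P, that is, to
    the polar form; uniqueness of Arens extensions does the rest. *)
Lemma aron_bernerE k (P : E -> scalars R) (B : ('I_k -> bidual E) -> scalars R) :
  wform B -> (forall x, B (fun=> canon x) = P x) ->
  aron_berner k P = fun z => B (fun=> z).
Proof.
move=> wB BP; pose B' := symz B.
have wB' : wform B' by apply: symz_slot => //; exact: evaluation_lin_closed.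
have pP : @polar _ k E P = fun x => B' (canon \o x).
  apply: polar_unique => [|s x|x].
  - apply/multilinearE => x i a y z; rewrite !canon_upd canonZD.
    exact: (evaluation_linear (wB' _ _)).
  - exact: (symz_sym B s (canon \o x)).
  - by rewrite -BP -symz_diag.
have aB' : arens_extension 1%g (@polar _ k E P) B' by apply: wform_arens; rewrite ?pP.
apply/funext => z; rewrite /aron_berner.
rewrite (arens_unique (@xgetI _ (fun=> 0) [set B | arens_extension _ _ B] _ aB') aB').
exact: symz_diag.
Qed.

End WeakStarForms.

Section ArensExistence.
Context {R : realType} {E : normedModType R[i]}.

(** Application of w to a function that is only known to be a functional by a
    later argument; it lets the extension below be defined before its
    intermediate maps are shown to be linear and bounded. *)
Definition dual_apply (w : bidual E) (f : E -> scalars R) : scalars R :=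
  w (xget 0 [set g : dual E | forall y, g y = f y]).

Lemma dual_applyE w (g : dual E) f : (forall y, g y = f y) -> dual_apply w f = w g.
Proof.
move=> gf; congr (w _); apply: xget_unique => // g' g'f.
by apply: clin_ext => y; rewrite gf; exact: g'f.
Qed.

Variables (k : nat) (L : ('I_k -> E) -> scalars R) (K : R).
Hypothesis lL : multilinear L.
Hypothesis K0 : 0 <= K.
Hypothesis LK : forall x, nrm (L x) <= K * \prod_i nrm (x i).

(** The variables of index below m have been extended to the bidual, the last of
    them outermost; the others are still read from x. *)
Fixpoint iext (z : 'I_k -> bidual E) (m : nat) (x : 'I_k -> E) : scalars R :=
  if m is m'.+1 then
    if insub m' is Some i then dual_apply (z i) (fun y => iext z m' (upd x i y))
    else iext z m' x
  else L x.

Let wt (z : 'I_k -> bidual E) m (x : 'I_k -> E) (i : 'I_k) :=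
  if (i < m)%N then nrm (z i) else nrm (x i).

Let iext_bnd m := forall z x, nrm (iext z m x) <= K * \prod_i wt z m x i.
Let iext_lin m := forall z x (i : 'I_k), (m <= i)%N ->
  linear (fun y => iext z m (upd x i y)).

Let wt_ge0 z m x i : 0 <= wt z m x i.
Proof. by rewrite /wt; case: ifP => _; rewrite nrm_ge0. Qed.

Let slot_functional m : iext_bnd m -> iext_lin m ->
  forall z x (i : 'I_k), (m <= i)%N -> exists2 g : dual E,
    forall y, g y = iext z m (upd x i y) &
    nrm g <= K * \prod_(j | j != i) wt z m x j.
Proof.
move=> bm lm z x i mi; set M := K * _.
have M0 : 0 <= M by rewrite mulr_ge0// prodr_ge0.
have bM y : nrm (iext z m (upd x i y)) <= M * nrm y.
  apply: le_trans (bm _ _) _; rewrite (bigD1 i)//= mulrCA mulrC.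
  rewrite {2}/wt ltnNge mi /= {2}/upd eqxx ler_wpM2r ?nrm_ge0// /M ler_wpM2l//.
  rewrite le_eqVlt; apply/orP; left; apply/eqP; apply: eq_bigr => j ji.
  by rewrite /wt /upd (negbTE ji).
exists (Clin (bounded_clinear (lm z x i mi) bM)) => //.
by rewrite nrm_clin; apply: opnorm_le.
Qed.

Lemma iext_step z m (mk : (m < k)%N) x :
  iext z m.+1 x = dual_apply (z (Ordinal mk)) (fun y => iext z m (upd x (Ordinal mk) y)).
Proof. by rewrite /= insubT. Qed.

Let iext_inv m : (m <= k)%N -> iext_bnd m /\ iext_lin m.
Proof.
elim: m => [_|m IH mk]; first by split=> [z x|z x i _]; [exact: LK|exact: lL].
have [bm lm] := IH (ltnW mk); pose i := Ordinal mk.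
split=> [z x|z x i' mi' a u v].
  rewrite (iext_step z mk); have [//|g gE gK] := @slot_functional m bm lm z x i _.
  rewrite (dual_applyE _ gE); apply: le_trans (le_opnorm _ _) _.
  rewrite (bigD1 i)//= /wt /= ltnS leqnn mulrCA; apply: ler_wpM2l; first exact: opnorm_ge0.
  apply: le_trans gK _; rewrite ler_wpM2l//.
  rewrite le_eqVlt; apply/orP; left; apply/eqP; apply: eq_bigr => j ji.
  rewrite /wt ltnS [(j <= m)%N]leq_eqVlt (_ : (j == m :> nat) = false)//.
  by apply: contra_neqF ji => /eqP jm; exact: val_inj.
have ii' : i' != i by apply: contraTneq mi' => ->; rewrite /= ltnn.
have sf X := @slot_functional m bm lm z (upd x i' X) i (leqnn m).
rewrite !(iext_step z mk).
have [g gE _] := sf (a *: u + v); have [gu guE _] := sf u; have [gv gvE _] := sf v.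
rewrite (dual_applyE _ gE) (dual_applyE _ guE) (dual_applyE _ gvE).
rewrite (_ : g = a *: gu + gv) ?clinD ?clinZ//.
apply: clin_ext => y; rewrite gE [RHS]/= [RHS](_ : _ = a *: gu y + gv y)// guE gvE.
rewrite ![upd (upd x i' _) i y]upd_swap//; apply: lm; exact: ltnW.
Qed.

Lemma iext_local m z z' : (m <= k)%N -> (forall i : 'I_k, (i < m)%N -> z i = z' i) ->
  forall x, iext z m x = iext z' m x.
Proof.
elim: m => // m IH mk zz' x; rewrite !(iext_step _ mk) zz'//; congr dual_apply.
apply/funext => y; apply: IH; first exact: ltnW.
by move=> i im; apply: zz'; rewrite ltnS ltnW.
Qed.

Lemma iext_slot m z x (i : 'I_k) : (m <= i)%N ->
  exists g : dual E, forall y, g y = iext z m (upd x i y).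
Proof.
move=> mi; have mk : (m <= k)%N by apply: leq_trans mi _; exact/ltnW/ltn_ord.
have [bm lm] := iext_inv mk.
by have [g] := slot_functional bm lm z x mi; exists g.
Qed.

Lemma iext_peel j d z (a : 'I_k -> E) : (j + d <= k)%N ->
  (forall i : 'I_k, (j <= i)%N -> z i = canon (a i)) ->
  forall x, iext z (j + d) x =
    iext z j (fun i : 'I_k => if (j <= i < j + d)%N then a i else x i).
Proof.
move=> + za; elim: d => [|d IH] jdk x.
  rewrite addn0; congr iext; apply/funext => i.
  by rewrite ltnNge andbN.
rewrite addnS in jdk *; rewrite (iext_step z jdk); set i := Ordinal jdk.
have [g gE] := @iext_slot (j + d) z x i (leqnn _).
rewrite (dual_applyE _ gE) za ?leq_addr//= gE IH ?(ltnW jdk)//; congr iext.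
apply/funext => i'; rewrite ltnS /upd [(i' <= j + d)%N]leq_eqVlt.
have [->|ii'] := eqVneq i' i; first by rewrite ltnn eqxx leq_addr andbF.
rewrite (_ : (i' == j + d :> nat) = false)//.
by apply: contra_neqF ii' => /eqP ii'; exact: val_inj.
Qed.

(** The iterated extension is the Arens extension for the increasing order. The
    second part is what remains of linearity and weak-star continuity when the later
    variables lie in E; for the last variable it is unconditional. *)
Lemma arens_exists : exists2 B, arens_extension 1%g L B &
  forall (j : 'I_k) z, (forall i : 'I_k, (j < i)%N -> range canon (z i)) ->
    evaluation (fun w => B (upd z j w)).
Proof.
pose B z := iext z k (fun=> 0).
have ev (j : 'I_k) z : (forall i : 'I_k, (j < i)%N -> range canon (z i)) ->
    evaluation (fun w => B (upd z j w)).
  move=> zP; pose a i := xget 0 [set x | canon x = z i].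
  have aP (i : 'I_k) : (j < i)%N -> z i = canon (a i).
    by move=> /zP[x _ xz]; apply/esym; apply: (@xgetI _ _ [set x | canon x = z i] x).
  have jk : (j.+1 + (k - j.+1) = k)%N by rewrite subnKC.
  (* The later variables, all in E, are moved inside the extension. *)
  pose x' (i : 'I_k) := if (j < i < k)%N then a i else 0.
  have BE w : B (upd z j w) = iext (upd z j w) j.+1 x'.
    rewrite /B -[X in iext _ X]jk (@iext_peel _ _ _ a) ?jk// => i ji.
    rewrite /upd; case: eqP ji => [->|_ ji]; first by rewrite ltnn.
    exact: aP.
  have [g gE] := @iext_slot j z x' j (leqnn _).
  exists g => w; rewrite BE (iext_step _ (ltn_ord j)).
  have jj : Ordinal (ltn_ord j) = j by exact: val_inj.
  rewrite jj /upd eqxx; apply: dual_applyE => y; rewrite gE.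
  apply: iext_local => [|i ij]; first exact/ltnW/ltn_ord.
  by case: eqP ij => // ->; rewrite ltnn.
exists B => //; split=> [x|j z zP].
  rewrite /B -[X in iext _ X]add0n (@iext_peel _ _ _ x)//=; congr L.
  by apply/funext => i; rewrite add0n ltn_ord.
rewrite perm1; apply: evaluation_continuous; apply: ev => i ji.
by have := zP i ji; rewrite perm1.
Qed.

End ArensExistence.

Section Regular.
Context {R : realType} {E : normedModType R[i]}.

(** Symmetry moves every variable to the last place, where an Arens extension is
    weak-star continuous without restriction on the other variables. *)
Lemma sym_wform k (B : ('I_k -> bidual E) -> scalars R) : symmetric_form B ->
  (forall (j : 'I_k) z, (forall i : 'I_k, (j < i)%N -> range canon (z i)) ->
    evaluation (fun w => B (upd z j w))) -> wform B.
Proof.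
case: k B => [|k] B sB eB x i; first by case: i.
have [|g gE] := eB ord_max (x \o tperm i ord_max).
  by move=> j; rewrite ltnNge -ltnS ltn_ord.
exists g => w; rewrite -gE -(sB (tperm i ord_max)) upd_comp.
by rewrite tpermV tpermL.
Qed.

End Regular.

(** * Norms in a polynomial ideal *)

Section IdealTheory.
Context {R : realType}.
Variables (k : nat) (I : poly_ideal R) (hI : banach_ideal k I) (E : banach R).
Implicit Types P Q : E -> scalars R.

Lemma ideal_apoly P : I E P -> apoly k P.
Proof. by move=> /(ideal_hpoly hI)/hpoly_apoly. Qed.

Lemma idealZ (a : R[i]) P : I E P -> I E (a *: P).
Proof.
move=> IP; rewrite -[_ *: _]addr0; apply: (ideal_linear hI) => //.
exact: ideal_0 hI _.
Qed.

Lemma idealD P Q : I E P -> I E Q -> I E (P + Q).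
Proof. by move=> IP IQ; rewrite -[P]scale1r; exact: ideal_linear hI _ _ _ _ IP IQ. Qed.

Lemma idealB P Q : I E P -> I E Q -> I E (P - Q).
Proof. by move=> IP IQ; rewrite -scaleN1r addrC; exact: ideal_linear hI _ _ _ _ IQ IP. Qed.

Lemma ideal_sum n (P_ : nat -> E -> scalars R) : (forall i, I E (P_ i)) ->
  I E (\sum_(i < n) P_ i).
Proof.
move=> IP; elim/big_ind: _ => //; [exact: ideal_0 hI _|exact: idealD].
Qed.

Lemma ideal_norm0 : ideal_norm I (0 : E -> scalars R) = 0.
Proof.
have := ideal_normZ hI (0 : scalars R) (ideal_0 hI E).
by rewrite scaler0 nrm0 mul0r.
Qed.

Lemma ideal_normN P : I E P -> ideal_norm I (- P) = ideal_norm I P.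
Proof.
move=> IP; have := ideal_normZ hI (-1 : scalars R) IP.
by rewrite scaleN1r => ->; rewrite /nrm normrN1 mul1r.
Qed.

Lemma ideal_norm_ge0 P : I E P -> 0 <= ideal_norm I P.
Proof.
move=> IP; have := ideal_normD hI IP (idealZ (-1) IP).
by rewrite scaleN1r subrr ideal_norm0 ideal_normN// -mulr2n pmulrn_lge0.
Qed.

Lemma ideal_normBC P Q : I E P -> I E Q ->
  ideal_norm I (P - Q) = ideal_norm I (Q - P).
Proof. by move=> IP IQ; rewrite -opprB ideal_normN//; exact: idealB. Qed.

Lemma ideal_norm_sum n (P_ : nat -> E -> scalars R) : (forall i, I E (P_ i)) ->
  ideal_norm I (\sum_(i < n) P_ i) <= \sum_(i < n) ideal_norm I (P_ i).
Proof.
move=> IP; elim: n => [|n IH]; first by rewrite !big_ord0 ideal_norm0.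
rewrite !big_ord_recr /=; apply: le_trans (ideal_normD hI _ _) _ => //.
  exact: ideal_sum.
by rewrite lerD2r.
Qed.

Lemma nrmM (a b : scalars R) : nrm (a * b) = nrm a * nrm b.
Proof. exact: (nrmZ a b). Qed.

Lemma apoly_hom P (t : R[i]) x : apoly k P -> P (t *: x) = t ^+ k *: P x.
Proof.
move=> aP; rewrite -(pol_diag _ aP) -[nseq _ _]cats0.
by rewrite (symlist_hom _ _ (pol_symlist aP)) ?addn0// cats0 pol_diag.
Qed.

Lemma line_clinear (x : E) : (fun z : scalars R => (z : R[i]) *: x) \in @clinear R _ E.
Proof.
apply: (@bounded_clinear _ _ _ _ (nrm x)) => [a y z|z]; last by rewrite nrmZ mulrC.
by rewrite scalerDl scalerA.
Qed.

(** Composing P with the line through x gives P x times the power function, which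
    has norm 1 in the ideal. *)
Lemma le_ideal_norm P x : I E P -> nrm (P x) <= ideal_norm I P * nrm x ^+ k.
Proof.
move=> IP; pose T := Clin (line_clinear x).
have [IPT PTn] := ideal_comp hI T IP.
have PT : P \o T = (P x : R[i]) *: (fun z : scalars R => z ^+ k).
  apply/funext => z /=; rewrite apoly_hom; last exact: ideal_apoly.
  exact: mulrC.
have [Ipow npow] := ideal_pow hI.
have := ideal_normZ hI (P x) Ipow; rewrite -PT npow mulr1 => <-.
apply: le_trans PTn _; rewrite ler_wpM2l ?ideal_norm_ge0//.
apply: lerXn2r; rewrite ?nnegrE ?nrm_ge0// nrm_clin.
by apply: opnorm_le => [|z]; rewrite ?nrm_ge0//= nrmZ mulrC.
Qed.

End IdealTheory.

(** * Derivatives in a coherent sequence *)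

Section Coherent.
Context {R : realType}.
Variables (A : nat -> poly_ideal R).

(** The bound of coherence for derivatives, with a constant at least 1 so that its
    powers are monotone in the exponent. *)
Definition pfix_bound (C : R) := 1 <= C /\
  forall (E : banach R) k, (0 < k)%N -> forall (P : E -> scalars R) (a : E),
    A k.+1 E P -> A k E (pfix k P a) /\
    ideal_norm (A k) (pfix k P a) <= C * ideal_norm (A k.+1) P * nrm a.

Hypothesis cA : coherent A.

Lemma coherent_pfix_bound : exists C, pfix_bound C.
Proof.
have [C [D [C0 _ CP]]] := coherent_bounds cA; exists (C + 1); split.
  by rewrite lerDr ltW.
move=> E k k0 P a AP; have [APa /le_trans] := (CP E k k0).1 P a AP.
move=> H; split=> //; apply: H; rewrite ler_wpM2r ?nrm_ge0// ler_wpM2r ?lerDl//.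
exact: (ideal_norm_ge0 (coherent_ideal cA (ltn0Sn k))).
Qed.

Variable C : R.
Hypothesis hC : pfix_bound C.

Let C1 : 1 <= C. Proof. by have [] := hC. Qed.
Let C0 : 0 <= C. Proof. exact: le_trans ler01 C1. Qed.

(** Coherence, applied once for each entry of s. *)
Lemma pol_ideal (E : banach R) (s : seq E) n (P : E -> scalars R) : (0 < n)%N ->
  A (size s + n) E P ->
  A n E (fun x => pol (size s + n) P (s ++ nseq n x)) /\
  ideal_norm (A n) (fun x => pol (size s + n) P (s ++ nseq n x))
    <= C ^+ size s * ideal_norm (A (size s + n)) P * \prod_(a <- s) nrm a.
Proof.
move=> n0; elim: s P => [|a s IH] P /= AP.
  rewrite (_ : (fun x => _) = P).
    by rewrite big_nil mulr1 mul1r.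
  apply/funext => x; apply: pol_diag; apply: ideal_apoly AP.
  exact: coherent_ideal.
have sn0 : (0 < size s + n)%N by rewrite addn_gt0 n0 orbT.
have [APa Pan] := hC.2 E _ sn0 P a AP.
have [AF Fn] := IH _ APa.
rewrite (_ : (fun x => _) = (fun x => pol (size s + n) (pfix (size s + n) P a) (s ++ nseq n x))).
  split=> //; apply: le_trans Fn _.
  rewrite big_cons; set p := \prod_(_ <- _) _.
  have p0 : 0 <= p by rewrite /p big_seq prodr_ge0// => i _; exact: nrm_ge0.
  apply: le_trans (_ : C ^+ size s *
    (C * ideal_norm (A (size s + n).+1) P * nrm a) * p <= _).
    by rewrite ler_wpM2r// ler_wpM2l// exprn_ge0.
  by rewrite exprS le_eqVlt; apply/orP; left; apply/eqP; ring.
apply/funext => x; rewrite pol_fix//; last by rewrite size_cat size_nseq.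
by apply: ideal_apoly AP; exact: coherent_ideal.
Qed.

(** Fixing all arguments but one leaves a functional in the ideal of degree 1, whose
    values are bounded by its ideal norm. *)
Lemma nrm_pol (E : banach R) k (P : E -> scalars R) (s : seq E) : (0 < k)%N ->
  A k E P -> size s = k ->
  nrm (pol k P s) <= C ^+ k * ideal_norm (A k) P * \prod_(a <- s) nrm a.
Proof.
move=> k0 AP; elim/last_ind: s => [|s x _]; first by move=> ks; rewrite -ks in k0.
rewrite size_rcons -addn1 => sk; rewrite -{}sk in AP *.
have [AF Fn] := pol_ideal (ltn0Sn 0) AP.
have := le_ideal_norm (coherent_ideal cA (ltn0Sn 0)) x AF.
rewrite /= cats1 => /le_trans; apply.
rewrite big_rcons /= mulrA expr1 ler_wpM2r ?nrm_ge0//.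
apply: le_trans Fn _; rewrite ler_wpM2r//.
  by rewrite big_seq prodr_ge0// => i _; exact: nrm_ge0.
rewrite ler_wpM2r//.
  by apply: (ideal_norm_ge0 _ AP); apply: coherent_ideal; rewrite // addn1.
by rewrite ler_weXn2l// leq_addr.
Qed.

Lemma nrm_polar (E : banach R) k (P : E -> scalars R) (x : 'I_k -> E) : (0 < k)%N ->
  A k E P -> nrm (polar P x) <= C ^+ k * ideal_norm (A k) P * \prod_i nrm (x i).
Proof.
move=> k0 AP; have := nrm_pol k0 AP (size_codom_ord x).
by rewrite /pol offormK codomE big_map big_enum.
Qed.

End Coherent.

(** * Weak-star polynomials and regularity *)

Section WeakStarPolynomials.
Context {R : realType} {E : normedModType R[i]}.
Implicit Types G : bidual E -> scalars R.

(** Polynomials on the bidual with a separately weak-star continuous multilinear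
    form; the form need not be symmetric, which makes products immediate. *)
Definition wpoly k G := exists2 B : ('I_k -> bidual E) -> scalars R,
  wform B & forall z, G z = B (fun=> z).

(** A weak-star polynomial is recovered from its restriction to E. This is the only
    way in which Aron-Berner extensions are computed. *)
Lemma wpoly_AB k G : wpoly k G -> aron_berner k (fun x => G (canon x)) = G.
Proof.
by move=> [B wB GB]; rewrite (aron_bernerE wB)//; apply/funext.
Qed.

Lemma wpoly_lin k (a : R[i]) G G' : wpoly k G -> wpoly k G' ->
  wpoly k (fun z => a *: G z + G' z).
Proof.
move=> [B wB GB] [B' wB' GB']; exists (fun x => a *: B x + B' x).
  by move=> x i; apply: evaluation_lin_closed.2; [exact: wB|exact: wB'].
by move=> z; rewrite GB GB'.
Qed.

Lemma wpoly0 k : wpoly k (fun=> 0).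
Proof.
by exists (fun=> 0) => // x i; exact: evaluation_lin_closed.1.
Qed.

Lemma wpolyZ k (a : R[i]) G : wpoly k G -> wpoly k (fun z => a *: G z).
Proof.
move=> gG; rewrite (_ : (fun z => _) = (fun z => a *: G z + 0)).
  exact: wpoly_lin (wpoly0 k).
by apply/funext => z; rewrite addr0.
Qed.

Lemma wpoly_sum k n (G_ : nat -> bidual E -> scalars R) :
  (forall i, wpoly k (G_ i)) -> wpoly k (fun z => \sum_(i < n) G_ i z).
Proof.
move=> gG; elim: n => [|n IH].
  by rewrite (_ : (fun z => _) = fun=> 0); [exact: wpoly0|apply/funext => z; rewrite big_ord0].
rewrite (_ : (fun z => _) = fun z => 1 *: G_ n z + \sum_(i < n) G_ i z).
  exact: wpoly_lin.
by apply/funext => z; rewrite big_ord_recr /= scale1r addrC.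
Qed.

Lemma wpoly_mul k l G G' : wpoly k G -> wpoly l G' -> wpoly (k + l) (fun z => G z * G' z).
Proof.
move=> [B wB GB] [B' wB' GB'].
exists (fun x => B (x \o lshift l) * B' (x \o @rshift k l)); last first.
  by move=> z; rewrite GB GB'.
move=> x i; case: (split_ordP i) => j ->.
- have [g gE] := wB (x \o lshift l) j.
  exists ((B' (x \o @rshift k l) : R[i]) *: g) => w.
  rewrite (_ : upd _ _ _ \o lshift l = upd (x \o lshift l) j w); last first.
    by apply/funext => m; rewrite /upd /= (inj_eq (@lshift_inj _ _)).
  rewrite (_ : upd _ _ _ \o @rshift k l = x \o @rshift k l); last first.
    by apply/funext => m; rewrite /upd /= eq_rlshift.
  by rewrite gE clinZ; exact: mulrC.
- have [g gE] := wB' (x \o @rshift k l) j.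
  exists ((B (x \o lshift l) : R[i]) *: g) => w.
  rewrite (_ : upd _ _ _ \o @rshift k l = upd (x \o @rshift k l) j w); last first.
    by apply/funext => m; rewrite /upd /= (inj_eq (@rshift_inj _ _)).
  rewrite (_ : upd _ _ _ \o lshift l = x \o lshift l); last first.
    by apply/funext => m; rewrite /upd /= eq_lrshift.
  by rewrite gE clinZ.
Qed.

(** Fixing some arguments of the symmetric form preserves weak-star continuity in
    the others; this applies to the derivatives that occur in a Taylor expansion. *)
Lemma wpoly_pol m n G z : (exists2 B : ('I_(m + n) -> bidual E) -> scalars R,
    wform B /\ symmetric_form B & forall z, G z = B (fun=> z)) ->
  wpoly n (fun x => pol (m + n) G (nseq m z ++ nseq n x)).
Proof.
move=> [B [wB sB] GB].
pose J (y : 'I_n -> bidual E) (i : 'I_(m + n)) :=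
  match fintype.split i with inl _ => z | inr j => y j end.
exists (fun y => B (J y)) => [y j|x].
  have [g gE] := wB (J y) (rshift m j); exists g => w; rewrite -gE; congr B.
  apply/funext => i; rewrite /J /upd; case: (split_ordP i) => i' ->.
    by rewrite eq_lrshift.
  by rewrite (inj_eq (@rshift_inj _ _)).
rewrite /pol (polar_unique (wform_multilinear wB) sB GB) /ofform; congr B.
apply/funext => i; rewrite /J nth_cat size_nseq; case: split_ordP => i' -> /=.
  by rewrite nth_nseq ltn_ord.
by rewrite addKn nth_nseq ltn_ord.
Qed.

End WeakStarPolynomials.

Section RegularAB.
Context {R : realType}.
Variables (A : nat -> poly_ideal R) (cA : coherent A) (E : banach R).
Hypothesis rA : regular_at A E.

(** Regularity makes the Arens extension symmetric, hence weak-star continuous in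
    every variable and not just in the last one. *)
Lemma regular_AB k (P : E -> scalars R) : (0 < k)%N -> A k E P ->
  exists2 B : ('I_k -> bidual E) -> scalars R, wform B /\ symmetric_form B &
  (forall z, aron_berner k P z = B (fun=> z)) /\ (forall x, aron_berner k P (canon x) = P x).
Proof.
move=> k0 AP; have hk := coherent_ideal cA k0.
have aP := ideal_apoly hk AP; have [lP sP PP] := polarP aP.
have [C hC] := coherent_pfix_bound cA.
have K0 : 0 <= C ^+ k * ideal_norm (A k) P.
  by rewrite mulr_ge0 ?(ideal_norm_ge0 hk)// exprn_ge0//; apply: le_trans hC.1.
have [B aB eB] := arens_exists lP K0 (fun x => nrm_polar cA hC x k0 AP).
have sB := rA k0 AP aB; have wB := sym_wform sB eB.
have BP x : B (fun=> canon x) = P x by rewrite PP -aB.1.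
exists B => //; rewrite (aron_bernerE wB BP); split=> //.
Qed.

Lemma AB_wpoly k (P : E -> scalars R) : (0 < k)%N -> A k E P -> wpoly k (aron_berner k P).
Proof. by move=> k0 /(regular_AB k0)[B [wB _] [BP _]]; exists B. Qed.

Lemma AB_canon k (P : E -> scalars R) x : (0 < k)%N -> A k E P ->
  aron_berner k P (canon x) = P x.
Proof. by move=> k0 /(regular_AB k0)[B _ []]. Qed.

Lemma AB_pol_wpoly m n (P : E -> scalars R) z : (0 < m + n)%N -> A (m + n)%N E P ->
  wpoly n (fun x => pol (m + n) (aron_berner (m + n) P) (nseq m z ++ nseq n x)).
Proof. by move=> k0 /(regular_AB k0)[B wsB [BP _]]; apply: wpoly_pol; exists B. Qed.

End RegularAB.

(** * Series of scalars *)

Section Limits.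
Context {R : realType}.
Implicit Types (u v : nat -> scalars R) (l : scalars R) (b : nat -> R).

Definition tends v l := forall e : R, 0 < e ->
  exists N, forall n, (N <= n)%N -> nrm (l - v n) < e.

Definition sums u l := tends (fun n => \sum_(k < n) u k) l.

Lemma tendsP v l : tends v l <-> v @ \oo --> l.
Proof.
rewrite cvg_nrmP; split=> vl e e0.
  by have [N vN] := vl e e0; exists N.
by have [N _ vN] := vl e e0; exists N => n; exact: vN.
Qed.

Lemma sumsP u l : sums u l <-> series u @ \oo --> l.
Proof.
rewrite /sums tendsP (_ : (fun n => \sum_(k < n) u k) = series u)//.
by apply/funext => n; rewrite /series /= big_mkord.
Qed.

Lemma sums_lim u l : sums u l -> limn (series u) = l.
Proof. by move=> /sumsP/cvg_lim; apply; exact: norm_hausdorff. Qed.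

Lemma tends_unique v l l' : tends v l -> tends v l' -> l = l'.
Proof. by move=> /tendsP vl /tendsP vl'; exact: norm_cvg_unique vl vl'. Qed.

Lemma tends_cst l : tends (fun=> l) l.
Proof. by move=> e e0; exists 0%N => n _; rewrite subrr nrm0. Qed.

Lemma tendsZ (a : R[i]) v l : tends v l -> tends (fun n => a *: v n) (a *: l).
Proof. by move=> /tendsP vl; apply/tendsP; exact: cvgZr vl. Qed.

Lemma tendsD v l v' l' : tends v l -> tends v' l' ->
  tends (fun n => v n + v' n) (l + l').
Proof. by move=> /tendsP vl /tendsP vl'; apply/tendsP; exact: cvgD vl vl'. Qed.

Lemma tendsB v l v' l' : tends v l -> tends v' l' ->
  tends (fun n => v n - v' n) (l - l').
Proof. by move=> /tendsP vl /tendsP vl'; apply/tendsP; exact: cvgB vl vl'. Qed.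

Lemma tends_sum n (v_ : nat -> nat -> scalars R) (l_ : nat -> scalars R) :
  (forall i, (i < n)%N -> tends (v_ i) (l_ i)) ->
  tends (fun m => \sum_(i < n) v_ i m) (\sum_(i < n) l_ i).
Proof.
elim: n => [_|n IH H].
  by rewrite big_ord0; under eq_fun do rewrite big_ord0; exact: tends_cst.
rewrite big_ord_recr /=; under eq_fun do rewrite big_ord_recr /=.
by apply: tendsD; [apply: IH => i /ltnW; exact: H|exact: H].
Qed.

Lemma tends_le v l M N : (forall n, (N <= n)%N -> nrm (v n) <= M) ->
  tends v l -> nrm l <= M.
Proof.
move=> vM vl; apply/ler_addgt0Pr => e e0; have [N' H] := vl e e0.
rewrite -(subrK (v (maxn N N')) l) addrC; apply: le_trans (nrmD _ _) _.
by rewrite lerD ?vM ?leq_maxl// ltW// H// leq_maxr.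
Qed.

Lemma tends_eq v v' l : v =1 v' -> tends v l -> tends v' l.
Proof. by move=> /funext ->. Qed.

Lemma tends_cauchy v : (forall e, 0 < e -> exists N, forall m n,
  (N <= m)%N -> (N <= n)%N -> nrm (v m - v n) < e) -> exists l, tends v l.
Proof.
move=> cv; have /cauchy_cvg : cauchy (v @ \oo).
  apply/cauchyP => _ /pos_realC[e e0 ->]; have [N vN] := cv e e0.
  by exists (v N); rewrite ball_nrmE; exists N => // n /=; apply: vN.
by move=> vl; exists (lim (v @ \oo)); apply/tendsP.
Qed.

(** Said with partial sums rather than as a limit, so that comparisons with S hold at
    every finite stage. *)
Definition rsum b S := [/\ forall k, 0 <= b k,
  forall n, \sum_(k < n) b k <= S &
  forall e, 0 < e -> exists N, forall n, (N <= n)%N -> S - e < \sum_(k < n) b k].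

Lemma rsum_nondecr b m n : (forall k, 0 <= b k) -> (m <= n)%N ->
  \sum_(k < m) b k <= \sum_(k < n) b k.
Proof.
move=> b0 mn; rewrite -(subnKC mn) -[leLHS]addr0.
by rewrite big_split_ord/= lerD2l sumr_ge0.
Qed.

Lemma rsum_exists b M : (forall k, 0 <= b k) -> (forall n, \sum_(k < n) b k <= M) ->
  exists2 S, rsum b S & S <= M.
Proof.
move=> b0 bM; pose X := range (fun n => \sum_(k < n) b k).
have X0 : X !=set0 by exists (\sum_(k < 0) b k), 0%N.
have Xs : has_sup X by split=> //; exists M => _ [n _ <-].
exists (sup X); last by apply: ge_sup => // _ [n _ <-].
split=> // [n|e e0]; first by apply: ub_le_sup; [exact: Xs.2|exists n].
have [_ [N _ <-] HN] := sup_adherent e0 Xs.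
by exists N => n Nn; apply: lt_le_trans HN _; exact: rsum_nondecr.
Qed.

Lemma nrm_sum n u b : (forall k, nrm (u k) <= b k) ->
  nrm (\sum_(k < n) u k) <= \sum_(k < n) b k.
Proof.
move=> ub; elim: n => [|n IH]; first by rewrite !big_ord0 nrm0.
by rewrite !big_ord_recr /=; apply: le_trans (nrmD _ _) _; rewrite lerD.
Qed.

Lemma nrm_sum_diff m n u b : (m <= n)%N -> (forall k, nrm (u k) <= b k) ->
  nrm (\sum_(k < n) u k - \sum_(k < m) u k) <= \sum_(k < n) b k - \sum_(k < m) b k.
Proof.
move=> mn ub; rewrite -(subnKC mn) !big_split_ord/= ![_ + _ - _]addrAC !subrr !add0r.
exact: (@nrm_sum _ (fun k => u (m + k)%N) (fun k => b (m + k)%N)).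
Qed.

(** Absolute convergence, with the error controlled by the tail of the majorant;
    uniform convergence of power series is read off from this estimate. *)
Lemma abs_sums u b S : (forall k, nrm (u k) <= b k) -> rsum b S ->
  exists2 l, sums u l & forall n, nrm (l - \sum_(k < n) u k) <= S - \sum_(k < n) b k.
Proof.
move=> ub [b0 bS bt].
have [e e0|l ul] := @tends_cauchy (fun n => \sum_(k < n) u k).
  have [N HN] := bt e e0; exists N => m n.
  wlog mn : m n / (m <= n)%N.
    move=> H Nm Nn; case/orP: (leq_total m n) => mn; first exact: H.
    by rewrite nrmB; exact: H.
  move=> Nm Nn; rewrite nrmB; apply: le_lt_trans (nrm_sum_diff mn ub) _.
  by have := HN m Nm; have := bS n; lra.
exists l => // n; apply: (@tends_le (fun m => \sum_(k < m) u k - \sum_(k < n) u k) _ _ n).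
  move=> m nm; apply: le_trans (nrm_sum_diff nm ub) _.
  by rewrite lerD2r.
by apply: tendsB => //; exact: tends_cst.
Qed.

Lemma sums_tail u b S l n : (forall k, nrm (u k) <= b k) -> rsum b S -> sums u l ->
  nrm (l - \sum_(k < n) u k) <= S - \sum_(k < n) b k.
Proof.
by move=> ub bS ul; have [l' ul'] := abs_sums ub bS; rewrite (tends_unique ul ul').
Qed.

Lemma sums_bound u b S l : (forall k, nrm (u k) <= b k) -> rsum b S -> sums u l ->
  nrm l <= S.
Proof.
move=> ub bS ul; have := sums_tail 0 ub bS ul.
by rewrite !big_ord0 !subr0.
Qed.

(** Rearrangement of a triangular array. The first N columns and the first N rows
    differ by entries of rows beyond N, whose total is at most the tail of b. *)
Lemma double_sums (a : nat -> nat -> scalars R) b S (q : nat -> scalars R) g :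
  (forall k n, (k < n)%N -> a k n = 0) ->
  (forall k n, \sum_(j < n) nrm (a k j) <= b k) -> rsum b S ->
  (forall n, sums (fun k => a k n) (q n)) ->
  sums (fun k => \sum_(n < k.+1) a k n) g -> sums q g.
Proof.
move=> a0 ab bS aq ag.
have qN N : nrm (\sum_(n < N) q n - \sum_(k < N) \sum_(n < k.+1) a k n)
    <= S - \sum_(k < N) b k.
  pose c k := \sum_(n < N) a k n.
  have cb k : nrm (c k) <= b k.
    by apply: le_trans (ab k N); apply: (@nrm_sum N (a k) (fun j => nrm (a k j))).
  have cq : sums c (\sum_(n < N) q n).
    apply: tends_eq (@tends_sum N (fun n m => \sum_(k < m) a k n) q (fun n _ => aq n)).
    by move=> m /=; rewrite exchange_big.
  have := sums_tail N cb bS cq; congr (nrm (_ - _) <= _).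
  apply: eq_bigr => -[k kN] _ /=; rewrite /c -(subnKC kN) big_split_ord/=.
  by rewrite [X in _ + X]big1 ?addr0// => i _; apply: a0; rewrite addSn ltnS leq_addr.
move=> e e0; have e2 : 0 < e / 2 by rewrite divr_gt0.
have [N HN] := ag _ e2; have [_ _ /(_ _ e2)[N' HN']] := bS.
exists (maxn N N') => n; rewrite geq_max => /andP[/HN gn /HN' Sn].
set T := \sum_(k < n) \sum_(j < k.+1) a k j in gn.
have -> : g - \sum_(k < n) q k = (g - T) + (T - \sum_(k < n) q k).
  by rewrite addrA subrK.
apply: le_lt_trans (nrmD _ _) _; rewrite [nrm (T - _)]nrmB.
have := qN n; rewrite -/T => qn.
have Snb : S - \sum_(k < n) b k <= e / 2.
  by move: Sn; lra.
by have := lerD (ltW gn) (le_trans qn Snb); move: gn; lra.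
Qed.

End Limits.

(** * Uniqueness of power series and the identity theorem *)

Section PowerSeries.
Context {R : realType}.

Lemma uniform_seqP (E : normedModType R[i]) (X : set E)
    (F : nat -> E -> scalars R) (f : E -> scalars R) :
  {uniform X, F @ \oo --> f} <->
  forall e : R, 0 < e -> exists N, forall n, (N <= n)%N ->
    forall x, X x -> nrm (f x - F n x) < e.
Proof.
split=> [Ff e e0|H].
  have entU : entourage [set xy : scalars R * scalars R | ball xy.1 (e%:C%C) xy.2].
    by rewrite -entourage_from_ballE; exists (e%:C%C) => //=; rewrite ltcR.
  have : nbhs (f : {uniform` X -> scalars R}) [set h | forall y, X y -> nrm (f y - h y) < e].
    apply/uniform_nbhs; exists [set xy : scalars R * scalars R | ball xy.1 (e%:C%C) xy.2].
    split=> // h Eh y Xy; have := Eh y Xy.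
    by rewrite /= ball_nrmE.
  by move=> /Ff [N _ HN]; exists N => n Nn; exact: HN.
move=> U /uniform_nbhs[V []]; rewrite -entourage_from_ballE
  => -[_ /= /pos_realC[e e0 ->] eV VU].
have [N HN] := H e e0; exists N => // n Nn; apply: VU => x Xx; apply: eV => /=.
by rewrite ball_nrmE; exact: HN.
Qed.

Lemma nrm_rpow (E : normedModType R[i]) (s : R) k (v : E) :
  nrm ((s%:C%C : R[i]) ^+ k *: v) = `|s| ^+ k * nrm v.
Proof.
elim: k v => [|k IH] v; first by rewrite !expr0 scale1r mul1r.
rewrite exprSr -scalerA IH nrmZ exprSr mulrA; congr (_ * _ * _).
by rewrite nrm_scalarE /= expr0n addr0 sqrtr_sqr.
Qed.

Definition real_series (a : nat -> scalars R) (s : R) : nat -> scalars R :=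
  fun k => (s%:C%C : R[i]) ^+ k *: a k.

Lemma half_sum (n : nat) : \sum_(k < n) (2^-1 : R) ^+ k <= 2.
Proof.
suff -> : \sum_(k < n) (2^-1 : R) ^+ k = 2 - 2 * 2^-1 ^+ n.
  by rewrite gerBl mulr_ge0// exprn_ge0.
elim: n => [|n IH]; first by rewrite big_ord0 expr0 mulr1 subrr.
by rewrite big_ord_recr /= IH exprS; lra.
Qed.

Lemma sums_term_bounded (u : nat -> scalars R) l : sums u l ->
  exists M, forall k, nrm (u k) <= M.
Proof.
move=> /(_ 1 ltr01)[N HN]; exists (2 + \sum_(j < N) nrm (u j)) => k.
have s0 : 0 <= \sum_(j < N) nrm (u j) by apply: sumr_ge0 => i _; exact: nrm_ge0.
have [kN|Nk] := ltnP k N.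
  rewrite (bigD1 (Ordinal kN))//= addrCA lerDl addr_ge0//.
  by apply: sumr_ge0 => i _; exact: nrm_ge0.
have -> : u k = (l - \sum_(j < k) u j) - (l - \sum_(j < k.+1) u j).
  have cancel_diff (p q r : scalars R) : r = (p - q) - (p - (q + r)).
    by ring.
  by rewrite big_ord_recr; exact: cancel_diff.
apply: le_trans (nrmD _ _) _.
have -> : nrm (- (l - \sum_(j < k.+1) u j)) = nrm (l - \sum_(j < k.+1) u j).
  by rewrite -sub0r nrmB subr0.
have := HN k Nk; have := HN k.+1 (leqW Nk); lra.
Qed.

(** At a zero s the lowest nonvanishing term a_k s^k equals the tail of the series,
    which is O(s^(k+1)); letting the zeros tend to 0 gives a_k = 0. *)
Lemma coef_unique (a : nat -> scalars R) :
  (forall e : R, 0 < e -> exists s : R, [/\ s != 0, `|s| < e & sums (real_series a s) 0]) ->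
  forall k, a k = 0.
Proof.
move=> H k; have [s0 [s0n0 _ /sums_term_bounded[M HM]]] := H 1 ltr01.
pose rho := `|s0|; have rho0 : 0 < rho by rewrite normr_gt0.
have M0 : 0 <= M by apply: le_trans (HM 0%N); exact: nrm_ge0.
have aM j : nrm (a j) <= M / rho ^+ j.
  by rewrite ler_pdivlMr ?exprn_gt0// mulrC; have := HM j; rewrite nrm_rpow.
elim/ltn_ind: k => k IH; apply: nrm_eq0; apply/eqP; apply: contraT => ak0.
have {}ak0 : 0 < nrm (a k) by rewrite lt_neqAle eq_sym ak0 nrm_ge0.
(* The tail is at most 2 M (|s| / rho)^(k+1) when |s| <= rho / 2; the summand 1
   only makes K positive. *)
pose K := 2 * M / rho ^+ k.+1 + 1.
have rk0 : 0 < rho ^+ k.+1 by rewrite exprn_gt0.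
have K0 : 0 < K by rewrite ltr_wpDl// divr_ge0 ?mulr_ge0// ltW.
have [|s [sn0 s_lt ss]] := H (Num.min (rho / 2) (nrm (a k) / K)).
  by rewrite lt_min !divr_gt0.
move: s_lt; rewrite lt_min => /andP[s1 s2].
have as0 : 0 < `|s| by rewrite normr_gt0.
pose t := `|s| / rho.
have t0 : 0 <= t by rewrite divr_ge0// ltW.
have t2 : t <= 2^-1.
  by rewrite /t ler_pdivrMr// mulrC ltW.
have bnd : nrm (real_series a s k) <= M * t ^+ k.+1 * 2.
  have -> : nrm (real_series a s k) = nrm (0 - real_series a s k).
    by rewrite nrmB subr0.
  apply: (@tends_le _ (fun n => \sum_(j < n) real_series a s j - real_series a s k) _ _ k.+1).
    move=> n kn; rewrite -(subnKC kn) big_split_ord/= big_ord_recr/=.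
    rewrite big1 ?add0r; last by move=> j _; rewrite /real_series IH ?scaler0.
    rewrite addrAC subrr add0r; set m := (n - k.+1)%N.
    apply: le_trans (@nrm_sum _ m (fun j => real_series a s (k.+1 + j)%N)
       (fun j => M * t ^+ k.+1 * 2^-1 ^+ j) _) _.
      move=> j; rewrite /real_series nrm_rpow.
      apply: le_trans (_ : `|s| ^+ (k.+1 + j) * (M / rho ^+ (k.+1 + j)) <= _).
        by rewrite ler_wpM2l// exprn_ge0.
      rewrite mulrCA -expr_div_n -/t exprD mulrA ler_wpM2l//.
        by rewrite mulr_ge0// exprn_ge0.
      by apply: lerXn2r => //; rewrite ?nnegrE ?invr_ge0.
    by rewrite -mulr_sumr ler_wpM2l ?half_sum// mulr_ge0// exprn_ge0.
  by apply: tendsB => //; exact: tends_cst.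
move: bnd; rewrite /real_series nrm_rpow /t expr_div_n.
have -> : M * (`|s| ^+ k.+1 / rho ^+ k.+1) * 2 = `|s| ^+ k * (`|s| * (2 * M / rho ^+ k.+1)).
  by rewrite exprS; ring.
rewrite ler_pM2l ?exprn_gt0// => le1.
have : nrm (a k) < nrm (a k).
  apply: le_lt_trans le1 _; move: s2; rewrite ltr_pdivlMr// /K mulrDr mulr1.
  by apply: le_lt_trans; rewrite lerDl.
by rewrite ltxx.
Qed.

Lemma real_seriesB a a' s l l' : sums (real_series a s) l -> sums (real_series a' s) l' ->
  sums (real_series (fun k => a k - a' k) s) (l - l').
Proof.
move=> al al'; apply: tends_eq (tendsB al al') => n /=.
by rewrite -sumrB; apply: eq_bigr => k _; rewrite /real_series scalerBr.
Qed.

Lemma coef_eq (a a' : nat -> scalars R) (d : R) : 0 < d ->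
  (forall s, `|s| < d -> exists2 l, sums (real_series a s) l & sums (real_series a' s) l) ->
  a = a'.
Proof.
move=> d0 H; apply/funext => k; apply/eqP; rewrite -subr_eq0; apply/eqP.
apply: (@coef_unique (fun k => a k - a' k)) => e e0.
pose s := Num.min e d / 2.
have m0 : 0 < Num.min e d by rewrite lt_min e0 d0.
have s0 : 0 < s by rewrite divr_gt0.
have [se sd] : s < e /\ s < d.
  have : s < Num.min e d by rewrite /s ltr_pdivrMr// ltr_pMr// ltr1n.
  by rewrite lt_min => /andP[].
have [|l al al'] := H s; first by rewrite gtr0_norm.
exists s; split; [by rewrite gt_eqF|by rewrite gtr0_norm|].
by rewrite -(subrr l); exact: real_seriesB.
Qed.

Lemma sums0 : sums (fun=> 0) (0 : scalars R).
Proof. by move=> e e0; exists 0%N => n _; rewrite big1// subr0 nrm0. Qed.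

(** Only real values of the variable occur: a line through 0 in E suffices for the
    identity theorem. *)
Definition locally_analytic (h : R -> scalars R) := forall t0 : R,
  exists (a : nat -> scalars R) (d : R), 0 < d /\
    forall s, `|s| < d -> sums (real_series a s) (h (t0 + s)).

(** The set of points near which h vanishes is open, and it is closed because at a
    limit point the zeros accumulate; the real line is connected. *)
Lemma identity_line (h : R -> scalars R) (d : R) : locally_analytic h -> 0 < d ->
  (forall s, `|s| < d -> h s = 0) -> forall t, h t = 0.
Proof.
move=> hA d0 h0.
pose D := [set t | exists2 e, 0 < e & forall s, `|s| < e -> h (t + s) = 0].
have Dopen : open D.
  rewrite openE => t [e e0 te]; apply/nbhs_ballP; exists e => //= t' tt'.
  exists (e - `|t - t'|); first by rewrite subr_gt0.
  move=> s; rewrite ltrBrDl => se.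
  rewrite (_ : t' + s = t + ((t' - t) + s)); last by ring.
  by apply: te; apply: le_lt_trans (ler_normD _ _) _; rewrite [`|t' - t|]distrC.
have Dclosed : closed D.
  move=> t0 t0D; have [a [e [e0 ae]]] := hA t0.
  exists e => // s se.
  have a0 : forall k, a k = 0.
    apply: coef_unique => e1 e10; pose e2 := Num.min e e1.
    have e20 : 0 < e2 by rewrite lt_min e0.
    have [t1 [[e3 e30 t1e] t1t0]] := t0D _ (nbhsx_ballx t0 e2 e20).
    pose e4 := Num.min e3 (e2 - `|t0 - t1|).
    have e40 : 0 < e4 by rewrite lt_min e30 subr_gt0.
    (* If t1 happens to be t0 itself, a small shift yields a nonzero s1. *)
    have [s1 [s1n0 s1e hs1]] : exists s1, [/\ s1 != 0, `|s1| < e2 & h (t0 + s1) = 0].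
      have [t10|t10] := eqVneq t1 t0.
        exists (e4 / 2); rewrite gt_eqF ?divr_gt0//.
        have e42 : `|e4 / 2| < e4.
          by rewrite gtr0_norm ?divr_gt0// ltr_pdivrMr// ltr_pMr// ltr1n.
        split=> //.
          apply: lt_le_trans e42 _; rewrite /e4 ge_min; apply/orP; right.
          by rewrite gerBl.
        rewrite -t10; apply: t1e; apply: lt_le_trans e42 _.
        by rewrite /e4 ge_min lexx.
      exists (t1 - t0); rewrite subr_eq0; split=> //; first by rewrite distrC.
      by rewrite addrC subrK -[t1]addr0; apply: t1e; rewrite normr0.
    move: s1e; rewrite lt_min => /andP[s1e s1e1].
    by exists s1; split=> //; rewrite -hs1; exact: ae.
  apply: (tends_unique (ae s se)); apply: tends_eq sums0 => n.
  by apply: eq_bigr => k _; rewrite /real_series a0 scaler0.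
have DT : D = setT.
  have /(_ D) H : connected [set: R] by apply/connected_intervalP.
  apply: H.
  - by exists 0, d => // s /h0; rewrite add0r.
  - by exists D => //; rewrite setTI.
  - by exists D => //; rewrite setTI.
move=> t; have [e e0 te] : D t by rewrite DT.
by rewrite -[t]addr0; apply: te; rewrite normr0.
Qed.

Section Entire.
Context {E : banach R}.
Implicit Types (f g : E -> scalars R) (P : nat -> E -> scalars R).

(** By homogeneity, a power series in E becomes on each line through the centre an
    ordinary power series whose coefficients are the values P k x. *)
Lemma power_series_line f a P x : power_series_at f a P ->
  exists2 d : R, 0 < d & forall s, `|s| < d ->
    sums (real_series (fun k => P k x) s) (f (a + (s%:C%C : R[i]) *: x)).
Proof.
move=> [hP [r r0 /uniform_seqP H]].
have nx : 0 < nrm x + 1 by rewrite ltr_wpDl ?nrm_ge0.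
exists (r / (nrm x + 1)); first exact: divr_gt0.
move=> s; rewrite ltr_pdivlMr// => sr e e0; have [N HN] := H e e0.
exists N => n Nn; pose v := (s%:C%C : R[i]) *: x.
have av : a + v - a = v by rewrite addrAC subrr add0r.
have vr : nrm v < r.
  apply: le_lt_trans sr; rewrite /v -[(s%:C)%C]expr1 nrm_rpow expr1.
  by rewrite ler_wpM2l// lerDl.
have := HN n Nn (a + v); rewrite /= av => /(_ vr); congr (nrm (_ - _) < e).
by apply: eq_bigr => k _; exact: apoly_hom (hpoly_apoly (hP k)).
Qed.

Lemma power_series_unique f a P P' : power_series_at f a P ->
  power_series_at f a P' -> P = P'.
Proof.
move=> fP fP'; apply/funext => k; apply/funext => x.
have [d d0 H] := power_series_line x fP; have [d' d'0 H'] := power_series_line x fP'.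
suff : (fun k => P k x) = (fun k => P' k x) by move/(congr1 (fun c : nat -> scalars R => c k)).
apply: (@coef_eq _ _ (Num.min d d')); first by rewrite lt_min d0.
by move=> s; rewrite lt_min => /andP[/H sd /H' sd']; exists (f (a + (s%:C%C : R[i]) *: x)).
Qed.

Lemma entire_line f x : entire f -> locally_analytic (fun t : R => f ((t%:C%C : R[i]) *: x)).
Proof.
move=> ef t0; have [P fP] := ef ((t0%:C%C : R[i]) *: x).
have [d d0 H] := power_series_line x fP; exists (fun k => P k x), d; split=> // s /H.
by rewrite rmorphD scalerDl.
Qed.

(** Every x is joined to 0 by the line t |-> t x, on which the identity theorem in
    one real variable applies. *)
Lemma entire_identity f g (d : R) : entire f -> entire g -> 0 < d ->
  (forall x, nrm x < d -> f x = g x) -> f = g.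
Proof.
move=> ef eg d0 fg; apply/funext => x.
pose h (t : R) := f ((t%:C%C : R[i]) *: x) - g ((t%:C%C : R[i]) *: x).
have hA : locally_analytic h.
  move=> t0; have [a [e [e0 ae]]] := entire_line x ef t0.
  have [a' [e' [e'0 ae']]] := entire_line x eg t0.
  exists (fun k => a k - a' k), (Num.min e e'); rewrite lt_min e0 e'0; split=> // s.
  by rewrite lt_min => /andP[/ae ? /ae' ?]; exact: real_seriesB.
have nx : 0 < nrm x + 1 by rewrite ltr_wpDl ?nrm_ge0.
have := identity_line hA (divr_gt0 d0 nx) _ 1.
rewrite /h scale1r => H; apply/eqP; rewrite -subr_eq0 H// => s.
rewrite ltr_pdivlMr// => sd; rewrite fg ?subrr//.
rewrite -[(s%:C)%C]expr1 nrm_rpow expr1; apply: le_lt_trans sd.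
by rewrite ler_wpM2l// lerDl.
Qed.

Lemma taylor_unique f P : power_series_at f 0 P -> taylor f = P.
Proof.
move=> fP; apply: xget_unique => // P' fP'; exact: power_series_unique fP' fP.
Qed.

End Entire.

Lemma rapid_geometric (y : nat -> R) N : (forall k, (N <= k)%N -> y k <= 2^-1 ^+ k) ->
  exists M, forall n, \sum_(k < n) y k <= M.
Proof.
move=> yN; exists (\sum_(k < N) `|y k| + 2) => n.
pose z k := if (k < N)%N then `|y k| else 0.
have z0 k : 0 <= z k by rewrite /z; case: ifP.
apply: le_trans (_ : \sum_(k < n) (z k + 2^-1 ^+ k) <= _).
  apply: ler_sum => k _; rewrite /z; case: ltnP => [_|/yN]; last by rewrite add0r.
  by apply: le_trans (ler_norm _) _; rewrite lerDl exprn_ge0.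
rewrite big_split/= lerD ?half_sum//.
apply: le_trans (rsum_nondecr z0 (leq_maxl n N)) _.
rewrite -(subnKC (leq_maxr n N)) big_split_ord/= [X in _ + X]big1 ?addr0.
  by apply: ler_sum => k _; rewrite /z ltn_ord.
by move=> k _; rewrite /z ltnNge leq_addr.
Qed.

(** The root test: eventually x k is at most (2 (r + 1))^-k. The term of index 0 is
    replaced by c because constants are measured by their absolute value. *)
Lemma root_lim_rapid (x : nat -> R) : (forall k, (0 < k)%N -> 0 <= x k) ->
  (x k `^ k%:R^-1) @[k --> \oo] --> (0 : R) ->
  forall r, 0 <= r -> forall c : R,
    exists M, forall n, \sum_(k < n) (if k == 0%N :> nat then c else x k) * r ^+ k <= M.
Proof.
move=> x0 xl r r0 c; pose e := (2 * (r + 1))^-1.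
have r10 : 0 < r + 1 by rewrite ltr_wpDl.
have e0 : 0 < e by rewrite invr_gt0 mulr_gt0.
move/cvgrPdist_lt : xl => /(_ _ e0)[N _ HN].
apply: (@rapid_geometric (fun k => (if k == 0%N then c else x k) * r ^+ k) N.+1) => k Nk.
have k0 : (0 < k)%N by apply: leq_trans Nk.
have xk0 := x0 _ k0.
rewrite gtn_eqF//; have := HN k (ltnW Nk); rewrite /= sub0r normrN.
rewrite ger0_norm ?powR_ge0// => /ltW.
move=> /(lerXn2r k) - /(_ (powR_ge0 _ _) (ltW e0)).
rewrite -powR_mulrn ?powR_ge0// -powRrM mulVf ?pnatr_eq0 -?lt0n// powRr1// => xe.
apply: le_trans (_ : e ^+ k * r ^+ k <= _); first by rewrite ler_wpM2r ?exprn_ge0.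
have er0 : 0 <= e * r by rewrite mulr_ge0// ltW.
rewrite -exprMn; apply: lerXn2r; rewrite ?nnegrE//.
rewrite /e invfM -mulrA ler_piMr ?invr_ge0// mulrC ler_pdivrMr// mul1r.
by rewrite lerDl.
Qed.

(** Boundedness of x k r^k for r = 4 / e gives x k <= M (e / 4)^k, and M is
    eventually absorbed by 2^k. *)
Lemma rapid_root_lim (x : nat -> R) : (forall k, (0 < k)%N -> 0 <= x k) ->
  (forall r, 0 <= r -> exists M, forall k, (0 < k)%N -> x k * r ^+ k <= M) ->
  (x k `^ k%:R^-1) @[k --> \oo] --> (0 : R).
Proof.
move=> x0 xr; apply/cvgrPdist_lt => e e0.
have [M HM] := xr (4 / e) (divr_ge0 (ler0n _ 4) (ltW e0)).
pose N := Num.Def.archi_bound `|M|; exists N.+1 => // k /= Nk.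
have k0 : (0 < k)%N by apply: leq_trans Nk.
have Mk : M <= 2 ^+ k.
  apply: le_trans (ler_norm _) _; apply: le_trans (ltW (archi_boundP (normr_ge0 M))) _.
  rewrite -natrX ler_nat; apply: leq_trans (ltnW Nk) _.
  exact/ltnW/ltn_expl.
have xk : x k <= (e / 2) ^+ k.
  have ek : 0 < (4 / e) ^+ k by rewrite exprn_gt0// divr_gt0.
  have := HM k k0; rewrite -ler_pdivlMr// => /le_trans; apply.
  rewrite ler_pdivrMr// -exprMn.
  by rewrite (_ : e / 2 * (4 / e) = 2)//; field; rewrite gt_eqF.
rewrite sub0r normrN ger0_norm ?powR_ge0//.
apply: le_lt_trans (_ : e / 2 < _); last by rewrite ltr_pdivrMr// ltr_pMr// ltr1n.
have kn : (k%:R : R) != 0 by rewrite pnatr_eq0 -lt0n.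
have -> : e / 2 = ((e / 2) ^+ k) `^ k%:R^-1.
  rewrite -powR_mulrn ?divr_ge0 ?ltW// -powRrM mulfV// powRr1// divr_ge0// ltW//.
apply: ge0_ler_powR; rewrite ?invr_ge0 ?ler0n// nnegrE ?x0//.
by rewrite exprn_ge0// divr_ge0// ltW.
Qed.

Lemma shift_sum (V : zmodType) (f : nat -> V) n K :
  \sum_(k < K) (if (n <= k)%N then f (k - n)%N else 0) = \sum_(j < K - n) f j.
Proof.
elim: K => [|K IH]; first by rewrite sub0n !big_ord0.
rewrite big_ord_recr /= IH; case: leqP => [nK|Kn].
  by rewrite subSn// big_ord_recr.
rewrite addr0; move: (Kn); rewrite -subn_eq0 => /eqP ->.
by move/ltnW: Kn; rewrite -subn_eq0 => /eqP ->.
Qed.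

Lemma tri_sum (V : zmodType) (a : nat -> V) k N : (k < N)%N ->
  \sum_(n < N) (if (n <= k)%N then a n else 0) = \sum_(n < k.+1) a n.
Proof.
move=> kN; rewrite -(subnKC kN) big_split_ord/= [X in _ + X]big1 ?addr0.
  by apply: eq_bigr => n _; rewrite -ltnS ltn_ord.
by move=> n _; rewrite leqNgt ltnS leq_addr.
Qed.

Lemma cauchy_bound (b b' : nat -> R) S S' : rsum b S -> rsum b' S' -> forall N,
  \sum_(k < N) \sum_(i < k.+1) b i * b' (k - i)%N <= S * S'.
Proof.
move=> [b0 bS _] [b'0 bS' _] N.
have S0 : 0 <= S by have := bS 0%N; rewrite big_ord0.
rewrite (eq_bigr (fun k : 'I_N => \sum_(i < N) (if (i <= k)%N then b i * b' (k - i)%N else 0))).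
  rewrite exchange_big/=.
  apply: le_trans (_ : \sum_(i < N) b i * S' <= _).
    apply: ler_sum => i _.
    rewrite (eq_bigr (fun k : 'I_N => b i * (if (i <= k)%N then b' (k - i)%N else 0))).
      by rewrite -mulr_sumr shift_sum ler_wpM2l.
    by move=> k _; case: ifP; rewrite ?mulr0.
  have S'0 : 0 <= S' by have := bS' 0%N; rewrite big_ord0.
  by rewrite -mulr_suml ler_wpM2r.
by move=> [k kN] _ /=; rewrite (tri_sum (fun i => b i * b' (k - i)%N)).
Qed.

(** The product series is the sum by rows of the array u_n v_(k-n), whose columns
    sum to u_n times the second sum. *)
Lemma cauchy_product (u v : nat -> scalars R) (b b' : nat -> R) S S' l l' :
  (forall k, nrm (u k) <= b k) -> (forall k, nrm (v k) <= b' k) ->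
  rsum b S -> rsum b' S' -> sums u l -> sums v l' ->
  sums (fun k => \sum_(i < k.+1) u i * v (k - i)%N) (l * l').
Proof.
move=> ub vb bS bS' ul vl'.
pose a k n : scalars R := if (n <= k)%N then u n * v (k - n)%N else 0.
pose c k := \sum_(i < k.+1) b i * b' (k - i)%N.
have c0 k : 0 <= c k.
  by apply: sumr_ge0 => i _; rewrite mulr_ge0//; [case: bS|case: bS'].
have [T cT _] := rsum_exists c0 (cauchy_bound bS bS').
have uvb i j : nrm (u i * v j) <= b i * b' j by rewrite nrmM ler_pM ?nrm_ge0.
have row k : \sum_(n < k.+1) a k n = \sum_(i < k.+1) u i * v (k - i)%N.
  by apply: eq_bigr => n _; rewrite /a -ltnS ltn_ord.
have ac k n : \sum_(j < n) nrm (a k j) <= c k.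
  apply: le_trans (rsum_nondecr (fun j => nrm_ge0 (a k j)) (leq_maxl n k.+1)) _.
  rewrite (eq_bigr (fun j : 'I_(maxn n k.+1) => if (j <= k)%N then nrm (u j * v (k - j)%N) else 0)).
    rewrite (tri_sum (fun j => nrm (u j * v (k - j)%N))) ?leq_maxr//.
    by apply: ler_sum => i _; exact: uvb.
  by move=> j _; rewrite /a; case: ifP => // _; rewrite nrm0.
have rc k : nrm (\sum_(i < k.+1) u i * v (k - i)%N) <= c k.
  rewrite -row; apply: le_trans (ac k k.+1).
  exact: (@nrm_sum _ k.+1 (a k) (fun j => nrm (a k j))).
have [g rg _] := abs_sums rc cT.
have aq n : sums (fun k => a k n) (u n * l').
  move=> e e0.
  have un0 : 0 < nrm (u n) + 1 by rewrite ltr_wpDl ?nrm_ge0.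
  have [N HN] := vl' _ (divr_gt0 e0 un0); exists (n + N)%N => m nm.
  have -> : \sum_(k < m) a k n = u n * \sum_(j < m - n) v j.
    rewrite -shift_sum mulr_sumr; apply: eq_bigr => k _; rewrite /a.
    by case: ifP => // _; rewrite mulr0.
  rewrite -mulrBr nrmM; have := HN (m - n)%N; rewrite ltr_pdivlMr// => H.
  apply: le_lt_trans (H _); last by rewrite leq_subRL// (leq_trans _ nm)// leq_addr.
  by rewrite mulrC ler_wpM2l ?nrm_ge0// lerDl.
have gE : sums (fun n => u n * l') g.
  apply: (double_sums _ ac cT aq); first by move=> k n kn; rewrite /a leqNgt kn.
  by apply: tends_eq rg => n; apply: eq_bigr => k _; rewrite row.
have lE : sums (fun n => u n * l') (l * l').
  rewrite (_ : l * l' = (l' : R[i]) *: l); last exact: mulrC.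
  apply: tends_eq (tendsZ (l' : R[i]) ul) => n.
  by rewrite scaler_sumr; apply: eq_bigr => k _; exact: mulrC.
by rewrite (tends_unique lE gE).
Qed.

End PowerSeries.

(** * Rapidly convergent expansions and their translates *)

Section RealSums.
Context {R : realType}.
Implicit Types b : nat -> R.

Lemma rsum_cvg b S : rsum b S -> (fun n => \sum_(k < n) b k) @ \oo --> S.
Proof.
move=> [b0 bS bt]; apply/cvgrPdist_lt => e e0; have [N HN] := bt e e0.
exists N => // n Nn; rewrite ger0_norm ?subr_ge0//.
by rewrite ltrBlDr -ltrBlDl HN.
Qed.

Lemma rsum_lim b S : rsum b S -> limn (series b) = S.
Proof.
move=> /rsum_cvg bS; apply/cvg_lim => //.
rewrite (_ : series b = fun n => \sum_(k < n) b k)//.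
by apply/funext => n; rewrite /series /= big_mkord.
Qed.

Lemma cvg_le (f : nat -> R) l M : f @ \oo --> l -> (forall n, f n <= M) -> l <= M.
Proof.
move=> fl fM; apply/ler_addgt0Pr => e e0.
move/cvgrPdist_lt : fl => /(_ e e0)[N _ /(_ N (leqnn N))] /=.
move=> H; have := le_lt_trans (ler_norm _) H; have := fM N; lra.
Qed.

Lemma binom_sum_le (k N : nat) (y r : R) : 0 <= y -> 0 <= r ->
  \sum_(n < N) 'C(k, n)%:R * y ^+ (k - n) * r ^+ n <= (r + y) ^+ k.
Proof.
move=> y0 r0; pose f n := 'C(k, n)%:R * y ^+ (k - n) * r ^+ n.
have f0 n : 0 <= f n by rewrite !mulr_ge0// exprn_ge0.
apply: le_trans (rsum_nondecr f0 (leq_maxl N k.+1)) _.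
rewrite -(subnKC (leq_maxr N k.+1)) big_split_ord/= [X in _ + X]big1 ?addr0.
  rewrite addrC exprDn le_eqVlt; apply/orP; left; apply/eqP.
  by apply: eq_bigr => n _; rewrite /f -mulrA mulr_natl.
by move=> n _; rewrite /f bin_small ?mul0r// addSn ltnS leq_addr.
Qed.

End RealSums.

Section Expansion.
Context {R : realType}.
Variables (A : nat -> poly_ideal R).

(** The coefficients of the seminorms p_r; constants are measured by their absolute
    value, because the sequence of ideals starts at degree 1. *)
Definition coefnorm (F : banach R) (P : nat -> F -> scalars R) k : R :=
  if k == 0%N then nrm (P 0%N 0) else ideal_norm (A k) (P k).

Definition rapid (c : nat -> R) := forall r, 0 <= r ->
  exists M, forall n, \sum_(k < n) c k * r ^+ k <= M.

(** The description of H_bA(F) by series that replaces the one by Taylor coefficients: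
    no analyticity is assumed, and convergence to g holds on the whole of F. The two
    are shown equivalent in expansion_inHb and inHb_expansion. *)
Record expansion (F : banach R) (P : nat -> F -> scalars R) (g : F -> scalars R) : Prop := {
  exp_ideal : forall k, (0 < k)%N -> A k F (P k) ;
  exp_cst : forall x, P 0%N x = P 0%N 0 ;
  exp_rapid : rapid (coefnorm P) ;
  exp_sums : forall x, sums (fun k => P k x) (g x) }.

Hypothesis cA : coherent A.

Section Basics.
Variables (F : banach R) (P : nat -> F -> scalars R).
Hypothesis PA : forall k, (0 < k)%N -> A k F (P k).
Hypothesis P0 : forall x, P 0%N x = P 0%N 0.

Lemma coefnorm_ge0 k : 0 <= coefnorm P k.
Proof.
rewrite /coefnorm; case: eqP => [_|/eqP]; first exact: nrm_ge0.
rewrite -lt0n => k0; apply: (ideal_norm_ge0 (coherent_ideal cA k0)); exact: PA.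
Qed.

Lemma coef_apoly k : apoly k (P k).
Proof.
have [->|] := posnP k; last first.
  by move=> k0; apply: ideal_apoly (PA k0); exact: coherent_ideal.
by exists (fun=> P 0%N 0) => // x [].
Qed.

Lemma coef_hpoly k : hpoly k F (P k).
Proof.
have [->|] := posnP k; last first.
  by move=> k0; apply: (ideal_hpoly (coherent_ideal cA k0)); exact: PA.
split; last exact: coef_apoly.
rewrite (_ : P 0%N = fun=> P 0%N 0); last exact/funext.
exact: cst_continuous.
Qed.

Lemma nrm_coef k x : nrm (P k x) <= coefnorm P k * nrm x ^+ k.
Proof.
rewrite /coefnorm; case: eqP => [->|/eqP]; first by rewrite P0 expr0 mulr1.
rewrite -lt0n => k0; apply: le_ideal_norm (PA k0); exact: coherent_ideal.
Qed.

Lemma nrm_coef_le k x r : nrm x <= r -> nrm (P k x) <= coefnorm P k * r ^+ k.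
Proof.
move=> xr; apply: le_trans (nrm_coef k x) _; rewrite ler_wpM2l ?coefnorm_ge0//.
by apply: lerXn2r; rewrite // ?nnegrE ?nrm_ge0// (le_trans (nrm_ge0 x)).
Qed.

Lemma rapid_rsum r : 0 <= r -> rapid (coefnorm P) ->
  exists S, rsum (fun k => coefnorm P k * r ^+ k) S.
Proof.
move=> r0 /(_ r r0)[M HM].
have b0 k : 0 <= coefnorm P k * r ^+ k.
  by rewrite mulr_ge0 ?coefnorm_ge0 ?exprn_ge0.
by have [S HS _] := rsum_exists b0 HM; exists S.
Qed.

Lemma rapid_sums x : rapid (coefnorm P) -> exists l, sums (fun k => P k x) l.
Proof.
move=> /(rapid_rsum (nrm_ge0 x))[S HS].
by have [l ?] := abs_sums (fun k => nrm_coef k x) HS; exists l.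
Qed.

End Basics.

(** The majorant with r = 1 is independent of the point, so convergence is uniform
    on the unit ball around a. *)
Lemma expansion_power_series (F : banach R) P (g : F -> scalars R) a :
  expansion P (fun x => g (a + x)) -> power_series_at g a P.
Proof.
move=> [PA P0 Pr Ps]; split; first exact: coef_hpoly.
exists 1 => //; apply/uniform_seqP => e e0.
have [S HS] := rapid_rsum PA ler01 Pr.
have [_ _ /(_ e e0)[N HN]] := HS; exists N => n Nn x /= xa.
have := sums_tail n (fun k => nrm_coef_le PA P0 k (ltW xa)) HS (Ps (x - a)).
rewrite [a + _]addrC subrK => /le_lt_trans; apply.
by have := HN n Nn; lra.
Qed.

Lemma sum_funE (T : Type) n (f : nat -> T -> scalars R) x :
  (\sum_(k < n) f k) x = \sum_(k < n) f k x.
Proof. by elim/big_ind2: _ => // f1 y1 f2 y2 <- <-. Qed.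

Variable C : R.
Hypothesis hC : pfix_bound A C.

Section Translate.
Variables (F : banach R) (P : nat -> F -> scalars R) (g : F -> scalars R) (a : F).
Hypothesis Pg : expansion P g.

Let PA := exp_ideal Pg.
Let P0 := exp_cst Pg.

(** The contribution of P k to the coefficient of degree n of the expansion around
    a, from the binomial formula for P k (a + x). *)
Definition shift_term k n (x : F) : scalars R :=
  if (n <= k)%N then
    ('C(k, n)%:R : R[i]) *: pol k (P k) (nseq (k - n) a ++ nseq n x)
  else 0.

Let y := C * nrm a.
Let y0 : 0 <= y.
Proof. by rewrite mulr_ge0 ?nrm_ge0//; apply: le_trans hC.1. Qed.

Let beta k n := coefnorm P k * ('C(k, n)%:R * y ^+ (k - n)).
Let beta_ge0 k n : 0 <= beta k n.
Proof. by rewrite !mulr_ge0 ?coefnorm_ge0// exprn_ge0. Qed.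

Lemma nrm_natr (m : nat) : nrm (m%:R : scalars R) = m%:R.
Proof.
by rewrite /nrm normr_nat; elim: m => // m IH; rewrite -!natr1 raddfD /= IH.
Qed.

Lemma shift_term_ideal k n : (0 < n)%N ->
  A n F (shift_term k n) /\ ideal_norm (A n) (shift_term k n) <= beta k n.
Proof.
move=> n0; have hn := coherent_ideal cA n0.
rewrite /shift_term; case: leqP => [nk|kn]; last first.
  rewrite (_ : (fun=> 0) = (0 : F -> scalars R))// (ideal_norm0 hn) beta_ge0.
  by split=> //; exact: (ideal_0 hn).
have k0 : (0 < k)%N by apply: leq_trans nk.
have skn : (size (nseq (k - n) a) + n = k)%N by rewrite size_nseq subnK.
have [] := @pol_ideal _ _ cA _ hC F (nseq (k - n) a) n (P k) n0.
  by rewrite skn; exact: PA.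
rewrite skn size_nseq; set G := (fun x : F => pol _ _ _) => GA Gn.
rewrite (_ : (fun x => _) = ('C(k, n)%:R : R[i]) *: G)//; split; first exact: (idealZ hn).
rewrite (ideal_normZ hn ('C(k, n)%:R : scalars R) GA) nrm_natr /beta mulrCA ler_wpM2l//.
apply: le_trans Gn _; rewrite /coefnorm gtn_eqF// [C ^+ _ * _]mulrC -mulrA ler_wpM2l//.
  by apply: (ideal_norm_ge0 (coherent_ideal cA k0)); exact: PA.
rewrite /y exprMn ler_wpM2l//; first by rewrite exprn_ge0//; apply: le_trans hC.1.
by elim: (k - n)%N => [|m IH]; rewrite /= ?big_nil ?big_cons// exprS ler_wpM2l ?nrm_ge0.
Qed.

Lemma shift_term0 k x : shift_term k 0 x = P k a.
Proof.
rewrite /shift_term leq0n bin0 subn0 cats0 scale1r pol_diag//.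
exact: coef_apoly.
Qed.

Lemma nrm_shift_term k n x : nrm (shift_term k n x) <= beta k n * nrm x ^+ n.
Proof.
have [->|n0] := posnP n.
  rewrite shift_term0 expr0 mulr1 /beta bin0 mul1r subn0.
  apply: nrm_coef_le => //; rewrite /y ler_peMl ?nrm_ge0//; exact: hC.1.
have [tA tn] := shift_term_ideal k n0.
apply: le_trans (le_ideal_norm (coherent_ideal cA n0) x tA) _.
by rewrite ler_wpM2r ?exprn_ge0 ?nrm_ge0.
Qed.

Let beta_row k N r : 0 <= r ->
  \sum_(n < N) beta k n * r ^+ n <= coefnorm P k * (r + y) ^+ k.
Proof.
move=> r0; rewrite /beta; under eq_bigr do rewrite -mulrA.
by rewrite -mulr_sumr ler_wpM2l ?coefnorm_ge0// binom_sum_le.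
Qed.

Let beta_rsum n : exists S, rsum (beta^~ n) S.
Proof.
have y10 : 0 <= 1 + y by rewrite addr_ge0.
have [M HM] := exp_rapid Pg y10.
have bM N : \sum_(k < N) beta k n <= M.
  apply: le_trans (HM N); apply: ler_sum => k _.
  apply: le_trans (beta_row k n.+1 ler01).
  rewrite big_ord_recr /= expr1n mulr1 lerDr sumr_ge0// => j _.
  by rewrite expr1n mulr1.
by have [S HS _] := rsum_exists (fun k => beta_ge0 k n) bM; exists S.
Qed.

Let T K n := \sum_(k < K) shift_term k n.

Let TA K n : (0 < n)%N -> A n F (T K n).
Proof.
move=> n0; apply: (ideal_sum (coherent_ideal cA n0) K (P_ := fun k => shift_term k n)).
by move=> k; exact: (shift_term_ideal k n0).1.
Qed.

Let T_diff n m K : (0 < n)%N -> (m <= K)%N ->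
  ideal_norm (A n) (T K n - T m n) <= \sum_(k < K) beta k n - \sum_(k < m) beta k n.
Proof.
move=> n0 mK; rewrite /T -(subnKC mK) !big_split_ord/= ![_ + _ - _]addrAC !subrr !add0r.
have tA k := (shift_term_ideal k n0).1.
apply: le_trans (ideal_norm_sum (coherent_ideal cA n0) (K - m)
  (P_ := fun k => shift_term (m + k) n) _) _ => //.
by apply: ler_sum => k _; exact: (shift_term_ideal _ n0).2.
Qed.

(** The coefficient of degree n of the translate exists as a limit in the Banach
    space A_n(F), which is where completeness of the ideals enters; in degree 0 it
    is the constant g a. *)
Lemma shift_lim n : exists Q : F -> scalars R,
  if n == 0%N then Q = fun=> g a else
  A n F Q /\ forall e, 0 < e -> exists N, forall K, (N <= K)%N ->
    ideal_norm (A n) (\sum_(k < K) shift_term k n - Q) < e.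
Proof.
have [_|n0] := posnP n; first by exists (fun=> g a).
have hn := coherent_ideal cA n0.
have [S [b0 bS bt]] := beta_rsum n.
have [e e0|Q QA TQ] := ideal_complete hn (fun K => TA K n0).
  have [N HN] := bt e e0; exists N => m K.
  wlog mK : m K / (m <= K)%N.
    move=> H Nm NK; case/orP: (leq_total m K) => mK; first exact: H.
    by rewrite (ideal_normBC hn (TA m n0) (TA K n0)); exact: H.
  move=> Nm NK; rewrite (ideal_normBC hn (TA m n0) (TA K n0)).
  apply: le_lt_trans (T_diff n0 mK) _.
  by have := HN m Nm; have := bS K; lra.
exists Q; split=> // e e0; move/cvgrPdist_lt : TQ => /(_ e e0)[N _ HN].
exists N => K NK; have := HN K NK; rewrite /= sub0r normrN.
by apply: le_lt_trans; exact: ler_norm.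
Qed.

(** Summing the bounds of shift_term_ideal over n first gives, by the binomial
    formula, the single series sum_k ||P_k|| (r + C |a|)^k. This majorant justifies
    the exchange of summations and bounds the seminorms of the translate. The last
    clause records the convergence in A_n(F), through which Aron-Berner extensions
    are later passed to the limit. *)
Lemma translate : exists Q : nat -> F -> scalars R,
  [/\ expansion Q (fun x => g (a + x)),
   forall r S, 0 <= r -> rsum (fun k => coefnorm P k * (r + C * nrm a) ^+ k) S ->
     forall N, \sum_(n < N) coefnorm Q n * r ^+ n <= S &
   forall n, (0 < n)%N -> (forall k, A n F (shift_term k n)) /\
     forall e, 0 < e -> exists N, forall K, (N <= K)%N ->
       ideal_norm (A n) (\sum_(k < K) shift_term k n - Q n) < e].
Proof.
have [Q HQ] := choice shift_lim.
have Q0 : Q 0%N = fun=> g a by have := HQ 0%N.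
have QA n : (0 < n)%N -> A n F (Q n) by move=> n0; have := HQ n; rewrite gtn_eqF// => -[].
have Qlim n : (0 < n)%N -> forall e, 0 < e -> exists N, forall K, (N <= K)%N ->
    ideal_norm (A n) (\sum_(k < K) shift_term k n - Q n) < e.
  by move=> n0; have := HQ n; rewrite gtn_eqF// => -[].
have Qpt n x : sums (fun k => shift_term k n x) (Q n x).
  have [->|n0] := posnP n.
    rewrite Q0; apply: tends_eq (exp_sums Pg a) => K.
    by apply: eq_bigr => k _; rewrite shift_term0.
  have hn := coherent_ideal cA n0.
  move=> e e0; have xn0 : 0 < nrm x ^+ n + 1 by rewrite ltr_wpDl ?exprn_ge0 ?nrm_ge0.
  have [N HN] := Qlim n n0 _ (divr_gt0 e0 xn0); exists N => K NK.
  have TQA := idealB hn (TA K n0) (QA n n0).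
  rewrite nrmB -(sum_funE K (fun k => shift_term k n)).
  apply: le_lt_trans (le_ideal_norm hn x TQA) _.
  have := HN K NK; rewrite ltr_pdivlMr//; apply: le_lt_trans.
  by rewrite ler_wpM2l ?(ideal_norm_ge0 hn)// lerDl.
have [Sb HSb] := choice beta_rsum.
have QS n : coefnorm Q n <= Sb n.
  rewrite /coefnorm; case: eqP => [->|/eqP].
    rewrite Q0; apply: (sums_bound _ (HSb 0%N) (exp_sums Pg a)) => k.
    by have := nrm_shift_term k 0 a; rewrite shift_term0 expr0 mulr1.
  rewrite -lt0n => n0; have hn := coherent_ideal cA n0.
  apply/ler_addgt0Pr => e e0; have [N /(_ N (leqnn N)) HN] := Qlim n n0 e e0.
  have -> : Q n = (Q n - T N n) + T N n by rewrite subrK.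
  apply: le_trans (ideal_normD hn (idealB hn (QA n n0) (TA N n0)) (TA N n0)) _.
  rewrite addrC lerD//; last by rewrite (ideal_normBC hn (QA n n0) (TA N n0)) ltW.
  have [_ bS _] := HSb n; apply: le_trans (bS N).
  apply: le_trans (ideal_norm_sum hn N (P_ := fun k => shift_term k n) _) _.
    by move=> k; exact: (shift_term_ideal k n0).1.
  by apply: ler_sum => k _; exact: (shift_term_ideal _ n0).2.
have Qr r S : 0 <= r -> rsum (fun k => coefnorm P k * (r + C * nrm a) ^+ k) S ->
    forall N, \sum_(n < N) coefnorm Q n * r ^+ n <= S.
  move=> r0 [b0 bS _] N.
  apply: le_trans (_ : \sum_(n < N) Sb n * r ^+ n <= _).
    by apply: ler_sum => n _; rewrite ler_wpM2r ?exprn_ge0.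
  apply: (@cvg_le _ (fun K => \sum_(n < N) (\sum_(k < K) beta k n) * r ^+ n)).
    elim: N => [|N IH].
      by rewrite big_ord0; under eq_fun do rewrite big_ord0; exact: cvg_cst.
    rewrite big_ord_recr /=; under eq_fun do rewrite big_ord_recr /=.
    by apply: cvgD => //; apply: cvgM; [exact: rsum_cvg (HSb N)|exact: cvg_cst].
  move=> K; under eq_bigr do rewrite mulr_suml.
  rewrite exchange_big /=; apply: le_trans (bS K).
  by apply: ler_sum => k _; exact: beta_row.
exists Q; split=> //; last first.
  by move=> n n0; split; [move=> k; exact: (shift_term_ideal k n0).1|exact: Qlim].
split=> // [x|r r0|x]; first by rewrite Q0.
  have ry0 : 0 <= r + y by rewrite addr_ge0.
  have [S HS] := rapid_rsum PA ry0 (exp_rapid Pg).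
  by exists S; exact: Qr.
have xy0 : 0 <= nrm x + y by rewrite addr_ge0 ?nrm_ge0.
have [S HS] := rapid_rsum PA xy0 (exp_rapid Pg).
apply: (double_sums (a := fun k n => shift_term k n x) _ _ HS) => [k n kn|k n|n|].
- by rewrite /shift_term leqNgt kn.
- apply: le_trans (beta_row k n (nrm_ge0 x)); apply: ler_sum => j _.
  exact: nrm_shift_term.
- exact: Qpt.
- apply: tends_eq (exp_sums Pg (a + x)) => K; apply: eq_bigr => k _.
  have aP := coef_apoly PA P0 k.
  rewrite -(pol_diag _ aP) -[nseq k (a + x)]cats0.
  rewrite (symlist_binom _ _ (pol_symlist aP)) ?addn0//.
  apply: eq_bigr => n _; rewrite /shift_term -ltnS ltn_ord cats0.
  rewrite -[RHS]/((_ : scalars R) * _); congr (_ * _).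
Qed.

End Translate.

End Expansion.
(** * The space of entire functions of bounded type *)

Section HbExpansion.
Context {R : realType}.
Variables (A : nat -> poly_ideal R) (cA : coherent A) (E : banach R).
Implicit Types (f g : E -> scalars R) (P Q : nat -> E -> scalars R).

Lemma power_series_sums f a P : power_series_at f a P ->
  exists2 r : R, 0 < r & forall x, nrm (x - a) < r -> sums (fun k => P k (x - a)) (f x).
Proof.
move=> [_ [r r0 /uniform_seqP H]]; exists r => // x xr e e0.
by have [N HN] := H e e0; exists N => n Nn; exact: HN.
Qed.

Lemma expansion_power_series0 f P : expansion A P f -> power_series_at f 0 P.
Proof.
move=> fP; apply: (expansion_power_series cA).
by rewrite (_ : (fun x => f (0 + x)) = f)//; apply/funext => x; rewrite add0r.
Qed.

(** The translate of g to a is again given by an expansion, hence by a power series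
    at a. *)
Lemma expansion_entire f P : expansion A P f -> entire f.
Proof.
move=> fP a; have [C hC] := coherent_pfix_bound cA.
have [Q [fQ _ _]] := translate cA hC a fP; exists Q.
exact: expansion_power_series fQ.
Qed.

Lemma expansion_taylor f P : expansion A P f -> taylor f = P.
Proof. by move=> /expansion_power_series0; exact: taylor_unique. Qed.

Lemma expansion_inHb f P : expansion A P f -> in_Hb A f.
Proof.
move=> fP; have tP := expansion_taylor fP; split; first exact: expansion_entire fP.
  by rewrite tP; exact: exp_ideal fP.
rewrite tP; apply: rapid_root_lim => [k k0|r r0].
  by apply: (ideal_norm_ge0 (coherent_ideal cA k0)); exact: exp_ideal fP _ k0.
have [M HM] := exp_rapid fP r0; exists M => k k0; apply: le_trans (HM k.+1).
rewrite big_ord_recr /= {2}/coefnorm gtn_eqF// lerDr sumr_ge0// => j _.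
by rewrite mulr_ge0 ?exprn_ge0//; apply: coefnorm_ge0 => //; exact: exp_ideal fP.
Qed.

Lemma hpoly0_cst (p : E -> scalars R) : hpoly 0 E p -> forall x, p x = p 0.
Proof.
by move=> [_ [L _ pL]] x; rewrite !pL; congr L; apply/funext; case.
Qed.

(** The Taylor series of f at 0 converges everywhere by the growth condition, and its
    sum is entire; the identity theorem identifies it with f. *)
Lemma inHb_expansion f : in_Hb A f -> expansion A (taylor f) f.
Proof.
move=> [ef fA fl].
have fT : power_series_at f 0 (taylor f) by apply: xgetPex; exact: ef.
have T0 := hpoly0_cst (fT.1 0%N).
have Tr : rapid (coefnorm A (taylor f)).
  move=> r r0; have := @root_lim_rapid _ (fun k => ideal_norm (A k) (taylor f k)) _ fl r r0.
  move=> /(_ _ (nrm (taylor f 0%N 0))) []; last by move=> M HM; exists M.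
  by move=> k k0; apply: (ideal_norm_ge0 (coherent_ideal cA k0)); exact: fA.
have [F HF] := choice (fun x => rapid_sums cA fA T0 x Tr).
have FT : expansion A (taylor f) F by split.
have [r r0 fr] := power_series_sums fT.
suff Ff : F = f by rewrite -[X in expansion _ _ X]Ff.
apply: (@entire_identity _ _ _ _ r) => // [|x xr]; first exact: expansion_entire FT.
have := fr x; rewrite subr0 => /(_ xr) fx; exact: tends_unique (HF x) fx.
Qed.

Lemma expansion_at0 f P : expansion A P f -> f 0 = P 0%N 0.
Proof.
move=> fP; apply: (tends_unique (exp_sums fP 0)) => e e0; exists 1%N => n n1.
rewrite -(subnKC n1) big_split_ord/= big_ord1 big1 ?addr0 ?subrr ?nrm0//.
move=> k _; apply/nrm_eq0/eqP; rewrite eq_le nrm_ge0 andbT.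
have := nrm_coef cA (exp_ideal fP) (exp_cst fP) (1 + k) 0.
by rewrite nrm0 expr0n mulr0.
Qed.

(** Connects the seminorm, defined as the limit of a series, with sums of
    nonnegative terms. *)
Lemma seminorm_rsum f P r : expansion A P f -> 0 <= r ->
  rsum (fun k => coefnorm A P k * r ^+ k) (Hb_seminorm A r f).
Proof.
move=> fP r0; have [S HS] := rapid_rsum cA (exp_ideal fP) r0 (exp_rapid fP).
suff -> : Hb_seminorm A r f = S by [].
rewrite -(rsum_lim HS) /Hb_seminorm (expansion_taylor fP) (expansion_at0 fP).
by congr (limn (series _)); apply/funext => k; rewrite /coefnorm; case: eqP => // ->.
Qed.

Lemma rapid_le (c c' : nat -> R) (al : R) : 0 <= al ->
  (forall k, c' k <= al ^+ k * c k) -> rapid c -> rapid c'.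
Proof.
move=> al0 cc' cr r r0; have [M HM] := cr (al * r) (mulr_ge0 al0 r0).
exists M => n; apply: le_trans (HM n); apply: ler_sum => k _.
by rewrite exprMn mulrA [c k * _]mulrC ler_wpM2r ?exprn_ge0.
Qed.

Lemma expansion_lin f g P Q (a : R[i]) : expansion A P f -> expansion A Q g ->
  expansion A (fun k => a *: P k + Q k) (a *: f + g).
Proof.
move=> fP gQ; split.
- move=> k k0; apply: (ideal_linear (coherent_ideal cA k0)).
    exact: exp_ideal fP _ k0.
  exact: exp_ideal gQ _ k0.
- move=> x; rewrite -[LHS]/(a *: P 0%N x + Q 0%N x) -[RHS]/(a *: P 0%N 0 + Q 0%N 0).
  by rewrite (exp_cst fP) (exp_cst gQ).
- move=> r r0; have [M HM] := exp_rapid fP r0; have [M' HM'] := exp_rapid gQ r0.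
  exists (nrm (a : scalars R) * M + M') => n.
  apply: le_trans (_ : \sum_(k < n) (nrm (a : scalars R) * (coefnorm A P k * r ^+ k)
     + coefnorm A Q k * r ^+ k) <= _); last first.
    rewrite big_split/=; apply: lerD; last exact: HM'.
    by rewrite -mulr_sumr; apply: ler_wpM2l; [exact: nrm_ge0|exact: HM].
  apply: ler_sum => k _; rewrite mulrA -mulrDl ler_wpM2r ?exprn_ge0//.
  rewrite /coefnorm; case: eqP => [_|/eqP].
    by apply: le_trans (nrmD _ _) _; rewrite nrmZ.
  rewrite -lt0n => k0; have hk := coherent_ideal cA k0.
  have PA := exp_ideal fP k0; have QA := exp_ideal gQ k0.
  apply: le_trans (ideal_normD hk (idealZ hk a PA) QA) _.
  by rewrite (ideal_normZ hk (a : scalars R) PA).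
- move=> x; apply: tends_eq (tendsD (tendsZ a (exp_sums fP x)) (exp_sums gQ x)) => n.
  by rewrite scaler_sumr -big_split.
Qed.

Lemma expansion_line f P x (s : R) : expansion A P f ->
  sums (real_series (fun k => P k x) s) (f ((s%:C%C : R[i]) *: x)).
Proof.
move=> fP; apply: tends_eq (exp_sums fP ((s%:C%C : R[i]) *: x)) => n.
apply: eq_bigr => k _; apply: apoly_hom.
exact: coef_apoly (exp_ideal fP) (exp_cst fP) k.
Qed.

(** On each line both sides are power series of f times g, the right-hand side by
    the Cauchy product; their coefficients agree by uniqueness. *)
Lemma expansion_mul f g P Q S : expansion A P f -> expansion A Q g ->
  expansion A S (fun x => f x * g x) ->
  forall k x, S k x = \sum_(i < k.+1) P i x * Q (k - i)%N x.
Proof.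
move=> fP gQ hS k x.
suff : (fun k => S k x) = (fun k => \sum_(i < k.+1) P i x * Q (k - i)%N x).
  by move/(congr1 (fun c : nat -> scalars R => c k)).
apply: (@coef_eq _ _ _ 1) => // s _; set v := (s%:C%C : R[i]) *: x.
exists (f v * g v); first exact: expansion_line hS.
have [T HT] := rapid_rsum cA (exp_ideal fP) (nrm_ge0 v) (exp_rapid fP).
have [U HU] := rapid_rsum cA (exp_ideal gQ) (nrm_ge0 v) (exp_rapid gQ).
have := cauchy_product (fun i => nrm_coef cA (exp_ideal fP) (exp_cst fP) i v)
  (fun i => nrm_coef cA (exp_ideal gQ) (exp_cst gQ) i v) HT HU (exp_sums fP v) (exp_sums gQ v).
apply: tends_eq => n; apply: eq_bigr => j _; rewrite /real_series scaler_sumr.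
apply: eq_bigr => i _; rewrite /v.
rewrite (apoly_hom _ _ (coef_apoly cA (exp_ideal fP) (exp_cst fP) i)).
rewrite (apoly_hom _ _ (coef_apoly cA (exp_ideal gQ) (exp_cst gQ) (j - i))).
rewrite -scalerAl -scalerAr scalerA -exprD subnKC// -ltnS; exact: ltn_ord.
Qed.

End HbExpansion.

(** * The Aron-Berner extension of an entire function *)

Section AronBernerExpansion.
Context {R : realType}.
Variables (A : nat -> poly_ideal R) (cA : coherent A) (E : banach R).
Hypothesis rA : regular_at A E.
Variables (alpha : R) (alpha0 : 0 < alpha).
Hypothesis hAB : forall (E : banach R) k, (0 < k)%N -> forall P : E -> scalars R, A k E P ->
  A k (bidual E) (aron_berner k P) /\
  ideal_norm (A k) (aron_berner k P) <= alpha ^+ k * ideal_norm (A k) P.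
Variables (C : R) (hC : pfix_bound A C).
Implicit Types (f g : E -> scalars R) (P Q : nat -> E -> scalars R).

Lemma canon_bound (x : E) : nrm (canon x : bidual E) <= 1 * nrm x.
Proof.
rewrite mul1r nrm_clin; apply: opnorm_le => [|g]; first exact: nrm_ge0.
by rewrite /= mulrC; exact: le_opnorm.
Qed.

Definition canon_clin : clin E (bidual E) :=
  Clin (bounded_clinear (@canonZD R E) canon_bound).

Lemma canon_clin_norm : nrm canon_clin <= 1.
Proof. by rewrite nrm_clin; apply: opnorm_le => // x; exact: canon_bound. Qed.

(** The canonical injection has norm at most 1, so restriction to E does not
    increase ideal norms. *)
Lemma ideal_comp_canon n (G : bidual E -> scalars R) : (0 < n)%N -> A n (bidual E) G ->
  A n E (fun x => G (canon x)) /\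
  ideal_norm (A n) (fun x : E => G (canon x)) <= ideal_norm (A n) G.
Proof.
move=> n0 GA; have hn := coherent_ideal cA n0.
have [GcA Gcn] := ideal_comp hn canon_clin GA; split=> //.
apply: le_trans Gcn _; rewrite ler_piMr ?(ideal_norm_ge0 hn)//.
by rewrite exprn_ile1 ?nrm_ge0// canon_clin_norm.
Qed.

Lemma AB_cst (c : scalars R) : aron_berner 0 (fun _ : E => c) = fun=> c.
Proof. by apply: (@aron_bernerE _ _ 0 _ (fun=> c)) => // x []. Qed.

(** The right-hand side is a weak-star polynomial extending the polynomial on the
    left. *)
Lemma AB_lin k (a : R[i]) (P Q : E -> scalars R) : (0 < k)%N -> A k E P -> A k E Q ->
  aron_berner k (a *: P + Q) = fun z => a *: aron_berner k P z + aron_berner k Q z.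
Proof.
move=> k0 PA QA;
rewrite -(wpoly_AB (wpoly_lin a (AB_wpoly cA rA k0 PA) (AB_wpoly cA rA k0 QA))).
by congr aron_berner; apply/funext => x; rewrite !(AB_canon cA rA).
Qed.

(** The bounds of AB-closedness are geometric in the degree, so the growth condition
    survives. *)
Lemma AB_expansion f P : expansion A P f ->
  expansion A (fun k => aron_berner k (P k)) (AB f).
Proof.
move=> fP; have PA := exp_ideal fP.
have P0E : P 0%N = fun=> P 0%N 0 by apply/funext; exact: exp_cst fP.
have ABA k : (0 < k)%N -> A k (bidual E) (aron_berner k (P k)).
  by move=> k0; exact: (hAB k0 (PA k k0)).1.
have AB0 z : aron_berner 0 (P 0%N) z = P 0%N 0 by rewrite P0E AB_cst.
have ABr : rapid (coefnorm A (fun k => aron_berner k (P k))).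
  apply: (rapid_le (ltW alpha0) _ (exp_rapid fP)) => k.
  rewrite /coefnorm; case: eqP => [->|/eqP]; first by rewrite AB0 expr0 mul1r.
  by rewrite -lt0n => k0; exact: (hAB k0 (PA k k0)).2.
split=> // [x|x]; first by rewrite !AB0.
have [l Hl] := rapid_sums cA ABA (fun x => etrans (AB0 x) (esym (AB0 0))) x ABr.
suff -> : AB f x = l by [].
rewrite /AB (expansion_taylor cA fP); exact: sums_lim.
Qed.

(** The map G |-> AB (G \o J) is bounded on A_n(E'') and fixes every G_ K, hence
    also their limit. *)
Lemma AB_fixed_limit n (G_ : nat -> bidual E -> scalars R) (G : bidual E -> scalars R) :
  (0 < n)%N -> (forall K, A n (bidual E) (G_ K)) -> (forall K, wpoly n (G_ K)) ->
  A n (bidual E) G ->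
  (forall e, 0 < e -> exists N, forall K, (N <= K)%N -> ideal_norm (A n) (G_ K - G) < e) ->
  aron_berner n (fun x => G (canon x)) = G.
Proof.
move=> n0 G_A G_g GA lim; have hn := coherent_ideal cA n0.
have Gc := (ideal_comp_canon n0 GA).1.
set H := aron_berner n _; have HA : A n (bidual E) H := (hAB n0 Gc).1.
suff : H - G = 0 by move/eqP; rewrite subr_eq0 => /eqP.
have HGA := idealB hn HA GA; apply: (ideal_norm_eq0 hn HGA).
apply/eqP; rewrite eq_le (ideal_norm_ge0 hn HGA) andbT.
apply/ler_addgt0Pr => e e0; rewrite add0r.
have a1 : 0 < alpha ^+ n + 1 by rewrite ltr_wpDl// exprn_ge0// ltW.
have [N /(_ N (leqnn N)) HN] := lim _ (divr_gt0 e0 a1).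
have GNA := idealB hn (G_A N) GA.
have [GNcA GNcn] := ideal_comp_canon n0 GNA.
(* G_ N is its own extension, so G_ N - H is the extension of G_ N - G. *)
have ABd : aron_berner n (fun x => (G_ N - G) (canon x)) = G_ N - H.
  rewrite (_ : (fun x => _) = (-1 : R[i]) *: (fun x => G (canon x)) + (fun x => G_ N (canon x))).
    rewrite (AB_lin (-1) n0 Gc (ideal_comp_canon n0 (G_A N)).1) (wpoly_AB (G_g N)).
    by apply/funext => z; rewrite scaleN1r addrC.
  by apply/funext => x; rewrite scaleN1r addrC.
have [ABdA ABdn] := hAB n0 GNcA.
rewrite ABd in ABdA ABdn.
have -> : H - G = (G_ N - G) - (G_ N - H).
  by rewrite opprB [RHS]addrC addrA subrK.
apply: le_trans (ideal_normD hn GNA _) _.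
  by rewrite -[X in A n _ X]scaleN1r; exact: (idealZ hn (-1) ABdA).
rewrite (ideal_normN hn ABdA).
have : ideal_norm (A n) (G_ N - H) <= alpha ^+ n * ideal_norm (A n) (G_ N - G).
  by apply: le_trans ABdn _; rewrite ler_wpM2l// exprn_ge0// ltW.
move: HN; rewrite ltr_pdivlMr// mulrDr mulr1 => HN HN'.
by apply: ltW; apply: le_lt_trans HN; rewrite addrC lerD// mulrC.
Qed.

(** The coefficients Q n of the translate of AB f are limits of weak-star polynomials,
    so they are the Aron-Berner extensions of their restrictions to E. These
    restrictions are the Taylor coefficients of tau z f, and therefore AB (tau z f)
    is the translate of AB f. *)
Lemma AB_translate f P z : expansion A P f ->
  exists Q : nat -> bidual E -> scalars R,
  [/\ expansion A Q (fun w => AB f (z + w)),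
   expansion A (fun n x => Q n (canon x)) (fun x : E => AB f (z + canon x)),
   AB (fun x : E => AB f (z + canon x)) = (fun w => AB f (z + w)) &
   forall r, 0 <= r -> forall N,
     \sum_(n < N) coefnorm A (fun n x => Q n (canon x : bidual E)) n * r ^+ n
       <= Hb_seminorm A (alpha * (r + C * nrm z)) f].
Proof.
move=> fP; have ABfP := AB_expansion fP.
have [Q [fQ Qr Ql]] := translate cA hC z ABfP.
have QA := exp_ideal fQ; have Q0 := exp_cst fQ.
have QcA n (n0 : (0 < n)%N) := ideal_comp_canon n0 (QA n n0).
have Qcn n : coefnorm A (fun n x => Q n (canon x : bidual E)) n <= coefnorm A Q n.
  rewrite /coefnorm; case: eqP => [_|/eqP]; first by rewrite Q0.
  by rewrite -lt0n => n0; exact: (QcA n n0).2.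
have fQc : expansion A (fun n x => Q n (canon x)) (fun x : E => AB f (z + canon x)).
  split=> [n n0|x|r r0|x].
  - exact: (QcA n n0).1.
  - by rewrite Q0 [RHS]Q0.
  - have [M HM] := exp_rapid fQ r0; exists M => n; apply: le_trans (HM n).
    by apply: ler_sum => k _; rewrite ler_wpM2r ?exprn_ge0.
  - exact: exp_sums fQ (canon x).
exists Q; split=> //; last first.
  move=> r r0 N; have rz : 0 <= r + C * nrm z.
    by rewrite addr_ge0// mulr_ge0 ?nrm_ge0//; apply: le_trans hC.1.
  have [S HS] := rapid_rsum cA (exp_ideal ABfP) rz (exp_rapid ABfP).
  apply: le_trans (_ : \sum_(n < N) coefnorm A Q n * r ^+ n <= _).
    by apply: ler_sum => k _; rewrite ler_wpM2r ?exprn_ge0.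
  apply: le_trans (Qr r S r0 HS N) _.
  have [_ bS _] := seminorm_rsum cA fP (mulr_ge0 (ltW alpha0) rz).
  apply: (cvg_le (rsum_cvg HS)) => K; apply: le_trans (bS K).
  apply: ler_sum => k _; rewrite exprMn mulrA ler_wpM2r ?exprn_ge0//.
  rewrite mulrC /coefnorm; case: eqP => [->|/eqP].
    rewrite expr0 mul1r (_ : P 0%N = fun=> P 0%N 0) ?AB_cst//.
    by apply/funext; exact: exp_cst fP.
  by rewrite -lt0n => k0; exact: (hAB k0 (exp_ideal fP k0)).2.
apply/funext => w; apply: (tends_unique (exp_sums (AB_expansion fQc) w)).
apply: tends_eq (exp_sums fQ w) => K; apply: eq_bigr => n _.
have [n0|n0] := posnP n.
  rewrite n0 (_ : (fun x : E => _) = fun=> Q 0%N 0) ?AB_cst ?Q0//.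
  by apply/funext => x; rewrite Q0.
have [TA Tl] := Ql n n0.
rewrite (AB_fixed_limit n0 _ _ (QA _ n0) Tl)// => m.
  exact: (ideal_sum (coherent_ideal cA n0) m (P_ := fun k => shift_term _ z k n)).
rewrite (_ : \sum_(k < m) _ =
  fun x => \sum_(k < m) shift_term (fun k => aron_berner k (P k)) z k n x).
  apply: (@wpoly_sum _ _ n m (fun k => shift_term (fun k => aron_berner k (P k)) z k n)) => k.
  rewrite /shift_term; case: leqP => [nk|_]; last exact: wpoly0.
  apply: wpolyZ; have kn : (k - n + n = k)%N by rewrite subnK.
  have := @AB_pol_wpoly _ _ cA _ rA (k - n)%N n (P k) z; rewrite kn; apply.
    exact: leq_trans nk.
  by apply: exp_ideal fP _ _; exact: leq_trans nk.
by apply/funext => x; exact: (sum_funE m (fun k => shift_term _ z k n) x).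
Qed.

Lemma AB_canonE f P x : expansion A P f -> AB f (canon x) = f x.
Proof.
move=> fP; apply: (tends_unique (exp_sums (AB_expansion fP) (canon x))).
apply: tends_eq (exp_sums fP x) => n; apply: eq_bigr => k _.
have [k0|k0] := posnP k; last by rewrite (AB_canon cA rA _ k0)//; exact: exp_ideal fP _ k0.
rewrite k0 (_ : P 0%N = fun=> P 0%N 0) ?AB_cst//; apply/funext; exact: exp_cst fP.
Qed.

Lemma AB_linear f g P Q (a : R[i]) : expansion A P f -> expansion A Q g ->
  AB (a *: f + g) = fun z => a *: AB f z + AB g z.
Proof.
move=> fP gQ; apply/funext => z.
apply: (tends_unique (exp_sums (AB_expansion (expansion_lin cA a fP gQ)) z)).
apply: tends_eq (tendsD (tendsZ a (exp_sums (AB_expansion fP) z))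
  (exp_sums (AB_expansion gQ) z)) => n.
rewrite scaler_sumr -big_split; apply: eq_bigr => k _ /=.
have [k0|k0] := posnP k; last first.
  by rewrite AB_lin//; [exact: exp_ideal fP _ k0|exact: exp_ideal gQ _ k0].
have [p Pp] : exists p, P 0%N = fun=> p.
  by exists (P 0%N 0); apply/funext; exact: exp_cst fP.
have [q Qq] : exists q, Q 0%N = fun=> q.
  by exists (Q 0%N 0); apply/funext; exact: exp_cst gQ.
rewrite k0 Pp Qq (_ : _ *: _ + _ = fun=> a *: p + q)//.
by rewrite !AB_cst.
Qed.

(** Each coefficient of the product is a sum of products of coefficients, and the
    products of the extensions are weak-star polynomials extending them. *)
Lemma AB_mul f g P Q S : expansion A P f -> expansion A Q g ->
  expansion A S (fun x => f x * g x) ->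
  AB (fun x => f x * g x) = fun z => AB f z * AB g z.
Proof.
move=> fP gQ hS; have SE := expansion_mul cA fP gQ hS.
have ABfP := AB_expansion fP; have ABgQ := AB_expansion gQ.
apply/funext => z; apply: (tends_unique (exp_sums (AB_expansion hS) z)).
have [T HT] := rapid_rsum cA (exp_ideal ABfP) (nrm_ge0 z) (exp_rapid ABfP).
have [U HU] := rapid_rsum cA (exp_ideal ABgQ) (nrm_ge0 z) (exp_rapid ABgQ).
have := cauchy_product (fun i => nrm_coef cA (exp_ideal ABfP) (exp_cst ABfP) i z)
  (fun i => nrm_coef cA (exp_ideal ABgQ) (exp_cst ABgQ) i z) HT HU
  (exp_sums ABfP z) (exp_sums ABgQ z).
apply: tends_eq => n; apply: eq_bigr => k _.
have ABc P' f' x : expansion A P' f' -> aron_berner 0 (P' 0%N) x = P' 0%N 0.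
  move=> fP'; have [p Pp] : exists p, P' 0%N = fun=> p.
    by exists (P' 0%N 0); apply/funext; exact: exp_cst fP'.
  by rewrite Pp AB_cst.
pose G i (w : bidual E) := aron_berner i (P i) w * aron_berner (k - i) (Q (k - i)%N) w.
have [k0|k0] := posnP k.
  rewrite k0 big_ord1 subn0 !(ABc _ _ _ fP) !(ABc _ _ _ gQ) (ABc _ _ _ hS) SE.
  by rewrite big_ord1 subn0.
have ABj j x : aron_berner j (P j) (canon x) = P j x.
  have [->|j0] := posnP j; last by rewrite (AB_canon cA rA _ j0)//; exact: exp_ideal fP _ j0.
  by rewrite (ABc _ _ _ fP) (exp_cst fP x).
have ABq j x : aron_berner j (Q j) (canon x) = Q j x.
  have [->|j0] := posnP j; last by rewrite (AB_canon cA rA _ j0)//; exact: exp_ideal gQ _ j0.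
  by rewrite (ABc _ _ _ gQ) (exp_cst gQ x).
have gA P' f' j : expansion A P' f' -> wpoly j (aron_berner j (P' j)).
  move=> fP'; have [->|j0] := posnP j; last by apply: (AB_wpoly cA rA j0); exact: exp_ideal fP' _ j0.
  by exists (fun=> P' 0%N 0) => [x []//|w]; rewrite (ABc _ _ _ fP').
have gG i : (i < k.+1)%N -> wpoly k (G i).
  rewrite ltnS => ik; rewrite -[X in wpoly X](subnKC ik).
  by apply: wpoly_mul; [exact: gA fP|exact: gA gQ].
pose G' i := if (i < k.+1)%N then G i else fun=> 0.
have gG' i : wpoly k (G' i).
  by rewrite /G'; case: ifP => [/gG//|_]; exact: wpoly0.
rewrite (_ : S k = fun x => \sum_(i < k.+1) G' i (canon x)).
  rewrite (wpoly_AB (wpoly_sum k.+1 gG')).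
  by apply: eq_bigr => i _; rewrite /G' ltn_ord.
apply/funext => x; rewrite SE; apply: eq_bigr => i _.
by rewrite /G' ltn_ord /G ABj ABq.
Qed.

End AronBernerExpansion.

(** * Translations and the topology of the function space *)

(** Principle for identifying the neighbourhoods of a point in a topology given by a
    subbase: N stands for the intended neighbourhood filter. *)
Lemma subbase_nbhd (T : Type) (I : choiceType) (D : set I) (b : I -> set T)
    (N : set T -> Prop) (x : T) :
  N setT -> (forall U V, N U -> N V -> N (U `&` V)) ->
  (forall U V, U `<=` V -> N U -> N V) ->
  (forall i, D i -> b i x -> N (b i)) ->
  forall D', D' `<=` finI_from D b -> (\bigcup_(B in D') B) x ->
    N (\bigcup_(B in D') B).
Proof.
move=> NT NI NS Nb D' sD' [B D'B Bx].
apply: (NS B); first by move=> y By; exists B.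
have [S sSD SB] := sD' _ D'B; rewrite -SB in Bx *.
have H (s : seq I) : (forall i, i \in s -> D i /\ b i x) ->
    N (\bigcap_(i in [set i | i \in s]) b i).
  elim: s => [_|i s IH Hs]; first by apply: (NS setT) => // y _ i.
  apply: (NS (b i `&` \bigcap_(i in [set i | i \in s]) b i)).
    move=> y [yi ys] j /=; rewrite inE => /orP[/eqP->//|js].
    exact: ys.
  apply: NI.
    by have [Di bi] := Hs i (mem_head _ _); exact: Nb.
  by apply: IH => j js; apply: Hs; rewrite inE js orbT.
apply: (H (finmap.enum_fset S)) => i iS; split; last exact: Bx.
by have := sSD i iS; rewrite inE.
Qed.

Section Translations.
Context {R : realType}.
Variables (A : nat -> poly_ideal R) (cA : coherent A) (E : banach R).
Hypothesis rA : regular_at A E.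
Variables (alpha : R) (alpha0 : 0 < alpha).
Hypothesis hAB : forall (E : banach R) k, (0 < k)%N -> forall P : E -> scalars R, A k E P ->
  A k (bidual E) (aron_berner k P) /\
  ideal_norm (A k) (aron_berner k P) <= alpha ^+ k * ideal_norm (A k) P.
Variables (C : R) (hC : pfix_bound A C).
Notation H := (Hb A E).
Notation M := (spectrum A E).
Implicit Types (f g h : H) (phi psi : M) (z w : bidual E).

Let Hexp f := inHb_expansion cA (svalP f).

Lemma Hb_eq f g : sval f = sval g -> f = g.
Proof.
case: f g => [f hf] [g hg] /= fg; move: hf; rewrite fg => hf.
by congr exist; exact: Prop_irrelevance.
Qed.

Definition mkHb (f : E -> scalars R) P (fP : expansion A P f) : H :=
  exist _ f (expansion_inHb cA fP).

Lemma tau_sval z f : sval (tau z f) = (fun x => AB (sval f) (z + canon x)).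
Proof.
have [Q [_ fQ _ _]] := AB_translate cA rA alpha0 hAB hC z (Hexp f).
exact: (@xgetI _ f [set g : H | sval g = _] (mkHb fQ) erefl).
Qed.

Lemma AB_tau z f : AB (sval (tau z f)) = fun w => AB (sval f) (z + w).
Proof.
by rewrite tau_sval; have [Q []] := AB_translate cA rA alpha0 hAB hC z (Hexp f).
Qed.

(** The group law: by AB_tau the second translation acts on AB f (z + .) itself and
    not merely on its restriction to E. *)
Lemma tauD z w f : tau w (tau z f) = tau (z + w) f.
Proof.
by apply: Hb_eq; rewrite tau_sval AB_tau tau_sval; apply/funext => x; rewrite addrA.
Qed.

Lemma tau0 f : tau 0 f = f.
Proof.
apply: Hb_eq; rewrite tau_sval; apply/funext => x; rewrite add0r.
exact: (AB_canonE cA rA alpha0 hAB x (Hexp f)).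
Qed.

Lemma tau_linear z (a : R[i]) f g h : sval h = a *: sval f + sval g ->
  sval (tau z h) = a *: sval (tau z f) + sval (tau z g).
Proof.
move=> hfg; move: (tau_sval z f) (tau_sval z g) (tau_sval z h).
case: (tau z f) => tf /= _; case: (tau z g) => tg /= _; case: (tau z h) => th /= _.
move=> -> -> ->; rewrite hfg (AB_linear cA rA alpha0 hAB a (Hexp f) (Hexp g)).
exact/funext.
Qed.

Lemma tau_mul z f g h : sval h = (fun x => sval f x * sval g x) ->
  sval (tau z h) = (fun x => sval (tau z f) x * sval (tau z g) x).
Proof.
move=> hfg; have hE := Hexp h; rewrite hfg in hE.
move: (tau_sval z f) (tau_sval z g) (tau_sval z h).
case: (tau z f) => tf /= _; case: (tau z g) => tg /= _; case: (tau z h) => th /= _.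
by move=> -> -> ->; rewrite hfg (AB_mul cA rA alpha0 hAB (Hexp f) (Hexp g) hE).
Qed.

Lemma Hb_lin (a : R[i]) f g : exists h, sval h = a *: sval f + sval g.
Proof. by exists (mkHb (expansion_lin cA a (Hexp f) (Hexp g))). Qed.

Definition Hdist r f g := Hb_seminorm A r (sval f - sval g).

Lemma Hb_sub f g : exists h, sval h = sval f - sval g.
Proof. by have [h hE] := Hb_lin (-1) g f; exists h; rewrite hE scaleN1r addrC. Qed.

Lemma seminormD f g h r : 0 <= r -> sval h = sval f + sval g ->
  Hb_seminorm A r (sval h) <= Hb_seminorm A r (sval f) + Hb_seminorm A r (sval g).
Proof.
move=> r0 hfg; have fP := Hexp f; have gQ := Hexp g.
have hE := expansion_lin cA 1 fP gQ; rewrite scale1r -hfg in hE.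
apply: (cvg_le (rsum_cvg (seminorm_rsum cA hE r0))) => n.
have [_ fS _] := seminorm_rsum cA fP r0; have [_ gS _] := seminorm_rsum cA gQ r0.
apply: le_trans (lerD (fS n) (gS n)); rewrite -big_split/=; apply: ler_sum => k _.
rewrite -mulrDl ler_wpM2r ?exprn_ge0// /coefnorm; case: eqP => [_|/eqP].
  by apply: le_trans (nrmD _ _) _; rewrite scale1r.
rewrite -lt0n => k0; rewrite scale1r.
by have := ideal_normD (coherent_ideal cA k0) (exp_ideal fP k0) (exp_ideal gQ k0).
Qed.

Lemma Hdist_triangle f g h r : 0 <= r -> Hdist r f h <= Hdist r f g + Hdist r g h.
Proof.
move=> r0; have [u uE] := Hb_sub f h; have [v vE] := Hb_sub f g.
have [w wE] := Hb_sub g h; rewrite /Hdist -uE -vE -wE; apply: seminormD => //.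
by rewrite uE vE wE addrA subrK.
Qed.

Lemma seminorm_mono f r r' : 0 <= r -> r <= r' ->
  Hb_seminorm A r (sval f) <= Hb_seminorm A r' (sval f).
Proof.
move=> r0 rr'; have fP := Hexp f.
apply: (cvg_le (rsum_cvg (seminorm_rsum cA fP r0))) => n.
have [_ fS _] := seminorm_rsum cA fP (le_trans r0 rr').
apply: le_trans (fS n); apply: ler_sum => k _.
rewrite ler_wpM2l ?(coefnorm_ge0 cA (exp_ideal fP))//.
by apply: lerXn2r; rewrite ?nnegrE// (le_trans r0).
Qed.

Lemma Hdist_mono f g r r' : 0 <= r -> r <= r' -> Hdist r f g <= Hdist r' f g.
Proof. by have [h hE] := Hb_sub f g; rewrite /Hdist -hE; exact: seminorm_mono. Qed.

Lemma Hdist_refl f r : 0 <= r -> Hdist r f f = 0.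
Proof.
move=> r0; have [h hE] := Hb_sub f f.
have zE : sval h = 0 by rewrite hE subrr.
have e0 : expansion A (fun k => (-1 : R[i]) *: taylor (sval f) k + taylor (sval f) k) (sval h).
  by have := expansion_lin cA (-1) (Hexp f) (Hexp f); rewrite scaleN1r addNr zE.
have [b0 bS bt] := seminorm_rsum cA e0 r0.
rewrite /Hdist -hE; apply: cvg_unique (rsum_cvg (seminorm_rsum cA e0 r0)) _ => //.
rewrite (_ : (fun n => _) = fun=> 0); first exact: cvg_cst.
apply/funext => n; apply: big1 => k _; rewrite /coefnorm scaleN1r addNr.
case: eqP => [_|/eqP]; first by rewrite (_ : nrm _ = 0) ?mul0r//; exact: nrm0.
by rewrite -lt0n => k0; rewrite scaleN1r addNr (ideal_norm0 (coherent_ideal cA k0)) mul0r.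
Qed.

(** The seminorms increase with r, so finitely many of the balls of the subbase around
    various centres contain one ball around f. *)
Lemma Hb_nbhsP f (U : set H) : nbhs f U <->
  exists r e, [/\ 0 < r, 0 < e & forall g, Hdist r g f < e -> U g].
Proof.
split=> [|[r [e [r0 e0 HU]]]].
  rewrite nbhsE => -[B [[D' sD' <-] Bf] BU].
  have [] := @subbase_nbhd _ _ _ _ (fun U : set H => exists r e,
    [/\ 0 < r, 0 < e & forall g, Hdist r g f < e -> U g]) f _ _ _ _ D' sD' Bf.
  - by exists 1, 1.
  - move=> V W [r [e [r0 e0 HV]]] [r' [e' [r'0 e'0 HW]]].
    exists (Num.max r r'), (Num.min e e'); split; first by rewrite lt_max r0.
      by rewrite lt_min e0.
    move=> g; rewrite lt_min => /andP[ge ge']; split.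
      by apply: HV; apply: le_lt_trans ge; apply: Hdist_mono; rewrite ?le_max ?lexx// ltW.
    by apply: HW; apply: le_lt_trans ge'; apply: Hdist_mono; rewrite ?le_max ?lexx ?orbT// ltW.
  - move=> V W VW [r [e [r0 e0 HV]]]; exists r, e; split=> // g /HV; exact: VW.
  - move=> _ [f1 [r [e [r0 e0 ->]]]] /= ff1.
    exists r, (e - Hdist r f f1); split=> //; first by rewrite subr_gt0.
    move=> g; rewrite ltrBrDr; apply: le_lt_trans.
    exact: Hdist_triangle (ltW r0).
  move=> r [e [r0 e0 HB]]; exists r, e; split=> // g /HB; exact: BU.
rewrite nbhsE; exists [set g | Hdist r g f < e]; last by move=> g; exact: HU.
split; last by rewrite /= Hdist_refl// ltW.
exists [set [set g | Hdist r g f < e]]; last by rewrite bigcup_set1.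
by move=> _ ->; apply: finI_from1; exists f, r, e.
Qed.

(** The estimate of translate, with the factor alpha coming from the Aron-Berner
    extension. *)
Lemma Hdist_tau z f g r : 0 <= r ->
  Hdist r (tau z f) (tau z g) <= Hdist (alpha * (r + C * nrm z)) f g.
Proof.
move=> r0; have [h hE] := Hb_lin (-1) g f.
have hB : sval h = sval f - sval g by rewrite hE scaleN1r addrC.
have thE := tau_linear z hE.
have [Q [_ hQ _ hb]] := AB_translate cA rA alpha0 hAB hC z (Hexp h).
have tE : sval (tau z f) - sval (tau z g) = (fun x => AB (sval h) (z + canon x)).
  move: thE (tau_sval z h); case: (tau z f) => tf /= _; case: (tau z g) => tg /= _.
  by case: (tau z h) => th /= _ thE <-; rewrite thE scaleN1r addrC.
rewrite /Hdist tE -hB; exact: cvg_le (rsum_cvg (seminorm_rsum cA hQ r0)) (hb r r0).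
Qed.

Lemma tau_continuous z : continuous (tau z : H -> H).
Proof.
move=> f U /Hb_nbhsP[r [e [r0 e0 HU]]]; apply/Hb_nbhsP.
have r'0 : 0 < alpha * (r + C * nrm z).
  rewrite mulr_gt0// ltr_pwDl// mulr_ge0 ?nrm_ge0//; apply: le_trans hC.1; exact: ler01.
exists (alpha * (r + C * nrm z)), e; split=> // g gf; apply: HU.
exact: le_lt_trans (Hdist_tau _ _ _ (ltW r0)) gf.
Qed.

Lemma spectrum_eq phi psi : sval phi = sval psi -> phi = psi.
Proof.
case: phi psi => [f hf] [g hg] /= fg; move: hf; rewrite fg => hf.
by congr exist; exact: Prop_irrelevance.
Qed.

(** The composite is nonzero because tau z is onto, with right inverse tau (- z). *)
Lemma act_character phi z : is_character (sval phi \o tau z).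
Proof.
have hphi := svalP phi; split.
- move=> a f g h /(tau_linear z) thE; exact: (character_linear hphi thE).
- move=> f g h /(tau_mul z) thE; exact: (character_mul hphi thE).
- move=> f; apply: continuous_comp; first exact: tau_continuous.
  exact: character_continuous hphi _.
- have [f phif] := character_neq0 hphi; exists (tau (- z) f).
  by rewrite /= tauD addNr tau0.
Qed.

Definition act phi z : M := exist _ _ (act_character phi z).

Lemma act0 phi : act phi 0 = phi.
Proof. by apply: spectrum_eq; apply/funext => f /=; rewrite tau0. Qed.

Lemma actD phi z w : act (act phi z) w = act phi (z + w).
Proof. by apply: spectrum_eq; apply/funext => f /=; rewrite tauD addrC. Qed.

(** By the group law, the ball of radius e - |z| around phi \o tau z lies in the ball
    of radius e around phi, so the subbase is already a base. *)
Lemma spectrum_nbhsP phi (U : set M) : nbhs phi U <->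
  exists2 e : R, 0 < e & forall z, nrm z < e -> U (act phi z).
Proof.
split=> [|[e e0 HU]].
  rewrite nbhsE => -[B [[D' sD' <-] Bf] BU].
  have [] := @subbase_nbhd _ _ _ _ (fun U : set M => exists2 e : R, 0 < e &
    forall z, nrm z < e -> U (act phi z)) phi _ _ _ _ D' sD' Bf.
  - by exists 1.
  - move=> V W [e e0 HV] [e' e'0 HW]; exists (Num.min e e'); first by rewrite lt_min e0.
    by move=> z; rewrite lt_min => /andP[ze ze']; split; [exact: HV|exact: HW].
  - by move=> V W VW [e e0 HV]; exists e => // z /HV; exact: VW.
  - move=> _ [psi [e [e0 ->]]] [z ze phiE].
    exists (e - nrm z); first by rewrite subr_gt0.
    move=> w; rewrite ltrBrDl => we; exists (z + w).
      by apply: le_lt_trans (nrmD _ _) we.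
    by apply/funext => f; rewrite /= phiE /= tauD addrC.
  by move=> e e0 HB; exists e => // z /HB; exact: BU.
rewrite nbhsE; exists (spectrum_nbhd phi e).
  split; last by exists 0; rewrite ?nrm0//; apply/funext => f /=; rewrite tau0.
  exists [set spectrum_nbhd phi e]; last by rewrite bigcup_set1.
  by move=> _ ->; apply: finI_from1; exists phi, e.
move=> psi [z ze psiE]; rewrite (_ : psi = act phi z); first exact: HU.
exact: spectrum_eq.
Qed.

Lemma rapid_finite (c : nat -> R) : (forall k, (1 < k)%N -> c k = 0) -> rapid c.
Proof.
move=> c0 r r0; exists (`|c 0%N| + `|c 1%N * r|) => n.
have cn0 k : 0 <= `|c k * r ^+ k| by [].
apply: le_trans (_ : \sum_(k < n) `|c k * r ^+ k| <= _).
  by apply: ler_sum => k _; exact: ler_norm.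
apply: le_trans (rsum_nondecr cn0 (leq_addl 2 n)) _.
rewrite big_split_ord/= big_ord_recl big_ord1 /= [X in _ + X]big1 ?addr0.
  by rewrite expr0 mulr1 expr1.
by move=> k _; rewrite c0// mul0r normr0.
Qed.

Lemma cst_expansion (c : scalars R) : expansion A
  (fun k => if k == 0%N then fun=> c else 0) (fun _ : E => c).
Proof.
split=> // [k k0|r|x].
- by rewrite gtn_eqF//; exact: ideal_0 (coherent_ideal cA k0) _.
- apply: rapid_finite => k k1; have k0 : (0 < k)%N by apply: leq_trans k1.
  by rewrite /coefnorm gtn_eqF// (ideal_norm0 (coherent_ideal cA k0)).
- move=> e e0; exists 1%N => n n1; rewrite -(subnKC n1) big_split_ord/= big_ord1/=.
  by rewrite big1// addr0 subrr nrm0.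
Qed.

Lemma dual_ideal (g : dual E) : A 1%N E g /\ ideal_norm (A 1%N) g <= nrm g.
Proof.
have h1 := coherent_ideal cA (ltn0Sn 0); have [pA pn] := ideal_pow h1.
have [gA gn] := ideal_comp h1 g pA.
rewrite pn mul1r expr1 in gn.
by rewrite (_ : (g : E -> scalars R) = (fun z : scalars R => z ^+ 1) \o g).
Qed.

Lemma dual_expansion (g : dual E) : expansion A
  (fun k => if k == 1%N then (g : E -> scalars R) else 0) g.
Proof.
split=> // [k k0|r|x].
- by case: eqP => [->|_]; [exact: (dual_ideal g).1|exact: ideal_0 (coherent_ideal cA k0) _].
- apply: rapid_finite => k k1; have k0 : (0 < k)%N by apply: leq_trans k1.
  by rewrite /coefnorm !gtn_eqF// (ideal_norm0 (coherent_ideal cA k0)).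
- move=> e e0; exists 2%N => n n1; rewrite -(subnKC n1) big_split_ord/=.
  rewrite big_ord_recl big_ord1/= [\sum_(i < n - 2) _]big1//.
  by rewrite !(addr0, add0r) subrr nrm0.
Qed.

Definition one_Hb : H := mkHb (cst_expansion 1).
Definition dual_Hb (g : dual E) : H := mkHb (dual_expansion g).

Lemma AB_dual (g : dual E) w : AB (g : E -> scalars R) w = w g.
Proof.
apply: (tends_unique (exp_sums (AB_expansion cA alpha0 hAB (dual_expansion g)) w)).
have AB1 : aron_berner 1 (g : E -> scalars R) = fun w => w g.
  have wg : wform (fun z : 'I_1 -> bidual E => z ord0 g).
    by move=> x i; exists g => v; rewrite /upd (ord1 i).
  by rewrite (aron_bernerE (P := g) wg).
have AB0 k : aron_berner k (0 : E -> scalars R) = fun=> 0.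
  by apply: (@aron_bernerE _ _ k _ (fun=> 0)) => // x i; exact: evaluation_lin_closed.1.
move=> e e0; exists 2%N => n n1; rewrite -(subnKC n1) big_split_ord/=.
rewrite big_ord_recl big_ord1/= [\sum_(i < n - 2) _]big1; last by move=> k _; rewrite AB0.
by rewrite AB0 AB1 !(addr0, add0r) subrr nrm0.
Qed.

Lemma character_one phi : sval phi one_Hb = 1.
Proof.
have hphi := svalP phi; have [f phif] := character_neq0 hphi.
have := character_mul hphi (_ : sval f = (fun x => sval f x * sval one_Hb x)).
move=> H1; apply: (@mulfI R[i] (sval phi f)) => //.
rewrite mulr1; apply/esym; apply: H1; apply/funext => x /=.
by rewrite mulr1.
Qed.

Lemma dual_Hb_lin (a : R[i]) (g g' : dual E) :
  sval (dual_Hb (a *: g + g')) = a *: sval (dual_Hb g) + sval (dual_Hb g').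
Proof. by []. Qed.

(** A continuous character is bounded by 1 on a ball of some seminorm p_r, and p_r of a
    functional g is at most r |g|; homogeneity turns this into a bound on E'. *)
Lemma character_dual_bound phi : exists K : R, forall g : dual E,
  nrm (sval phi (dual_Hb g)) <= K * nrm g.
Proof.
have hphi := svalP phi; have [lphi _ cphi _] := hphi.
have phi0 : sval phi (dual_Hb 0) = 0.
  have H0 : sval (dual_Hb 0) = (-1 : R[i]) *: sval (dual_Hb 0) + sval (dual_Hb 0).
    by rewrite scaleN1r addNr.
  by rewrite (lphi _ _ _ _ H0) scaleN1r addNr.
have : nbhs (dual_Hb 0) [set f | nrm (sval phi f) < 1].
  apply: (cphi (dual_Hb 0) [set y : scalars R | nrm y < 1]).
  rewrite phi0; apply/nbhs_ballP; exists 1 => //= y.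
  by rewrite -[1]/(1%:C%C) ball_nrmE /= nrmB subr0.
move=> /Hb_nbhsP[r [e [r0 e0 He]]].
have small (g : dual E) : nrm g < e / r -> nrm (sval phi (dual_Hb g)) < 1.
  move=> ge; apply: He; rewrite /Hdist.
  have -> : sval (dual_Hb g) - sval (dual_Hb 0) = g :> (E -> scalars R).
    by apply/funext => x; rewrite /= [LHS]subr0.
  apply: le_lt_trans (_ : nrm g * r < _); last by rewrite -ltr_pdivlMr.
  apply: (cvg_le (rsum_cvg (seminorm_rsum cA (dual_expansion g) (ltW r0)))) => n.
  have b0 k : 0 <= coefnorm A (fun k => if k == 1%N then (g : E -> scalars R) else 0) k * r ^+ k.
    apply: mulr_ge0; last by rewrite exprn_ge0// ltW.
    exact: (coefnorm_ge0 cA (exp_ideal (dual_expansion g))).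
  apply: le_trans (rsum_nondecr b0 (leq_addl 2 n)) _.
  rewrite big_split_ord/= big_ord_recl big_ord1 /= [X in _ + X]big1 ?addr0.
    rewrite /coefnorm /= nrm0 mul0r add0r expr1.
    by apply: ler_wpM2r; [exact: ltW|exact: (dual_ideal g).2].
  by move=> k _; rewrite /coefnorm /= (ideal_norm0 (coherent_ideal cA _))// mul0r.
exists (2 * r / e) => g.
have [/nrm_eq0->|g0] := eqVneq (nrm g) 0; first by rewrite phi0 !nrm0 mulr0.
have {}g0 : 0 < nrm g by rewrite lt_neqAle eq_sym g0 nrm_ge0.
(* Half of the admissible radius, since the bound on small g is strict. *)
pose s := e / r / 2 / nrm g.
have s0 : 0 < s by rewrite !divr_gt0.
have sg : nrm ((s%:C%C : R[i]) *: g) < e / r.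
  rewrite -[(s%:C)%C]expr1 nrm_rpow expr1 gtr0_norm// /s divfK ?gt_eqF//.
  by rewrite ltr_pdivrMr// ltr_pMr ?divr_gt0// ltr1n.
have := small _ sg.
have -> : sval phi (dual_Hb ((s%:C%C : R[i]) *: g)) = (s%:C%C : R[i]) *: sval phi (dual_Hb g).
  have Hs := dual_Hb_lin (s%:C%C) g 0; rewrite addr0 in Hs.
  by rewrite (lphi _ _ _ _ Hs) phi0 addr0.
rewrite -[(s%:C)%C]expr1 nrm_rpow expr1 gtr0_norm// mulrC -ltr_pdivlMr// mul1r.
move=> /ltW/le_trans; apply; rewrite /s le_eqVlt; apply/orP; left; apply/eqP.
by field; rewrite !gt_eqF.
Qed.

Lemma spectrum_projE phi (g : dual E) : spectrum_proj phi g = sval phi (dual_Hb g).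
Proof.
have [K HK] := character_dual_bound phi.
have lin : linear (fun g : dual E => sval phi (dual_Hb g)).
  move=> a g1 g2; exact: (character_linear (svalP phi) (dual_Hb_lin a g1 g2)).
pose z : bidual E := Clin (bounded_clinear lin HK).
pose X := [set z : bidual E | forall (g : dual E) (f : H),
    sval f = g :> (E -> scalars R) -> z g = sval phi f].
have Xz : X z.
  move=> g' f fg; rewrite -[LHS]/(sval phi (dual_Hb g')); congr (sval phi _).
  exact/esym/Hb_eq.
exact: (@xgetI _ 0 X z Xz g (dual_Hb g) erefl).
Qed.

(** On functionals the translation is tau z g = z g + g, the sum of g and a constant,
    and a character maps the constant 1 to 1. *)
Lemma proj_act phi z : spectrum_proj (act phi z) = spectrum_proj phi + z.
Proof.
apply: clin_ext => g; rewrite spectrum_projE /=.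
rewrite [RHS](_ : _ = spectrum_proj phi g + z g)// spectrum_projE.
have := character_linear (svalP phi) (_ : sval (tau z (dual_Hb g)) =
  (z g : R[i]) *: sval one_Hb + sval (dual_Hb g)).
move=> ->; first by rewrite character_one addrC; congr (_ + _); exact: mulr1.
rewrite tau_sval; apply/funext => x; rewrite AB_dual.
rewrite -[LHS]/(z g + canon x g); congr (_ + _).
by rewrite -[RHS]/((z g : R[i]) * 1) mulr1.
Qed.

End Translations.

(** * The sheets of the spectrum *)

Section Sheets.
Context {R : realType}.
Variables (A : nat -> poly_ideal R) (cA : coherent A) (E : banach R).
Hypothesis rA : regular_at A E.
Variables (alpha : R) (alpha0 : 0 < alpha).
Hypothesis hAB : forall (E : banach R) k, (0 < k)%N -> forall P : E -> scalars R, A k E P ->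
  A k (bidual E) (aron_berner k P) /\
  ideal_norm (A k) (aron_berner k P) <= alpha ^+ k * ideal_norm (A k) P.
Variables (C : R) (hC : pfix_bound A C).
Notation M := (spectrum A E).
Notation proj := (@spectrum_proj R A E).
Notation action := (act cA rA alpha0 hAB hC).
Implicit Types (phi psi : M) (z w : bidual E).

Let proj_action := proj_act cA rA alpha0 hAB hC.
Let actionD := actD cA rA alpha0 hAB hC.
Let nbhs_spectrumP := spectrum_nbhsP cA rA alpha0 hAB hC.

Lemma nbhs_nrmP (F : normedModType R[i]) (x : F) (U : set F) : nbhs x U <->
  exists2 e : R, 0 < e & forall y, nrm (x - y) < e -> U y.
Proof.
split=> [/nbhs_ballP[_ /= /pos_realC[e e0 ->] eU]|[e e0 eU]].
  by exists e => // y xy; apply: eU; rewrite ball_nrmE.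
apply/nbhs_ballP; exists (e%:C%C) => /=; first by rewrite ltcR.
by rewrite ball_nrmE => y; exact: eU.
Qed.

(** Equivariance: the projection maps V_(phi, e) into the ball of radius e. *)
Lemma proj_continuous : continuous proj.
Proof.
move=> phi U /nbhs_nrmP[e e0 eU]; apply/nbhs_spectrumP; exists e => // z ze.
rewrite /preimage /=; apply: eU; rewrite proj_action opprD addrA subrr add0r.
by rewrite -sub0r nrmB subr0.
Qed.

(** The inverse of the projection on the sheet of phi. *)
Definition sheet_section phi w : M := action phi (w - proj phi).

Lemma proj_section phi w : proj (sheet_section phi w) = w.
Proof. by rewrite proj_action addrC subrK. Qed.

Lemma section_proj phi z : sheet_section phi (proj (action phi z)) = action phi z.
Proof. by rewrite /sheet_section proj_action addrAC subrr add0r. Qed.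

Lemma section_continuous phi : continuous (sheet_section phi).
Proof.
move=> w U /nbhs_spectrumP[e e0 eU]; apply/nbhs_nrmP; exists e => // v vw.
rewrite /preimage /=; have -> : sheet_section phi v = action (sheet_section phi w) (v - w).
  by rewrite actionD addrC addrA subrK.
by apply: eU; rewrite nrmB.
Qed.

Definition sheet phi : set M := range (action phi).

Lemma sheet_refl phi : sheet phi phi.
Proof. by exists 0 => //; exact: act0. Qed.

Lemma sheet_act phi psi z : sheet phi (action psi z) -> sheet phi psi.
Proof.
move=> [w _ wE]; exists (w - z) => //.
by rewrite -actionD wE actionD subrr act0.
Qed.

Lemma act_sheet phi psi z : sheet phi psi -> sheet phi (action psi z).
Proof. by move=> [w _ <-]; exists (w + z) => //; rewrite actionD. Qed.

Lemma sheet_open phi : open (sheet phi).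
Proof.
rewrite openE => psi ps; apply/nbhs_spectrumP; exists 1 => // z _; exact: act_sheet.
Qed.

(** An orbit that meets every neighbourhood of psi meets the orbit of psi, which is
    one of them. *)
Lemma sheet_closed phi : closed (sheet phi).
Proof.
move=> psi pc; have : nbhs psi [set action psi z | z in [set: bidual E]].
  by apply/nbhs_spectrumP; exists 1 => // z _; exists z.
by move=> /pc[chi [/= ps [z _ zE]]]; apply: (@sheet_act _ _ z); rewrite zE.
Qed.

(** The sheet is the union of the images of the real lines through 0, all of which
    contain phi. *)
Lemma sheet_connected phi : connected (sheet phi).
Proof.
pose line z (t : R) := action phi ((t%:C%C : R[i]) *: z).
have -> : sheet phi = \bigcup_(z in [set: bidual E]) range (line z).
  apply/seteqP; split=> [_ [z _ <-]|_ [z _ [t _ <-]]].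
    exists z; first by [].
    exists 1; first by [].
    by rewrite /line (_ : (1%:C%C : R[i]) *: z = z)//; exact: scale1r.
  by exists ((t%:C%C : R[i]) *: z).
apply: bigcup_connected => [|z _].
  exists (action phi 0) => z _; exists 0; first by [].
  by rewrite /line (_ : (0%:C%C : R[i]) *: z = 0)//; exact: scale0r.
apply: connected_continuous_connected; first exact/connected_intervalP.
apply: continuous_subspaceT => t U /nbhs_spectrumP[e e0 eU].
have nz : 0 < nrm z + 1 by rewrite ltr_wpDl ?nrm_ge0.
apply/nbhs_ballP; exists (e / (nrm z + 1)) => /=; first exact: divr_gt0.
move=> s; rewrite /ball /= ltr_pdivlMr// => st.
rewrite /preimage /=.
have -> : line z s = action (line z t) (((s - t)%:C%C : R[i]) *: z).
  by rewrite /line actionD -scalerDl -rmorphD addrC subrK.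
apply: eU; rewrite -[((s - t)%:C)%C]expr1 nrm_rpow expr1 distrC.
by apply: le_lt_trans st; rewrite ler_wpM2l// lerDl.
Qed.

Lemma component_sheet phi : connected_component [set: M] phi = sheet phi.
Proof.
apply/seteqP; split; last first.
  by apply: connected_component_max => //; [exact: sheet_refl|exact: sheet_connected].
move=> psi [B [Bphi _ Bc] Bpsi].
suff BE : B `&` sheet phi = B by move: Bpsi; rewrite -BE => -[].
apply: Bc.
- by exists phi; split=> //; exact: sheet_refl.
- by exists (sheet phi) => //; exact: sheet_open.
- by exists (sheet phi) => //; exact: sheet_closed.
Qed.

(** Suppose that all neighbourhoods of phi and psi meet. Comparing projections
    gives proj phi = proj psi; then phi \o tau z = psi \o tau w forces z = w, and
    undoing the translation gives phi = psi. *)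
Lemma spectrum_hausdorff : hausdorff_space M.
Proof.
move=> phi psi cl.
have meet (e : R) : 0 < e -> exists z w, [/\ nrm z < e, nrm w < e & action phi z = action psi w].
  move=> e0; have nb chi : nbhs chi [set action chi z | z in [set z | nrm z < e]].
    by apply/nbhs_spectrumP; exists e => // z ze; exists z.
  by have [_ [[z ze <-] [w we wE]]] := cl _ _ (nb phi) (nb psi); exists z, w.
have [pp|pp] := eqVneq (proj phi) (proj psi).
  have [z [w [_ _ zw]]] := meet 1 ltr01.
  have /addrI zwE : proj phi + z = proj phi + w by rewrite -proj_action zw proj_action pp.
  by rewrite -(act0 cA rA alpha0 hAB hC phi) -(act0 cA rA alpha0 hAB hC psi) -(subrr z)
    -actionD zw actionD zwE.
have d0 : 0 < nrm (proj phi - proj psi).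
  rewrite lt_neqAle nrm_ge0 andbT eq_sym; apply: contra pp => /eqP/nrm_eq0/eqP.
  by rewrite subr_eq0.
have [z [w [ze we zw]]] := meet _ (divr_gt0 d0 (ltr0n R 2)).
have dE : proj phi - proj psi = w - z.
  have pz : proj phi + z = proj psi + w by rewrite -proj_action zw proj_action.
  by apply/eqP; rewrite subr_eq addrAC eq_sym subr_eq pz addrC.
have : nrm (proj phi - proj psi) < nrm (proj phi - proj psi).
  rewrite {1}dE; apply: le_lt_trans (nrmD _ _) _.
  by rewrite -(sub0r z) nrmB subr0 [ltRHS]splitr ltrD.
by rewrite ltxx.
Qed.

Lemma spectrum_riemann : riemann_domain proj.
Proof.
split; first exact: spectrum_hausdorff.
move=> phi; exists (sheet phi).
have pT : proj @` sheet phi = setT.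
  apply/seteqP; split=> // w _; exists (sheet_section phi w); last exact: proj_section.
  by exists (w - proj phi).
split; [exact: sheet_open|exact: sheet_refl|by rewrite pT; exact: openT| |].
  exact/continuous_subspaceT/proj_continuous.
exists (sheet_section phi); last exact/continuous_subspaceT/section_continuous.
by move=> _ /set_mem[z _ <-]; exact: section_proj.
Qed.

Lemma component_homeomorphic phi :
  homeomorphic (set_type (connected_component [set: M] phi)) (bidual E).
Proof.
rewrite component_sheet.
have inS w : sheet_section phi w \in sheet phi by apply/mem_set; exists (w - proj phi).
exists (fun x => proj (set_val x)), (fun w => SigSub (inS w)); split.
- move=> [psi psiS]; apply: val_inj.
  suff : sheet_section phi (proj psi) = psi by [].
  by move/set_mem : psiS => [z _ <-]; exact: section_proj.
- by move=> w; exact: proj_section.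
- move=> x; apply: continuous_comp; first exact: initial_continuous.
  exact: proj_continuous.
- move=> w U [_ [[V Vop <-] Vw VU]].
  have : nbhs (sheet_section phi w) V by exact: open_nbhs_nbhs.
  move=> /section_continuous Vnear.
  apply: (@filterS _ (nbhs w) _ (sheet_section phi @^-1` V) _ _ Vnear) => v Vv.
  exact: VU.
Qed.

End Sheets.

Theorem proposition3p13 (R : realType) (A : nat -> poly_ideal R) (E : banach R) :
  multiplicative_seq A -> AB_closed A -> regular_at A E ->
  riemann_domain (@spectrum_proj R A E) /\
  forall phi : spectrum A E,
    homeomorphic (set_type (connected_component [set: spectrum A E] phi))
                 (bidual E).
Proof.
move=> [cA _] [alpha alpha0 hAB] rA; have [C hC] := coherent_pfix_bound cA.
split; first exact: (spectrum_riemann cA rA alpha0 hAB hC).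
exact: (component_homeomorphic cA rA alpha0 hAB hC).
Qed.
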